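(* Let $K\subset\mathbb{N}$ be arbitrary, let $I\subset\mathbb{R}$ be a bounded and symmetric interval, and let $$L=\bigcup_{n\in K}\Big(\big(-\log(n+1),-\log n\big]\cup\big[\log n,\log(n+1)\big)\Big)\subset\mathbb{R}.$$ Then there exists a compact operator $\Phi_{K,I}$ on $L^2(I)$ such that $$\mathcal{Z}_{K,I}=\chi_I\,\mathcal{F}^{-1}\chi_L\mathcal{F}+\Phi_{K,I}.$$
   Context: $\mathbb{N}=\{1,2,3,\dots\}$. A bounded symmetric interval is $I=(-T,T)$ with $0<T<\infty$. For $K\subset\mathbb{N}$, $\zeta_K(s)=\sum_{n\in K}n^{-s}$, absolutely convergent for $\operatorname{Re}s>1$. The operator $\mathcal{Z}_{K,I}:L^2(I)\to L^2(I)$ is defined by $$\mathcal{Z}_{K,I}g(t)=\lim_{\delta\to0^+}\frac{\chi_I(t)}{\pi}\int_I g(\tau)\operatorname{Re}\zeta_K(1+\delta+\mathrm{i}(t-\tau))\,\mathrm{d}\tau,$$ with the limit taken in $L^2(I)$ (this is a bounded operator on $L^2(I)$). $L^2(I)$ is identified with the subspace of $L^2(\mathbb{R})$ of functions supported in $I$; $\chi_E$ denotes the characteristic function of a set $E$, and also the operator of multiplication by it. $\mathcal{F}$ is the unitary Fourier transform on $L^2(\mathbb{R})$, $\mathcal{F}g(t)=\frac{1}{\sqrt{2\pi}}\int_{\mathbb{R}}g(\xi)\mathrm{e}^{-\mathrm{i}\xi t}\,\mathrm{d}\xi$. The operator $\chi_I\mathcal{F}^{-1}\chi_L\mathcal{F}$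 is considered as an operator from $L^2(I)$ to $L^2(I)$. *)

(* Defs.v *)
From HB Require Import structures.
From mathcomp Require Import all_boot all_order all_algebra.
From mathcomp Require Import generic_quotient ring_quotient.
From mathcomp Require Import all_classical all_reals all_analysis.
From mathcomp Require Import measurable_realfun.

Set Implicit Arguments.
Unset Strict Implicit.
Unset Printing Implicit Defensive.

Import Order.TTheory GRing.Theory Num.Theory.
Import numFieldNormedType.Exports.
From mathcomp Require Import complex.
Import Normc.

Local Open Scope classical_set_scope.
Local Open Scope ring_scope.
Local Open Scope complex_scope.

Section L2.
Context {R : realType}.
Local Notation mu := (@lebesgue_measure R).
Implicit Types (f g : R -> R[i]) (A : set R).

Definition square_integrable f :=
  [/\ measurable_fun setT (fun x => Re (f x)),
      measurable_fun setT (fun x => Im (f x)) &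
      finite_norm mu 2%:E (fun x => normc (f x))].

(* Square-integrable functions on the whole line that vanish off A: L^2(A) is
   seen inside L^2(R), so A need not be measurable. *)
Definition L2pred A : {pred R -> R[i]} :=
  [pred f | `[< square_integrable f /\ forall x, ~ A x -> f x = 0 >]].

Lemma normc_ge0 (z : R[i]) : 0 <= normc z.
Proof. by case: z => a b; exact: sqrtr_ge0. Qed.

Lemma measurable_normc f : measurable_fun setT (fun x => Re (f x)) ->
  measurable_fun setT (fun x => Im (f x)) ->
  measurable_fun setT (fun x => normc (f x)).
Proof.
move=> mre mim.
rewrite (_ : (fun x => _) = Num.sqrt \o
    (fun x => Re (f x) ^+ 2 + Im (f x) ^+ 2)); last first.
  by apply/funext => x /=; case: (f x).
apply: measurableT_comp.
  by apply: continuous_measurable_fun; exact: sqrt_continuous.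
by apply: measurable_funD; apply: measurable_funX.
Qed.

Lemma Lnorm2_le (u v : R -> R) : measurable_fun setT u -> measurable_fun setT v ->
  (forall x, 0 <= u x <= v x) ->
  ('N[mu]_2%:E[EFin \o u] <= 'N[mu]_2%:E[EFin \o v])%E.
Proof.
move=> mu_ mv uv; rewrite unlock /Lnorm.
have mp (w : R -> R) : measurable_fun setT w ->
    measurable_fun setT (fun x => `|(w x)%:E| `^ 2%R)%E.
  move=> mw; apply: (@measurableT_comp _ _ _ _ _ _ (fun x => x `^ 2%R)%E) => /=.
    exact: measurable_poweR.
  by do 2 apply: measurableT_comp => //.
apply: gt0_ler_poweR.
- by rewrite invr_ge0.
- by rewrite in_itv /= leey andbT integral_ge0// => x _; exact: poweR_ge0.
- by rewrite in_itv /= leey andbT integral_ge0// => x _; exact: poweR_ge0.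
apply: (@ge0_le_integral _ _ R mu setT measurableT) => [x _| | |x _ /=].
- exact: poweR_ge0.
- exact: mp mu_.
- exact: mp mv.
 have /andP[u0 uvx] := uv x.
rewrite !ger0_norm ?(le_trans u0)// lee_fin.
by apply: ge0_ler_powR => //; rewrite nnegrE ?(le_trans u0).
Qed.


Lemma ReD (z w : R[i]) : Re (z + w) = Re z + Re w.
Proof. by case: z w => [a b] [c d]. Qed.

Lemma ImD (z w : R[i]) : Im (z + w) = Im z + Im w.
Proof. by case: z w => [a b] [c d]. Qed.

Lemma ReM (z w : R[i]) : Re (z * w) = Re z * Re w - Im z * Im w.
Proof. by case: z w => [a b] [c d]. Qed.

Lemma ImM (z w : R[i]) : Im (z * w) = Re z * Im w + Im z * Re w.
Proof. by case: z w => [a b] [c d]. Qed.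

Lemma square_integrable_normc_Lfun f :
  square_integrable f -> (fun x => normc (f x)) \in Lfun mu 2%:E.
Proof.
move=> [fr fi fn]; rewrite inE; apply/andP; split; apply/mem_set => //=.
exact: measurable_normc.
Qed.

Lemma Lnorm2_normcZ (a : R[i]) f : square_integrable f ->
  ('N[mu]_2%:E[EFin \o (fun x => normc (a * f x)%R)] =
   (normc a)%:E * 'N[mu]_2%:E[EFin \o (fun x => normc (f x))])%E.
Proof.
move=> /square_integrable_normc_Lfun fL.
have := LnormZ (Lfun_Sub (lee1n 2) fL) (normc a).
rewrite ger0_norm ?normc_ge0// => <-.
by apply: eq_Lnorm => x /=; rewrite normcM.
Qed.

Lemma Lnorm2_normcD f g : square_integrable f -> square_integrable g ->
  ('N[mu]_2%:E[EFin \o (fun x => normc (f x + g x)%R)] <=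
   'N[mu]_2%:E[EFin \o (fun x => normc (f x))] +
   'N[mu]_2%:E[EFin \o (fun x => normc (g x))])%E.
Proof.
move=> [fr fi fn] [gr gi gn].
have mf := measurable_normc fr fi; have mg := measurable_normc gr gi.
apply: le_trans (@eminkowski _ _ _ mu _ _ 2%:E mf mg (lee1n 2)).
apply: Lnorm2_le.
- apply: measurable_normc.
  + by under eq_fun do rewrite ReD; exact: measurable_funD.
  + by under eq_fun do rewrite ImD; exact: measurable_funD.
- exact: measurable_funD.
- by move=> x; rewrite normc_ge0/=; exact: le_normcD.
Qed.

Lemma square_integrable0 : square_integrable (fun=> 0).
Proof.
split => //=; rewrite /finite_norm.
rewrite (_ : EFin \o _ = cst 0%E) ?Lnorm0//.
by apply/funext => x /=; rewrite expr0n addr0 sqrtr0.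
Qed.

Lemma square_integrable_lin (a : R[i]) f g :
  square_integrable f -> square_integrable g ->
  square_integrable (fun x => a * f x + g x).
Proof.
move=> sf sg.
have saf : square_integrable (fun x => a * f x).
  have [fr fi fn] := sf; split.
  - under eq_fun do rewrite ReM.
    by apply: measurable_funB; apply: measurable_funM.
  - under eq_fun do rewrite ImM.
    by apply: measurable_funD; apply: measurable_funM.
  - by rewrite /finite_norm Lnorm2_normcZ// lte_mul_pinfty// lee_fin normc_ge0.
have [[fr fi fn] [gr gi gn]] := (saf, sg); split.
- by under eq_fun do rewrite ReD; exact: measurable_funD.
- by under eq_fun do rewrite ImD; exact: measurable_funD.
- rewrite /finite_norm (le_lt_trans (Lnorm2_normcD saf sg))//.
  by rewrite lte_add_pinfty.
Qed.

Section L2A.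
Variable A : set R.

Lemma L2pred_submod_closed : submod_closed (L2pred A).
Proof.
split.
  by apply/asboolP; split => //; exact: square_integrable0.
move=> a f g /asboolP[sf f0] /asboolP[sg g0]; apply/asboolP; split.
  exact: square_integrable_lin.
by move=> x Ax; rewrite -[LHS]/(a * f x + g x) f0// g0// mulr0 addr0.
Qed.

HB.instance Definition _ :=
  GRing.isSubmodClosed.Build R[i] (R -> R[i]) (L2pred A) L2pred_submod_closed.

Record L2fun := MkL2fun { L2val :> R -> R[i] ; _ : L2val \in L2pred A }.

HB.instance Definition _ := [isSub for L2val].
HB.instance Definition _ := [Choice of L2fun by <:].
HB.instance Definition _ := [SubChoice_isSubLmodule of L2fun by <:].

Definition L2null : {pred L2fun} :=
  [pred f : L2fun | `[< {ae mu, forall x, (f : R -> R[i]) x = 0} >]].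

Lemma L2null_zmod_closed : zmod_closed L2null.
Proof.
split; first by apply/asboolP; exact: aeW.
move=> f g /asboolP f0 /asboolP g0; apply/asboolP.
have aef := ae_filter_ringOfSetsType mu.
by apply: filterS2 f0 g0 => x fx gx; rewrite -[LHS]/(f x - g x) fx gx subrr.
Qed.

HB.instance Definition _ :=
  GRing.isZmodClosed.Build L2fun L2null L2null_zmod_closed.

Definition L2 : Type := Quotient.quot L2null.

HB.instance Definition _ := GRing.Zmodule.on L2.
HB.instance Definition _ := EqQuotient.on L2.


Local Open Scope quotient_scope.

Lemma L2_eqP (f g : L2fun) :
  \pi_L2 f = \pi_L2 g <-> {ae mu, forall x, (f : R -> R[i]) x = g x}.
Proof.
have aef := ae_filter_ringOfSetsType mu.
split=> [/eqP|fg].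
  rewrite -(Quotient.idealrBE L2null) => /asboolP; apply: filterS => x fg.
  by apply/subr0_eq; rewrite -[LHS]/((f - g) x) fg.
apply/eqP; rewrite -(Quotient.idealrBE L2null); apply/asboolP.
by apply: filterS fg => x fg; rewrite -[LHS]/(f x - g x) fg subrr.
Qed.

Lemma L2_ae_repr (f : L2fun) :
  {ae mu, forall x, (repr (\pi_L2 f) : R -> R[i]) x = f x}.
Proof. by apply/L2_eqP; rewrite reprK. Qed.

Definition L2scale (a : R[i]) (u : L2) : L2 := \pi_L2 (a *: repr u).

Lemma L2scale_pi a (f : L2fun) : L2scale a (\pi_L2 f) = \pi_L2 (a *: f).
Proof.
apply/L2_eqP; have aef := ae_filter_ringOfSetsType mu.
apply: filterS (L2_ae_repr f) => x fx.
by rewrite -[LHS]/(a * repr (\pi_L2 f) x) fx.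
Qed.

Lemma L2_ind (P : L2 -> Prop) : (forall f : L2fun, P (\pi_L2 f)) -> forall u, P u.
Proof. by move=> Pf u; rewrite -[u]reprK; exact: Pf. Qed.

Lemma L2scaleA a b u : L2scale a (L2scale b u) = L2scale (a * b) u.
Proof. by elim/L2_ind: u => f; rewrite !L2scale_pi scalerA. Qed.

Lemma L2scale1 : left_id 1 L2scale.
Proof. by elim/L2_ind => f; rewrite L2scale_pi scale1r. Qed.

Lemma L2scaleDr : right_distributive L2scale +%R.
Proof.
move=> a; elim/L2_ind => f; elim/L2_ind => g.
by rewrite -[in LHS]raddfD !L2scale_pi scalerDr raddfD.
Qed.

Lemma L2scaleDl u : {morph L2scale^~ u : a b / a + b}.
Proof.
by elim/L2_ind: u => f a b; rewrite !L2scale_pi scalerDl raddfD.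
Qed.

HB.instance Definition _ := GRing.Zmodule_isLmodule.Build R[i] L2
  L2scaleA L2scale1 L2scaleDr L2scaleDl.

(* The norm is R[i]-valued since L2 is a normed module over R[i]. *)
Definition L2norm (u : L2) : R[i] :=
  (fine ('N[mu]_2%:E[EFin \o (fun x => normc (repr u x))])%E)%:C.

Lemma L2fun_square_integrable (f : L2fun) : square_integrable f.
Proof. by case: f => f /= /asboolP[]. Qed.

Lemma L2fun_Lnorm_fin (f : L2fun) :
  ('N[mu]_2%:E[EFin \o (fun x => normc (f x))])%E \is a fin_num.
Proof.
have [_ _ fn] := L2fun_square_integrable f.
by rewrite ge0_fin_numE ?Lnorm_ge0.
Qed.

Lemma measurable_L2fun_normc (f : L2fun) :
  measurable_fun setT (fun x => normc (f x)).
Proof.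
by have [fr fi _] := L2fun_square_integrable f; exact: measurable_normc.
Qed.

Lemma L2norm_pi (f : L2fun) :
  L2norm (\pi_L2 f) =
  (fine ('N[mu]_2%:E[EFin \o (fun x => normc (f x))])%E)%:C.
Proof.
rewrite /L2norm unlock /Lnorm; congr ((fine (_ `^ _))%:C)%E.
have mp (g : L2fun) :
    measurable_fun setT (fun x => `|(normc (g x))%:E| `^ 2%R)%E.
  apply: (@measurableT_comp _ _ _ _ _ _ (fun x => x `^ 2%R)%E) => /=.
    exact: measurable_poweR.
  by do 2 apply: measurableT_comp => //; exact: measurable_L2fun_normc.
apply: ae_eq_integral => //; [exact: mp|exact: mp|].
have aef := ae_filter_ringOfSetsType mu.
by apply: filterS (L2_ae_repr f) => x /= ->.
Qed.

Lemma L2normD u v : L2norm (u + v) <= L2norm u + L2norm v.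
Proof.
elim/L2_ind: u => f; elim/L2_ind: v => g; rewrite -[_ + _]raddfD !L2norm_pi.
rewrite -rmorphD lecR -lee_fin [leRHS]EFinD !fineK ?L2fun_Lnorm_fin//.
exact: (Lnorm2_normcD (L2fun_square_integrable f) (L2fun_square_integrable g)).
Qed.

Lemma L2normZ a u : L2norm (a *: u) = `|a| * L2norm u.
Proof.
elim/L2_ind: u => f; rewrite [_ *: _]L2scale_pi !L2norm_pi.
rewrite (_ : `|a| = (normc a)%:C); last by case: (a).
rewrite -rmorphM/=; congr (_ %:C).
have fin := L2fun_Lnorm_fin.
apply: EFin_inj; rewrite EFinM (fineK (fin (a *: f))) (fineK (fin f)).
exact: Lnorm2_normcZ (L2fun_square_integrable f).
Qed.

Lemma L2norm_eq0 u : L2norm u = 0 -> u = 0.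
Proof.
elim/L2_ind: u => f; rewrite L2norm_pi => -[f0].
have /Lnorm_eq0_eq0 : ('N[mu]_2%:E[EFin \o (fun x => normc (f x))] = 0)%E.
  by rewrite -[LHS]fineK ?L2fun_Lnorm_fin// f0.
have mf : measurable_fun setT (EFin \o (fun x => normc (f x))).
  by apply/measurable_EFinP; exact: measurable_L2fun_normc.
move=> /(_ mf (lte0n 2)) fae; rewrite -(raddf0 (\pi_L2)); apply/L2_eqP.
have aef := ae_filter_ringOfSetsType mu.
by apply: filterS fae => x /(_ I) /= -[]; exact: eq0_normc.
Qed.

HB.instance Definition _ :=
  Lmodule_isNormed.Build R[i] L2 L2normD L2normZ L2norm_eq0.

End L2A.
End L2.
Arguments L2 : clear implicits.

Section operators.
Context {R : realType}.
Local Notation mu := (@lebesgue_measure R).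
Implicit Types (A B D E I : set R) (K : set nat).

Definition Cintegral D (f : R -> R[i]) : R[i] :=
  (\int[mu]_(x in D) Re (f x)) +i* (\int[mu]_(x in D) Im (f x)).

Definition cexp (z : R[i]) : R[i] :=
  (expR (Re z))%:C * (cos (Im z) +i* sin (Im z)).

(* Class in L2 A of a function; 0 when f is not square-integrable or does not
   vanish off A. *)
Definition L2class A (f : R -> R[i]) : L2 R A :=
  \pi_(L2 R A)%qT (insubd (0 : L2fun A) f).

(* Multiplication by the characteristic function of E, landing in L2 B. With
   E := setT it is the inclusion of L2 A into L2 B for A `<=` B. *)
Definition chi B E A (u : L2 R A) : L2 R B :=
  L2class B (patch (fun=> 0) E (repr u)).

Definition fourier_trunc (N : nat) (g : R -> R[i]) (t : R) : R[i] :=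
  ((Num.sqrt (2 * pi))^-1)%:C *
  Cintegral `]- N%:R, N%:R[ (fun xi => g xi * cexp (0 -i* (xi * t))).

(* The Fourier integral need not converge absolutely on L^2(R), hence the limit
   in the L^2 norm of the integrals over ]-N, N[. *)
Definition fourier (u : L2 R setT) : L2 R setT :=
  limn (fun N => L2class setT (fourier_trunc N (repr u))).

(* fourier is bijective by Plancherel's theorem, so this is its inverse. *)
Definition fourier_inv : L2 R setT -> L2 R setT := 'pinv_(fun=> 0) setT fourier.

(* Meant for K not containing 0; the sum converges absolutely if Re s > 1. *)
Definition zeta K (s : R[i]) : R[i] :=
  limn (fun N => \sum_(0 <= n < N | n \in K)
    cexp (- (s * (ln n%:R)%:C)) : R[i]^o).

(* The operator whose limit as delta --> 0^'+, in the norm of L2 R I, is Zop. *)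
Definition Zdelta K I (delta : R) (g : L2 R I) : L2 R I :=
  L2class I (patch (fun=> 0) I (fun t => (pi^-1)%:C * Cintegral I (fun tau =>
    (repr g : R -> R[i]) tau *
    (Re (zeta K ((1 + delta) +i* (t - tau))))%:C))).

Definition Zop K I (g : L2 R I) : L2 R I :=
  lim (Zdelta K delta g @[delta --> 0^'+]).

Definition Lset K : set R :=
  \bigcup_(n in K) (`]- ln n.+1%:R, - ln n%:R] `|` `[ln n%:R, ln n.+1%:R[).

End operators.

Definition compact_operator (F : numFieldType) (V W : normedModType F)
    (Phi : {linear V -> W}) :=
  forall B : set V, bounded_set B -> precompact (Phi @` B).

(* Main.v *)
From Pilot Require Import Defs.
From HB Require Import structures.
From mathcomp Require Import all_boot all_order all_algebra.
From mathcomp Require Import generic_quotient ring_quotient.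
From mathcomp Require Import all_classical all_reals all_analysis.
From mathcomp Require Import measurable_realfun ring lra.
Import Order.TTheory GRing.Theory Num.Theory.
Import numFieldNormedType.Exports.
From mathcomp Require Import complex.
Import Normc Pilot.Defs.

(** Write s = 1 + delta + i t.  Replacing each n^(-s), n in K, by the integral of
    x^(-s) over [n, n + 1] changes zeta_K(s) by a series whose n-th term is
    O(1 / n^2), uniformly for delta in [0, 1] and t bounded (dterm_bound).  So this
    change is a continuous function Dser of (delta, t) up to delta = 0.  In the
    variable log x the real part of what remains is half of the integral over
    L of exp (- delta |x|) cos (t x), because L is symmetric (Re_zeta).

    The operator Zdelta splits accordingly.  By Fubini the integral over L
    contributes the inverse Fourier transform of exp (- delta |.|) chi_L F g
    (ft_damped), which tends in L2 to that of chi_L F g by dominated convergence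
    and the boundedness of the transform (damped_cvg, isF_dist).  The function
    Dser contributes an operator with continuous kernel.  It converges uniformly
    as delta tends to 0 (corr_unif_continuous), and its limit Phi maps bounded
    sets to uniformly bounded equicontinuous ones, so that it is compact by
    Arzela-Ascoli (equi_class_compact, corr_op_compact).

    The L2 theory of the Fourier transform is derived from one identity: the
    transform of exp (- d |.|) is a Poisson kernel (integral_abel_cos).  The Schur
    test for this kernel bounds the transform in L2 (nrm2_abel_ft, nrm2_ft), so
    that it extends from integrable functions to all of L2 (isF_exists).  That the
    Poisson kernels form an approximate identity shows that its square is the
    reflection (isF_invol), so that the inverse transform is the reflected
    transform (fourier_invE).  Only boundedness of the transform is needed, and
    the constants 8 and 32 are not the sharp ones. *)

Set Implicit Arguments.
Unset Strict Implicit.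
Unset Printing Implicit Defensive.

Local Open Scope classical_set_scope.
Local Open Scope ring_scope.
Local Open Scope complex_scope.

(** * Complex numbers *)

Section complex_facts.
Context {R : realType}.
Implicit Types z w : R[i].

Lemma normc_sqE z : normc z ^+ 2 = Re z ^+ 2 + Im z ^+ 2.
Proof. by case: z => a b; rewrite /= sqr_sqrtr// addr_ge0 ?sqr_ge0. Qed.

Lemma ReN z : Re (- z) = - Re z. Proof. by case: z. Qed.
Lemma ImN z : Im (- z) = - Im z. Proof. by case: z. Qed.
Lemma normcN' z : normc (- z) = normc z.
Proof. by case: z => a b; rewrite /= !sqrrN. Qed.
Lemma complexP z w : Re z = Re w -> Im z = Im w -> z = w.
Proof. by case: z w => a b [c d] /= -> ->. Qed.

Lemma Re_le_normc z : `|Re z| <= normc z.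
Proof.
rewrite -(@ler_pXn2r _ 2) ?nnegrE ?normc_ge0// normc_sqE -normrX.
by rewrite ger0_norm ?sqr_ge0// lerDl sqr_ge0.
Qed.

Lemma Im_le_normc z : `|Im z| <= normc z.
Proof.
rewrite -(@ler_pXn2r _ 2) ?nnegrE ?normc_ge0// normc_sqE -normrX.
by rewrite ger0_norm ?sqr_ge0// lerDr sqr_ge0.
Qed.

Lemma normc_real (x : R) : normc x%:C = `|x|.
Proof. by rewrite /= expr0n addr0 sqrtr_sqr. Qed.

Lemma normc_le z : normc z <= `|Re z| + `|Im z|.
Proof.
rewrite -(@ler_pXn2r _ 2) ?nnegrE ?normc_ge0 ?addr_ge0// normc_sqE.
rewrite -(real_normK (num_real (Re z))) -(real_normK (num_real (Im z))).
have := normr_ge0 (Re z); have := normr_ge0 (Im z); nra.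
Qed.

Lemma normcD z w : normc (z + w) <= normc z + normc w.
Proof. exact: le_normcD. Qed.

Lemma normcB z w : normc (z - w) <= normc z + normc w.
Proof. by rewrite -(normcN' w); exact: le_normcD. Qed.

Lemma normc_distC z w : normc (z - w) = normc (w - z).
Proof. by rewrite -normcN' opprB. Qed.

Lemma sqr_addr_le (a b : R) : (a + b) ^+ 2 <= 2 * (a ^+ 2 + b ^+ 2).
Proof. have := sqr_ge0 (a - b); nra. Qed.

Lemma normcD_sq z w :
  normc (z + w) ^+ 2 <= 2 * (normc z ^+ 2 + normc w ^+ 2).
Proof.
apply: le_trans (sqr_addr_le _ _).
by rewrite ler_pXn2r ?nnegrE ?addr_ge0 ?normc_ge0// normcD.
Qed.

Definition cis (t : R) : R[i] := cos t +i* sin t.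

Lemma normc_cis t : normc (cis t) = 1.
Proof. by rewrite /= cos2Dsin2 sqrtr1. Qed.

Lemma cisD s t : cis (s + t) = cis s * cis t.
Proof. by apply: complexP; rewrite ?ReM ?ImM /= ?cosD ?sinD; ring. Qed.

End complex_facts.

(** * Measurable complex-valued functions *)

Section Cmeas.
Context {R : realType} d (T : measurableType d).
Implicit Types f g : T -> R[i].

Definition Cmeas f := measurable_fun setT (fun x => Re (f x)) /\
  measurable_fun setT (fun x => Im (f x)).

Lemma CmeasD f g : Cmeas f -> Cmeas g -> Cmeas (fun x => f x + g x).
Proof.
move=> [f1 f2] [g1 g2]; split.
  by under eq_fun do rewrite ReD; exact: measurable_funD.
by under eq_fun do rewrite ImD; exact: measurable_funD.
Qed.

Lemma CmeasM f g : Cmeas f -> Cmeas g -> Cmeas (fun x => f x * g x).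
Proof.
move=> [f1 f2] [g1 g2]; split.
  by under eq_fun do rewrite ReM;
    apply: measurable_funB; exact: measurable_funM.
by under eq_fun do rewrite ImM; apply: measurable_funD; exact: measurable_funM.
Qed.

Lemma CmeasN f : Cmeas f -> Cmeas (fun x => - f x).
Proof.
move=> [f1 f2]; split.
  by under eq_fun do rewrite ReN; exact: measurable_funN.
by under eq_fun do rewrite ImN; exact: measurable_funN.
Qed.

Lemma CmeasB f g : Cmeas f -> Cmeas g -> Cmeas (fun x => f x - g x).
Proof. by move=> mf mg; apply: CmeasD => //; exact: CmeasN. Qed.

Lemma Cmeas_real (u : T -> R) : measurable_fun setT u ->
  Cmeas (fun x => (u x)%:C).
Proof. by move=> mu_; split. Qed.

Lemma Cmeas_cis (u : T -> R) : measurable_fun setT u ->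
  Cmeas (fun x => cis (u x)).
Proof.
move=> mu_; split => /=.
  apply: measurableT_comp => //.
  by apply: continuous_measurable_fun; exact: continuous_cos.
apply: measurableT_comp => //.
by apply: continuous_measurable_fun; exact: continuous_sin.
Qed.

Lemma Cmeas_normc f : Cmeas f -> measurable_fun setT (fun x => normc (f x)).
Proof.
move=> [f1 f2]; rewrite (_ : (fun x => _) = Num.sqrt \o
    (fun x => Re (f x) ^+ 2 + Im (f x) ^+ 2)); last first.
  by apply/funext => x /=; case: (f x).
apply: measurableT_comp.
  by apply: continuous_measurable_fun; exact: sqrt_continuous.
by apply: measurable_funD; apply: measurable_funX.
Qed.

Lemma Cmeas_patch (A : set T) f : measurable A -> Cmeas f ->
  Cmeas (patch (fun=> 0) A f).
Proof.
move=> mA [f1 f2]; split.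
  rewrite (_ : (fun x => _) = (fun x => Re (f x)) \_ A).
    by apply/(measurable_restrictT _ mA); exact: measurable_funTS.
  by apply/funext => x; rewrite /patch; case: ifP.
rewrite (_ : (fun x => _) = (fun x => Im (f x)) \_ A).
  by apply/(measurable_restrictT _ mA); exact: measurable_funTS.
by apply/funext => x; rewrite /patch; case: ifP.
Qed.

End Cmeas.

Lemma Cmeas_comp {R : realType} d d' (T : measurableType d)
    (T' : measurableType d') (f : T -> R[i]) (h : T' -> T) :
  measurable_fun setT h -> Cmeas f -> Cmeas (f \o h).
Proof.
move=> mh [f1 f2]; split.
  exact: (measurableT_comp f1 mh).
exact: (measurableT_comp f2 mh).
Qed.

(** * The squared norm of L2 *)

Section nrm2.
Context {R : realType}.
Local Notation mu := (@lebesgue_measure R).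
Implicit Types (f g : R -> R[i]) (A : set R).

(** The square of the norm avoids roots, at the price of a factor 2 in the
    triangle inequality. *)
Definition nrm2 f : \bar R := (\int[mu]_x (normc (f x) ^+ 2)%:E)%E.

Lemma measurable_nrm2 f : Cmeas f ->
  measurable_fun setT (fun x => (normc (f x) ^+ 2)%:E).
Proof.
by move=> mf; apply/measurable_EFinP/measurable_funX; exact: Cmeas_normc.
Qed.

Lemma nrm2_ge0 f : (0 <= nrm2 f)%E.
Proof. by apply: integral_ge0 => x _; rewrite lee_fin sqr_ge0. Qed.

Lemma Lnorm_nrm2 f :
  ('N[mu]_2%:E[EFin \o (fun x => normc (f x))] = (nrm2 f) `^ 2^-1)%E.
Proof.
rewrite unlock /Lnorm; congr (_ `^ _)%E; apply: eq_integral => x _ /=.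
by rewrite ger0_norm ?normc_ge0// powR_mulrn ?normc_ge0.
Qed.

Lemma square_integrableP f :
  square_integrable f <-> Cmeas f /\ (nrm2 f < +oo)%E.
Proof.
rewrite /square_integrable /finite_norm Lnorm_nrm2; split.
  move=> [f1 f2 /poweR_lty f3]; split => //.
  by have := f3 2; rewrite -poweRrM mulVf// poweRe1 ?nrm2_ge0.
by move=> [[f1 f2] f3]; split => //; exact: poweR_lty.
Qed.

Lemma nrm2_le f g : Cmeas f -> Cmeas g ->
  (forall x, normc (f x) <= normc (g x)) -> (nrm2 f <= nrm2 g)%E.
Proof.
move=> mf mg fg; apply: ge0_le_integral => //.
- by move=> x _; rewrite lee_fin sqr_ge0.
- exact: measurable_nrm2.
- exact: measurable_nrm2.
- by move=> x _; rewrite lee_fin ler_pXn2r ?nnegrE ?normc_ge0.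
Qed.

Lemma nrm2D f g : Cmeas f -> Cmeas g ->
  (nrm2 (fun x => f x + g x)%R <= 2%:E * (nrm2 f + nrm2 g))%E.
Proof.
move=> mf mg; rewrite /nrm2 -ge0_integralD//; last 4 first.
- by move=> x _; rewrite lee_fin sqr_ge0.
- exact: measurable_nrm2.
- by move=> x _; rewrite lee_fin sqr_ge0.
- exact: measurable_nrm2.
rewrite -ge0_integralZl//; last 2 first.
- by apply: emeasurable_funD; exact: measurable_nrm2.
- by move=> x _; rewrite -EFinD lee_fin addr_ge0 ?sqr_ge0.
apply: ge0_le_integral => //.
- by move=> x _; rewrite lee_fin sqr_ge0.
- by apply: measurable_nrm2; exact: CmeasD.
- by apply: measurable_funeM; apply: emeasurable_funD; exact: measurable_nrm2.
- by move=> x _; rewrite -EFinD -EFinM lee_fin normcD_sq.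
Qed.

Lemma nrm2N f : nrm2 (fun x => - f x) = nrm2 f.
Proof. by apply: eq_integral => x _; rewrite normcN'. Qed.

Lemma nrm2B f g : Cmeas f -> Cmeas g ->
  (nrm2 (fun x => f x - g x)%R <= 2%:E * (nrm2 f + nrm2 g))%E.
Proof.
by move=> mf mg; rewrite -(nrm2N g); apply: nrm2D => //; exact: CmeasN.
Qed.

Lemma nrm2_distC f g :
  nrm2 (fun x => f x - g x) = nrm2 (fun x => g x - f x).
Proof. by apply: eq_integral => x _; rewrite normc_distC. Qed.

Lemma nrm2_dist f g h : Cmeas f -> Cmeas g -> Cmeas h ->
  (nrm2 (fun x => f x - h x)%R <=
   2%:E * (nrm2 (fun x => f x - g x)%R + nrm2 (fun x => g x - h x)%R))%E.
Proof.
move=> mf mg mh.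
rewrite (_ : (fun x => f x - h x) = (fun x => (f x - g x) + (g x - h x))).
  by apply: nrm2D; exact: CmeasB.
by apply/funext => x; ring.
Qed.

Lemma nrm2Z (c : R[i]) f : Cmeas f ->
  (nrm2 (fun x => c * f x)%R = (normc c ^+ 2)%:E * nrm2 f)%E.
Proof.
move=> mf; rewrite /nrm2 -ge0_integralZl//.
- by apply: eq_integral => x _; rewrite normcM exprMn EFinM.
- exact: measurable_nrm2.
- by move=> x _; rewrite lee_fin sqr_ge0.
- by rewrite lee_fin sqr_ge0.
Qed.

Lemma nrm2_ae f g : Cmeas f -> Cmeas g -> {ae mu, forall x, f x = g x} ->
  nrm2 f = nrm2 g.
Proof.
move=> mf mg fg; apply: ae_eq_integral => //.
- exact: measurable_nrm2.
- exact: measurable_nrm2.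
have aef := ae_filter_ringOfSetsType mu.
by apply: filterS fg => x /= ->.
Qed.

Lemma nrm2_eq0 f : Cmeas f -> nrm2 f = 0%E -> {ae mu, forall x, f x = 0}.
Proof.
move=> mf f0; have aef := ae_filter_ringOfSetsType mu.
have : (\int[mu]_x `|(normc (f x) ^+ 2)%:E| = 0)%E.
  rewrite -[RHS]f0; apply: eq_integral => x _.
  by rewrite /= ger0_norm ?sqr_ge0.
move=> /(ae_eq_integral_abs mu measurableT (measurable_nrm2 mf)).
apply: filterS => x /(_ Logic.I) /= -[] /eqP; rewrite sqrf_eq0 => /eqP.
exact: eq0_normc.
Qed.

Lemma nrm20 : nrm2 (fun=> 0) = 0%E.
Proof. by apply: integral0_eq => x _; rewrite normc0 expr0n. Qed.

Lemma nrm2_fin f : (nrm2 f < +oo)%E -> nrm2 f = (fine (nrm2 f))%:E.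
Proof. by move=> ?; rewrite fineK// ge0_fin_numE ?nrm2_ge0. Qed.

Lemma nrm2B_lty f g : Cmeas f -> Cmeas g -> (nrm2 f < +oo)%E ->
  (nrm2 g < +oo)%E -> (nrm2 (fun x => f x - g x)%R < +oo)%E.
Proof.
move=> mf mg fo go; apply: le_lt_trans (nrm2B mf mg) _.
by rewrite (nrm2_fin fo) (nrm2_fin go) -EFinD -EFinM ltry.
Qed.

Lemma nrm2D_lty f g : Cmeas f -> Cmeas g -> (nrm2 f < +oo)%E ->
  (nrm2 g < +oo)%E -> (nrm2 (fun x => f x + g x)%R < +oo)%E.
Proof.
move=> mf mg fo go; apply: le_lt_trans (nrm2D mf mg) _.
by rewrite (nrm2_fin fo) (nrm2_fin go) -EFinD -EFinM ltry.
Qed.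

End nrm2.

(** * Functions and their classes in L2 *)

Section L2class.
Context {R : realType}.
Local Notation mu := (@lebesgue_measure R).
Implicit Types (f g : R -> R[i]) (A : set R).

Definition L2on A f :=
  [/\ Cmeas f, (nrm2 f < +oo)%E & forall x, ~ A x -> f x = 0].

Lemma L2onP A f : f \in L2pred A <-> L2on A f.
Proof.
split=> [/asboolP[/square_integrableP[? ?] ?]//|[? ? ?]].
by apply/asboolP; split => //; exact/square_integrableP.
Qed.

Lemma L2on_repr A (u : L2 R A) : L2on A (repr u).
Proof. by case: (repr u) => f /= /L2onP. Qed.

Lemma L2classE A f (Pf : f \in L2pred A) :
  L2class A f = (\pi_(L2 R A) (MkL2fun Pf))%qT.
Proof.
rewrite /L2class; congr (\pi_(L2 R A)%qT _); apply: val_inj.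
by rewrite val_insubd Pf.
Qed.

Lemma L2class_ae A f : L2on A f ->
  {ae mu, forall x, (repr (L2class A f) : R -> R[i]) x = f x}.
Proof. by move=> /L2onP Pf; rewrite (L2classE Pf); exact: L2_ae_repr. Qed.

Lemma L2class_eqP A f g : L2on A f -> L2on A g ->
  L2class A f = L2class A g <-> {ae mu, forall x, f x = g x}.
Proof.
move=> /L2onP Pf /L2onP Pg; rewrite (L2classE Pf) (L2classE Pg).
exact: L2_eqP.
Qed.

Lemma L2class_repr A (u : L2 R A) : L2class A (repr u) = u.
Proof.
have Pu : (repr u : R -> R[i]) \in L2pred A by exact/L2onP/L2on_repr.
rewrite (L2classE Pu) -[RHS]reprK; congr (\pi_(L2 R A)%qT _).
exact: val_inj.
Qed.

Lemma L2on_lin A (a : R[i]) f g : L2on A f -> L2on A g ->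
  L2on A (fun x => a * f x + g x).
Proof.
move=> [mf fo f0] [mg go g0]; split.
- by apply: CmeasD => //; apply: CmeasM.
- apply: nrm2D_lty => //; first exact: CmeasM.
  by rewrite nrm2Z// (nrm2_fin fo) -EFinM ltry.
- by move=> x Ax; rewrite f0// g0// mulr0 addr0.
Qed.

Lemma L2class_lin A (a : R[i]) f g : L2on A f -> L2on A g ->
  L2class A (fun x => a * f x + g x) = a *: L2class A f + L2class A g.
Proof.
move=> hf hg; have /L2onP Ph := L2on_lin a hf hg.
move: hf hg => /L2onP Pf /L2onP Pg.
rewrite (L2classE Ph) (L2classE Pf) (L2classE Pg).
rewrite [_ *: _]L2scale_pi -[in RHS]raddfD; congr (\pi_(L2 R A)%qT _).
exact: val_inj.
Qed.

Lemma L2onB A f g : L2on A f -> L2on A g -> L2on A (fun x => f x - g x).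
Proof.
move=> [mf fo f0] [mg go g0]; split.
- exact: CmeasB.
- exact: nrm2B_lty.
- by move=> x Ax; rewrite f0// g0// subr0.
Qed.

Lemma L2classB A f g : L2on A f -> L2on A g ->
  L2class A (fun x => f x - g x) = L2class A f - L2class A g.
Proof.
move=> hf hg; have /L2onP Ph := L2onB hf hg.
move: hf hg => /L2onP Pf /L2onP Pg.
rewrite (L2classE Ph) (L2classE Pf) (L2classE Pg).
rewrite -[in RHS]raddfB; congr (\pi_(L2 R A)%qT _).
exact: val_inj.
Qed.

Lemma L2class_norm A f : L2on A f ->
  `|L2class A f| = (Num.sqrt (fine (nrm2 f)))%:C.
Proof.
move=> /[dup] /L2onP Pf [_ fo _].
rewrite (L2classE Pf) -[LHS]/(L2norm _) L2norm_pi Lnorm_nrm2/=.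
congr (_%:C); rewrite (nrm2_fin fo)/= powR12_sqrt// fine_ge0//.
exact: nrm2_ge0.
Qed.

(** Turns limits in the quotient into estimates on representatives. *)
Lemma L2class_cvg A {I : Type} {F : set_system I} {FF : Filter F}
    (f_ : I -> R -> R[i]) f :
  L2on A f -> (\forall i \near F, L2on A (f_ i)) ->
  (forall e : R, 0 < e ->
    \forall i \near F, (nrm2 (fun x => f_ i x - f x)%R <= e%:E)%E) ->
  L2class A (f_ i) @[i --> F] --> L2class A f.
Proof.
move=> hf hf_ H; apply/cvgrPdist_le => eps; rewrite ltcE/= => /andP[/eqP ei e0].
have -> : eps = (Re eps)%:C by apply: complexP.
have e20 : 0 < Re eps ^+ 2 by rewrite exprn_gt0.
near=> i.
have hfi : L2on A (f_ i) by near: i.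
rewrite distrC -L2classB// L2class_norm; last exact: L2onB.
rewrite lecR -[leRHS]ger0_norm ?(ltW e0)// -sqrtr_sqr ler_wsqrtr//.
rewrite -lee_fin -nrm2_fin; last by have [] := L2onB hfi hf.
by near: i; exact: H.
Unshelve. all: by end_near. Qed.

End L2class.

(** * Completeness of L2 *)

Lemma patch_in {T : Type} {U : Type} (d f : T -> U) (A : set T) x : A x -> patch d A f x = f x.
Proof. by move=> Ax; rewrite /patch mem_set. Qed.

Lemma patch_out {T : Type} {U : Type} (d f : T -> U) (A : set T) x : ~ A x -> patch d A f x = d x.
Proof. by move=> Ax; rewrite /patch memNset. Qed.

Section riesz_fischer.
Context {R : realType}.
Local Notation mu := (@lebesgue_measure R).
Implicit Types (f g : R -> R[i]) (A : set R).

Definition Ccvg (u : nat -> R[i]) (l : R[i]) :=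
  (Re (u n) @[n --> \oo] --> Re l) /\ (Im (u n) @[n --> \oo] --> Im l).

Lemma Ccvg_normc_sq u l : Ccvg u l ->
  normc (u n) ^+ 2 @[n --> \oo] --> normc l ^+ 2.
Proof.
move=> [ur ui]; under eq_fun do rewrite normc_sqE.
by rewrite normc_sqE; apply: cvgD; rewrite expr2; under eq_fun do rewrite expr2;
  exact: cvgM.
Qed.

Lemma nrm2_fatou (f_ : nat -> R -> R[i]) f (c : \bar R) :
  (forall n, Cmeas (f_ n)) -> Cmeas f ->
  {ae mu, forall x, Ccvg (f_ ^~ x) (f x)} ->
  (exists N, forall n, (N <= n)%N -> (nrm2 (f_ n) <= c)%E) ->
  (nrm2 f <= c)%E.
Proof.
move=> mf_ mf ff [N HN]; have aef := ae_filter_ringOfSetsType mu.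
pose g n x := (normc (f_ (n + N)%N x) ^+ 2)%:E.
have mg n : measurable_fun setT (g n) by exact: measurable_nrm2.
have -> : nrm2 f = (\int[mu]_x limn_einf (g ^~ x))%E.
  apply: ae_eq_integral => //.
  - exact: measurable_nrm2.
  - under eq_fun do rewrite /limn_einf.
    apply: measurableT_comp => //; apply: measurable_fun_limn_esup => n.
    by apply: measurableT_comp => //; exact: mg.
  apply: filterS ff => x /Ccvg_normc_sq fx _.
  have gx : g ^~ x @ \oo --> (normc (f x) ^+ 2)%:E.
    apply: cvg_EFin; first by apply: nearW.
    by move: fx; rewrite -(cvg_shiftn N).
  rewrite is_cvg_limn_einfE; last by apply/cvg_ex; eexists; exact: gx.
  by apply/esym/cvg_lim.
apply: le_trans (fatou mu measurableT mg _) _.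
  by move=> n x _; rewrite lee_fin sqr_ge0.
rewrite limn_einf_lim; apply: lime_le; first exact: is_cvg_einfs.
apply: nearW => n; apply: le_trans (ereal_inf_lbound _) (HN (n + N)%N _).
  by exists n => //=.
exact: leq_addl.
Qed.

Lemma cauchy_fast_cvg (u : nat -> R) (s : R) :
  (forall k, `|u k.+1 - u k| <= s * 2^-1 ^+ k) -> cvgn u.
Proof.
move=> H.
rewrite (_ : u = fun n => u 0%N + series (telescope u) n); last first.
  by apply/funext => n; rewrite [LHS]eq_sum_telescope.
have : cvgn (series (telescope u)).
  apply: normed_cvg; apply: (@series_le_cvg _ _ (geometric s 2^-1)).
  - by move=> n /=.
  - by move=> n; rewrite /geometric/= mulr_ge0 ?exprn_ge0//;
      have := le_trans (normr_ge0 _) (H 0%N); rewrite expr0 mulr1.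
  - by move=> n; exact: H.
  - by apply: is_cvg_geometric_series; rewrite ger0_norm// invf_lt1// ltr1n.
move=> /cvg_ex[l Hl]; apply/cvg_ex; exists (u 0%N + l).
by apply: cvgD => //; exact: cvg_cst.
Qed.

(** A subsequence with squared steps at most 8^-k converges almost everywhere,
    because the sum of the 4^k |step|^2 has a finite integral.  By Fatou's lemma
    its limit is also the limit of the whole sequence in quadratic mean. *)
Lemma riesz_fischer (h_ : nat -> R -> R[i]) :
  (forall n, Cmeas (h_ n)) ->
  (forall e : R, 0 < e -> exists N, forall n m, (N <= n)%N -> (N <= m)%N ->
     (nrm2 (fun x => h_ n x - h_ m x)%R <= e%:E)%E) ->
  exists2 h, Cmeas h & forall e : R, 0 < e -> exists N, forall n, (N <= n)%N ->
     (nrm2 (fun x => h_ n x - h x)%R <= e%:E)%E.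
Proof.
move=> mh hC; have aef := ae_filter_ringOfSetsType mu.
have /choice[N_ HN_] : forall k, exists N, forall n m, (N <= n)%N -> (N <= m)%N ->
    (nrm2 (fun x => h_ n x - h_ m x)%R <= ((8^-1 : R) ^+ k)%:E)%E.
  by move=> k; apply: hC; rewrite exprn_gt0.
pose phi k := (\sum_(j < k.+1) (N_ j).+1)%N.
have phiE k : phi k.+1 = (phi k + (N_ k.+1).+1)%N by rewrite /phi big_ord_recr.
have phiS k : (phi k <= phi k.+1)%N by rewrite phiE leq_addr.
have phiN k : (N_ k <= phi k)%N by rewrite /phi big_ord_recr/= ltnW// leq_addl.
have phi_ge k : (k <= phi k)%N.
  elim: k => // k ih; apply: leq_ltn_trans ih _.
  by rewrite phiE addnS ltnS leq_addr.
pose D k x := h_ (phi k.+1) x - h_ (phi k) x.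
have mD k : Cmeas (D k) by exact: CmeasB.
have nD k : (nrm2 (D k) <= ((8^-1 : R) ^+ k)%:E)%E.
  by apply: HN_ => //; apply: leq_trans (phiN k) _.
(* 8^-k against the weight 4^k leaves the summable 2^-k *)
pose w k x : \bar R := (4 ^+ k * normc (D k x) ^+ 2)%:E.
have w0 k x : (0 <= w k x)%E by rewrite lee_fin mulr_ge0 ?sqr_ge0 ?exprn_ge0.
have mw k : measurable_fun setT (w k).
  apply/measurable_EFinP; apply: measurable_funM => //.
  by apply: measurable_funX; exact: Cmeas_normc.
pose S x := (\sum_(k <oo) w k x)%E.
have mS : measurable_fun setT S.
  by apply: ge0_emeasurable_sum => //.
have S0 x : (0 <= S x)%E by exact: nneseries_ge0.
have iS : (\int[mu]_x S x < +oo)%E.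
  rewrite /S integral_nneseries//.
  apply: (@le_lt_trans _ _ (\sum_(k <oo) ((geometric 1 2^-1) k : R)%:E)%E).
    apply: lee_nneseries => [k _ _|k _]; first exact: integral_ge0.
    rewrite /w; under eq_integral do rewrite EFinM.
    rewrite ge0_integralZl//; last 2 first.
    - exact: measurable_nrm2.
    - by move=> x _; rewrite lee_fin sqr_ge0.
    apply: le_trans (lee_wpmul2l _ (nD k)) _; first by rewrite lee_fin exprn_ge0.
    rewrite -EFinM lee_fin /geometric/= mul1r -exprMn.
    by rewrite (_ : 4 * 8^-1 = 2^-1 :> R)//; field.
  have cg : cvgn (series (geometric (1 : R) 2^-1)).
    by apply: is_cvg_geometric_series; rewrite ger0_norm// invf_lt1// ltr1n.
  have /cvg_lim -> // : (\sum_(0 <= k < n) ((geometric 1 2^-1) k : R)%:E)%E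
      @[n --> \oo] --> (limn (series (geometric (1 : R) 2^-1)))%:E.
    under eq_fun do rewrite sumEFin.
    by apply: cvg_EFin; [exact: nearW|exact: cg].
  by rewrite ltry.
have Sae : {ae mu, forall x, setT x -> S x \is a fin_num}.
  apply: integrable_ae => //; apply/integrableP; split=> //.
  by under eq_integral do rewrite gee0_abs//.
pose E := [set x | S x \is a fin_num].
have mE : measurable E.
  rewrite (_ : E = ~` (S @^-1` [set +oo%E])).
    apply: measurableC; rewrite -[X in measurable X]setTI.
    by apply: mS => //; exact: emeasurable_set1.
  apply/seteqP; split => x; rewrite /E/=; first by move=> Sx Soo; rewrite Soo in Sx.
  by move=> Sx; rewrite ge0_fin_numE// lt_neqAle leey andbT; exact/eqP.
pose H k := patch (fun=> 0) E (h_ (phi k)).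
have mH k : Cmeas (H k) by exact: Cmeas_patch.
have DE x k : E x -> normc (D k x) <= Num.sqrt (fine (S x)) * 2^-1 ^+ k.
  move=> Ex; have : (w k x <= S x)%E.
    apply: le_trans (nneseries_lim_ge k.+1 _) => //.
    by rewrite big_nat_recr//= leeDr// sume_ge0.
  rewrite -[S x]fineK// lee_fin => wS.
  rewrite exprVn ler_pdivlMr ?exprn_gt0// -[leLHS]ger0_norm; last first.
    by rewrite mulr_ge0 ?normc_ge0 ?exprn_ge0.
  rewrite -sqrtr_sqr ler_wsqrtr// exprMn -exprM mulnC exprM mulrC.
  by rewrite (_ : 2 ^+ 2 = 4 :> R)//; ring.
have HD x k : E x -> H k.+1 x - H k x = D k x.
  by move=> Ex; rewrite /H !patch_in.
have cHr x : cvgn (fun k => Re (H k x)).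
  have [Ex|Ex] := pselect (E x).
    apply: (@cauchy_fast_cvg _ (Num.sqrt (fine (S x)))) => k.
    apply: le_trans (DE x k Ex); rewrite -HD//.
    by rewrite -ReN -ReD Re_le_normc.
  by apply/cvg_ex; exists 0; rewrite /H; under eq_fun do
    rewrite patch_out//; exact: cvg_cst.
have cHi x : cvgn (fun k => Im (H k x)).
  have [Ex|Ex] := pselect (E x).
    apply: (@cauchy_fast_cvg _ (Num.sqrt (fine (S x)))) => k.
    apply: le_trans (DE x k Ex); rewrite -HD//.
    by rewrite -ImN -ImD Im_le_normc.
  by apply/cvg_ex; exists 0; rewrite /H; under eq_fun do
    rewrite patch_out//; exact: cvg_cst.
pose h x := limn (fun k => Re (H k x)) +i* limn (fun k => Im (H k x)).
have mh' : Cmeas h.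
  split => /=.
    apply: (@measurable_fun_cvg _ _ R setT (fun k x => Re (H k x))).
    - by move=> k; have [] := mH k.
    - by move=> x _; exact: cHr.
  apply: (@measurable_fun_cvg _ _ R setT (fun k x => Im (H k x))).
  - by move=> k; have [] := mH k.
  - by move=> x _; exact: cHi.
exists h => // e e0; have [N HN] := hC _ e0.
exists N => n Nn; apply: (nrm2_fatou (f_ := fun k x => h_ n x - h_ (phi k) x)).
- by move=> k; exact: CmeasB.
- exact: CmeasB.
- apply: filterS Sae => x /(_ Logic.I) Ex.
  have HE k : h_ (phi k) x = H k x by rewrite /H patch_in.
  split.
    under eq_fun do rewrite ReD ReN HE; rewrite ReD ReN.
    by apply: cvgB; [exact: cvg_cst|exact: cHr].
  under eq_fun do rewrite ImD ImN HE; rewrite ImD ImN.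
  by apply: cvgB; [exact: cvg_cst|exact: cHi].
- exists N => k Nk; apply: HN => //.
  exact: leq_trans Nk (phi_ge k).
Qed.

End riesz_fischer.

(** * Integration of complex-valued functions *)

Section Cintegral.
Context {R : realType}.
Local Notation mu := (@lebesgue_measure R).
Implicit Types (f g : R -> R[i]) (A : set R).

Definition Cint f := Cmeas f /\ mu.-integrable setT (EFin \o (fun x => normc (f x))).

Lemma Cint_dom f (b : R -> R) : Cmeas f -> mu.-integrable setT (EFin \o b) ->
  (forall x, normc (f x) <= b x) -> Cint f.
Proof.
move=> mf ib fb; split => //; apply: le_integrable ib => //.
  by apply/measurable_EFinP; exact: Cmeas_normc.
move=> x _; rewrite /= lee_fin ger0_norm ?normc_ge0//.
exact: le_trans (fb x) (ler_norm _).
Qed.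

Lemma Cint_Re f : Cint f -> mu.-integrable setT (EFin \o (fun x => Re (f x))).
Proof.
move=> [[f1 f2] fi]; apply: le_integrable fi => //; first exact/measurable_EFinP.
by move=> x _; rewrite /= lee_fin [leRHS]ger0_norm ?normc_ge0// Re_le_normc.
Qed.

Lemma Cint_Im f : Cint f -> mu.-integrable setT (EFin \o (fun x => Im (f x))).
Proof.
move=> [[f1 f2] fi]; apply: le_integrable fi => //; first exact/measurable_EFinP.
by move=> x _; rewrite /= lee_fin [leRHS]ger0_norm ?normc_ge0// Im_le_normc.
Qed.

Lemma CintD f g : Cint f -> Cint g -> Cint (fun x => f x + g x).
Proof.
move=> [mf fi] [mg gi].
apply: (@Cint_dom _ (fun x => normc (f x) + normc (g x))).
- exact: CmeasD.
- exact: (integrableD measurableT fi gi).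
- by move=> x; exact: normcD.
Qed.

Lemma CintM (c : R[i]) f : Cint f -> Cint (fun x => c * f x).
Proof.
move=> [mf fi]; apply: (@Cint_dom _ (fun x => normc c * normc (f x))).
- exact: CmeasM.
- exact: (integrableZl measurableT _ fi).
- by move=> x; rewrite normcM.
Qed.

Lemma CintM_bounded f g (c : R) : Cint f -> Cmeas g ->
  (forall x, normc (g x) <= c) -> Cint (fun x => f x * g x).
Proof.
move=> [mf fi] mg gc; apply: (@Cint_dom _ (fun x => c * normc (f x))).
- exact: CmeasM.
- exact: (integrableZl measurableT _ fi).
- by move=> x; rewrite normcM mulrC ler_wpM2r ?normc_ge0.
Qed.

Lemma CintegralD f g : Cint f -> Cint g ->
  Cintegral setT (fun x => f x + g x) = Cintegral setT f + Cintegral setT g.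
Proof.
move=> fi gi; apply: complexP => /=.
  rewrite -RintegralD//; [|exact: Cint_Re|exact: Cint_Re].
  by apply: eq_Rintegral => x _; rewrite ReD.
rewrite -RintegralD//; [|exact: Cint_Im|exact: Cint_Im].
by apply: eq_Rintegral => x _; rewrite ImD.
Qed.

Lemma CintegralZ (c : R[i]) f : Cint f ->
  Cintegral setT (fun x => c * f x) = c * Cintegral setT f.
Proof.
move=> fi; have [fr fj] := (Cint_Re fi, Cint_Im fi).
have iZ (r : R) h : mu.-integrable setT (EFin \o h) ->
    mu.-integrable setT (EFin \o (fun x => r * h x)).
  by move=> hi; exact: (integrableZl measurableT r hi).
apply: complexP; rewrite ?ReM ?ImM /=.
  rewrite -!RintegralZl// -RintegralB//; [|exact: iZ|exact: iZ].
  by apply: eq_Rintegral => x _; rewrite ReM.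
rewrite -!RintegralZl// -RintegralD//; [|exact: iZ|exact: iZ].
by apply: eq_Rintegral => x _; rewrite ImM.
Qed.

Lemma CintegralB f g : Cint f -> Cint g ->
  Cintegral setT (fun x => f x - g x) = Cintegral setT f - Cintegral setT g.
Proof.
move=> fi gi; have gi' := CintM (-1) gi.
rewrite -mulN1r -CintegralZ// -CintegralD//.
by congr (Cintegral setT _); apply/funext => x; rewrite mulN1r.
Qed.

Lemma Cintegral_real (u : R -> R) :
  Cintegral setT (fun x => (u x)%:C) = (\int[mu]_x u x)%:C.
Proof.
apply: complexP => //=; rewrite /Rintegral integral0_eq//.
Qed.

(** Bounding the real and the imaginary part separately costs a factor 2. *)
Lemma normc_Cintegral f : Cint f ->
  normc (Cintegral setT f) <= 2 * \int[mu]_x normc (f x).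
Proof.
move=> fi; have [fr fj] := (Cint_Re fi, Cint_Im fi).
apply: le_trans (normc_le _) _; rewrite mulr_natl mulr2n; apply: lerD => /=.
  apply: le_trans (le_normr_Rintegral measurableT fr) _.
  apply: le_Rintegral => //; [exact: integrable_norm|by case: fi|].
  by move=> x _; exact: Re_le_normc.
apply: le_trans (le_normr_Rintegral measurableT fj) _.
apply: le_Rintegral => //; [exact: integrable_norm|by case: fi|].
by move=> x _; exact: Im_le_normc.
Qed.

Lemma Cintegral_ae f g : Cmeas f -> Cmeas g -> {ae mu, forall x, f x = g x} ->
  Cintegral setT f = Cintegral setT g.
Proof.
move=> [f1 f2] [g1 g2] fg; have aef := ae_filter_ringOfSetsType mu.
apply: complexP => /=; congr fine; apply: ae_eq_integral => //;
  try exact/measurable_EFinP.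
  by apply: filterS fg => x /= ->.
by apply: filterS fg => x /= ->.
Qed.

Lemma Cintegral_mkcond A f :
  Cintegral A f = Cintegral setT (patch (fun=> 0) A f).
Proof.
apply: complexP; rewrite /= Rintegral_mkcond; apply: eq_Rintegral => x _;
  by rewrite /patch; case: ifP.
Qed.

End Cintegral.

(** * Fubini for kernels dominated by a product *)

Section Cfubini.
Context {R : realType}.
Local Notation mu := (@lebesgue_measure R).
Variables (F : R * R -> R[i]) (a b : R -> R).
Hypothesis mF : Cmeas F.
Hypotheses (ia : mu.-integrable setT (EFin \o a))
           (ib : mu.-integrable setT (EFin \o b)).
Hypothesis Fab : forall x y, normc (F (x, y)) <= a x * b y.

(** The product bound makes the kernel integrable on the plane. *)
Let fubini_real (G : R * R -> R) : measurable_fun setT G ->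
  (forall x y, `|G (x, y)| <= a x * b y) ->
  [/\ measurable_fun setT (fun x => \int[mu]_y G (x, y)),
      measurable_fun setT (fun y => \int[mu]_x G (x, y)) &
   \int[mu]_x \int[mu]_y G (x, y) = \int[mu]_y \int[mu]_x G (x, y)].
Proof.
move=> mG Gab.
have mE : measurable_fun setT (EFin \o G) by exact/measurable_EFinP.
have mGx x : measurable_fun setT (fun y => G (x, y)).
  by apply: measurableT_comp mG _; exact: pair1_measurable.
have mGy y : measurable_fun setT (fun x => G (x, y)).
  by apply: measurableT_comp mG _; exact: pair2_measurable.
have ab x y : a x * b y = `|a x| * `|b y|.
  by rewrite -normrM ger0_norm// (le_trans (normr_ge0 _) (Gab x y)).
have iG : (mu \x mu)%E.-integrable setT (EFin \o G).
  apply/integrable12ltyP => //=.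
  apply: (@le_lt_trans _ _ (\int[mu]_x ((`|a x| * \int[mu]_y `|b y|)%:E))%E).
    apply: ge0_le_integral => //.
    - by move=> x _; exact: integral_ge0.
    - apply: (measurable_fun_fubini_tonelli_F (m2 := mu)
        (fun z => `|G z|%:E)) => //=.
      by apply/measurable_EFinP; exact: measurableT_comp.
    - apply/measurable_EFinP; apply: measurable_funM => //.
      apply: measurableT_comp => //; apply/measurable_EFinP.
      exact: measurable_int ia.
    - move=> x _; rewrite -RintegralZl//; last exact: integrable_norm.
      rewrite /Rintegral fineK; last first.
        apply: integrable_fin_num => //.
        exact: (integrableZl measurableT `|a x| (integrable_norm ib)).
      apply: ge0_le_integral => //=.
      - by apply/measurable_EFinP; apply: measurableT_comp => //; exact: mGx.
      - apply/measurable_EFinP; apply: measurable_funM => //.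
        apply: measurableT_comp => //; apply/measurable_EFinP.
        exact: measurable_int ib.
      - by move=> y _; rewrite lee_fin -ab Gab.
  have := integrableZr measurableT (\int[mu]_y `|b y|) (integrable_norm ia).
  by move=> /integrable_lty; exact.
have fF x : (\int[mu]_y (G (x, y))%:E)%E \is a fin_num.
  apply: integrable_fin_num => //.
  apply: le_integrable (integrableZl measurableT (a x) ib) => //.
    by apply/measurable_EFinP; exact: mGx.
  move=> y _; rewrite /= lee_fin; apply: le_trans (Gab x y) (ler_norm _).
have fG y : (\int[mu]_x (G (x, y))%:E)%E \is a fin_num.
  apply: integrable_fin_num => //.
  apply: le_integrable (integrableZr measurableT (b y) ia) => //.
    by apply/measurable_EFinP; exact: mGy.
  move=> x _; rewrite /= lee_fin; apply: le_trans (Gab x y) (ler_norm _).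
split.
- apply: measurableT_comp => //; exact: (measurable_fubini_F iG).
- apply: measurableT_comp => //; exact: (measurable_fubini_G iG).
- rewrite /Rintegral; congr fine.
  under eq_integral do rewrite fineK//.
  under [in RHS]eq_integral do rewrite fineK//.
  exact: (Fubini iG).
Qed.

Lemma Cmeas_fubini_F : Cmeas (fun x => Cintegral setT (fun y => F (x, y))).
Proof.
case: mF => F1 F2; split => /=.
  have [] // := fubini_real F1 _.
  by move=> x y; exact: le_trans (Re_le_normc _) (Fab x y).
have [] // := fubini_real F2 _.
by move=> x y; exact: le_trans (Im_le_normc _) (Fab x y).
Qed.

Lemma Cmeas_fubini_G : Cmeas (fun y => Cintegral setT (fun x => F (x, y))).
Proof.
case: mF => F1 F2; split => /=.
  have [] // := fubini_real F1 _.
  by move=> x y; exact: le_trans (Re_le_normc _) (Fab x y).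
have [] // := fubini_real F2 _.
by move=> x y; exact: le_trans (Im_le_normc _) (Fab x y).
Qed.

Lemma Cfubini :
  Cintegral setT (fun x => Cintegral setT (fun y => F (x, y))) =
  Cintegral setT (fun y => Cintegral setT (fun x => F (x, y))).
Proof.
case: mF => F1 F2; apply: complexP => /=.
  have [] // := fubini_real F1 _.
  by move=> x y; exact: le_trans (Re_le_normc _) (Fab x y).
have [] // := fubini_real F2 _.
by move=> x y; exact: le_trans (Im_le_normc _) (Fab x y).
Qed.

Lemma Cint_fubini_F : Cint (fun x => Cintegral setT (fun y => F (x, y))).
Proof.
have iab x : mu.-integrable setT (EFin \o (fun y => a x * b y)).
  exact: (integrableZl measurableT (a x) ib).
have iF x : Cint (fun y => F (x, y)).
  apply: Cint_dom (iab x) _ => [|y]; last exact: Fab.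
  exact: (Cmeas_comp (pair1_measurable x) mF).
apply: (Cint_dom (b := fun x => (2 * \int[mu]_y b y) * a x)) => [| |x].
- exact: Cmeas_fubini_F.
- exact: (integrableZl measurableT (2 * \int[mu]_y b y) ia).
- apply: le_trans (normc_Cintegral (iF x)) _.
  rewrite -mulrA ler_pM2l// mulrC -RintegralZl//; apply: le_Rintegral => //.
  by case: (iF x).
Qed.

Lemma Cint_fubini_G : Cint (fun y => Cintegral setT (fun x => F (x, y))).
Proof.
have iab y : mu.-integrable setT (EFin \o (fun x => a x * b y)).
  exact: (integrableZr measurableT (b y) ia).
have iF y : Cint (fun x => F (x, y)).
  apply: Cint_dom (iab y) _ => [|x]; last exact: Fab.
  exact: (Cmeas_comp (pair2_measurable y) mF).
apply: (Cint_dom (b := fun y => (2 * \int[mu]_x a x) * b y)) => [| |y].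
- exact: Cmeas_fubini_G.
- exact: (integrableZl measurableT (2 * \int[mu]_x a x) ib).
- apply: le_trans (normc_Cintegral (iF y)) _.
  rewrite -mulrA ler_pM2l// -RintegralZr//; apply: le_Rintegral => //.
  by case: (iF y).
Qed.

End Cfubini.

(** * Reflection in the origin *)

Section reflection.
Context {R : realType}.
Local Notation mu := (@lebesgue_measure R).

Let mopp : measurable_fun setT (-%R : R -> R).
Proof. exact: oppr_measurable. Qed.

Lemma ge0_integralN (f : R -> \bar R) : measurable_fun setT f ->
  (forall x, (0 <= f x)%E) ->
  (\int[mu]_x f (- x)%R = \int[mu]_x f x)%E.
Proof.
move=> mf f0.
apply: etrans (esym (@ge0_integral_pushforward _ _ (measurableTypeR R)
  (measurableTypeR R) R (-%R) mopp mu setT f measurableT mf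
  (fun y _ => f0 y))) _.
by apply: eq_measure_integral => A mA _; exact: lebesgue_measureN.
Qed.

Lemma RintegralN (f : R -> R) : mu.-integrable setT (EFin \o f) ->
  \int[mu]_x f (- x) = \int[mu]_x f x.
Proof.
move=> fi; have mf := measurable_int _ fi.
have fNi : mu.-integrable setT (EFin \o (fun x => f (- x))).
  apply/integrableP; split; first exact: (measurableT_comp mf mopp).
  rewrite (ge0_integralN (f := abse \o (EFin \o f)))//.
    by have /integrableP[] := fi.
  - exact: measurableT_comp.
  - by move=> x; exact: abse_ge0.
congr fine.
apply: etrans (esym (@integral_pushforward _ _ (measurableTypeR R)
  (measurableTypeR R) R (-%R) mopp mu setT (EFin \o f) mf fNi measurableT)) _.
by apply: eq_measure_integral => A mA _; exact: lebesgue_measureN.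
Qed.

Lemma CintegralN (f : R -> R[i]) : Cint f ->
  Cintegral setT (fun x => f (- x)) = Cintegral setT f.
Proof.
move=> fi; apply: complexP => /=.
  by rewrite (RintegralN (Cint_Re fi)).
by rewrite (RintegralN (Cint_Im fi)).
Qed.

Lemma CmeasN_comp (f : R -> R[i]) : Cmeas f -> Cmeas (fun x : R => f (- x)).
Proof. by move=> mf; exact: (Cmeas_comp mopp mf). Qed.

Lemma nrm2N_comp (f : R -> R[i]) : Cmeas f ->
  nrm2 (fun x => f (- x)) = nrm2 f.
Proof.
move=> mf; apply: (ge0_integralN (f := fun x => (normc (f x) ^+ 2)%:E)).
  exact: measurable_nrm2.
by move=> x; rewrite lee_fin sqr_ge0.
Qed.

End reflection.

(** * Integrals from primitives and parity *)

Section calculus.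
Context {R : realType}.
Local Notation mu := (@lebesgue_measure R).

Lemma is_derive_continuous (F f : R -> R) :
  (forall x : R, is_derive x 1 F (f x)) -> continuous F.
Proof.
move=> dF x; apply: differentiable_continuous; apply/derivable1_diffP.
exact: ex_derive.
Qed.

Lemma ftc_itv (f F : R -> R) a b : a < b ->
  (forall x : R, is_derive x 1 F (f x)) -> continuous f ->
  (\int[mu]_(x in `[a, b]) (f x)%:E = (F b - F a)%:E)%E.
Proof.
move=> ab dF cf; have cF := is_derive_continuous dF.
rewrite EFinB; apply: continuous_FTC2 => //.
- by apply: continuous_subspaceT; exact: cf.
- split.
  + by move=> x _; exact: ex_derive.
  + by apply: cvg_at_right_filter; exact: cF.
  + by apply: cvg_at_left_filter; exact: cF.
- by move=> x _; rewrite derive1E derive_val.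
Qed.

Lemma ftc_ray (f F : R -> R) a l : (forall x, 0 <= f x) ->
  (forall x : R, is_derive x 1 F (f x)) -> continuous f ->
  F x @[x --> +oo] --> l ->
  (\int[mu]_(x in `[a, +oo[) (f x)%:E = (l - F a)%:E)%E.
Proof.
move=> f0 dF cf Fl; have cF := is_derive_continuous dF.
rewrite EFinB; apply: ge0_continuous_FTC2y => //.
- by apply: continuous_subspaceT; exact: cf.
- by apply: cvg_at_right_filter; exact: cF.
- by move=> x _; rewrite derive1E derive_val.
Qed.

Lemma Rintegral_odd (u : R -> R) : mu.-integrable setT (EFin \o u) ->
  (forall x, u (- x) = - u x) -> \int[mu]_x u x = 0.
Proof.
move=> iu uN; have := RintegralN iu.
under eq_Rintegral do rewrite uN.
under eq_Rintegral do rewrite -mulN1r.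
by rewrite RintegralZl//; lra.
Qed.

Lemma Rintegral_even (u : R -> R) : mu.-integrable setT (EFin \o u) ->
  (forall x, u (- x) = u x) ->
  \int[mu]_x u x = 2 * \int[mu]_(x in `[0, +oo[) u x.
Proof.
move=> iu uN; pose A : set R := `[0, +oo[%classic.
pose B : set R := `]-oo, 0[%classic.
have AB : setT = A `|` B.
  apply/seteqP; split => // x _; rewrite /A /B /= !in_itv/= andbT.
  by case: (leP 0 x); [left|right].
have iS (C : set R) : measurable C -> mu.-integrable setT (EFin \o (u \_ C)).
  move=> mC; have := (integrable_mkcond (mu := mu) (EFin \o u) mC).1.
  by rewrite restrict_EFin; apply; exact: integrableS iu.
have mA : measurable A by exact: measurable_itv.
have mB : measurable B by exact: measurable_itv.
rewrite AB Rintegral_setU//; last 2 first.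
- by rewrite -AB.
- apply/disj_setPS => x []; rewrite /A /B /= !in_itv/= andbT => x0.
  by rewrite ltNge x0.
rewrite [X in _ + X]Rintegral_mkcond -RintegralN; last exact: iS.
have eB : (fun x => (u \_ B) (- x)) = u \_ `]0, +oo[.
  apply/funext => x; rewrite /patch !mem_setE !in_itv/= andbT oppr_lt0.
  by case: ifP => // _; rewrite uN.
rewrite eB.
rewrite -Rintegral_mkcond Rintegral_itv_obnd_cbnd; last exact: integrableS iu.
by rewrite -/A; ring.
Qed.

End calculus.

(** * Abel weights and Poisson kernels *)

Section poisson.
Context {R : realType}.
Local Notation mu := (@lebesgue_measure R).
Implicit Types d x t : R.

Definition abel d x := expR (- (d * `|x|)).
(** The Poisson kernel of the upper half plane at height d, of total mass 2 pi. *)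
Definition poisson d t := 2 * d / (d ^+ 2 + t ^+ 2).

Lemma abel_ge0 d x : 0 <= abel d x. Proof. exact: expR_ge0. Qed.
Lemma abel_le1 d x : 0 <= d -> abel d x <= 1.
Proof. by move=> d0; rewrite -expR0 ler_expR oppr_le0 mulr_ge0. Qed.
Lemma abelN d x : abel d (- x) = abel d x.
Proof. by rewrite /abel normrN. Qed.

Lemma continuous_abel d : continuous (abel d).
Proof.
move=> x; apply: continuous_comp; last exact: continuous_expR.
apply: cvgN; apply: cvgM; first exact: cvg_cst.
exact: (@norm_continuous _ R^o).
Qed.

Lemma measurable_abel d : measurable_fun setT (abel d).
Proof. by apply: continuous_measurable_fun; exact: continuous_abel. Qed.

Lemma cvgy_expRN d : 0 < d -> expR (- (d * x)) @[x --> +oo] --> (0 : R).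
Proof.
move=> d0; apply: (@cvg_comp _ _ _ (fun x => d * x) (fun z => expR (- z))
  _ (pinfty_nbhs R)); last exact: cvgr_expR.
exact: gt0_cvgMry.
Qed.

Let integral_expRN d : 0 < d ->
  (\int[mu]_(x in `[0%R, +oo[) (expR (- (d * x)))%:E = (d^-1)%:E)%E.
Proof.
move=> d0; pose F x := - d^-1 * expR (- (d * x)).
have dF (x : R) : is_derive x 1 F (expR (- (d * x))).
  apply: is_derive_eq.
  by rewrite /GRing.scale/=; field; rewrite gt_eqF.
have cf : continuous (fun x => expR (- (d * x))).
  apply: (@is_derive_continuous _ _ (fun x => - d * expR (- (d * x)))).
  by move=> x; apply: is_derive_eq; rewrite /GRing.scale/=; ring.
have Fl : F x @[x --> +oo] --> (0 : R).
  rewrite -[X in _ --> X](mulr0 (- d^-1)); apply: cvgM; first exact: cvg_cst.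
  exact: cvgy_expRN.
rewrite (ftc_ray 0 (fun x => expR_ge0 _) dF cf Fl) /F.
by rewrite mulr0 oppr0 expR0 mulr1 sub0r opprK.
Qed.

Lemma integrable_abel d : 0 < d -> mu.-integrable setT (EFin \o abel d).
Proof.
move=> d0; apply/integrableP; split.
  by apply/measurable_EFinP; exact: measurable_abel.
under eq_integral do rewrite /= ger0_norm ?abel_ge0//.
rewrite ge0_symfun_integralT//; last 3 first.
- by move=> x; exact: abel_ge0.
- exact: continuous_abel.
- by move=> x /=; rewrite abelN.
rewrite (_ : [set x | _] = `[0, +oo[%classic); last first.
  by apply/seteqP; split => x/=; rewrite in_itv/= andbT.
have -> : (\int[mu]_(x in `[0%R, +oo[) (abel d x)%:E)%E = (d^-1)%:E.
  rewrite -integral_expRN//; apply: eq_integral.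
  by move=> x; rewrite inE/= in_itv/= andbT => x0; rewrite /abel ger0_norm.
by rewrite -EFinM ltry.
Qed.

(** The integrand has an explicit primitive.  On the half line it is made
    nonnegative by adding expR (- (d * x)), which turns the cosine into
    1 + cos (t * x) and whose integral is d^-1. *)
Lemma integral_abel_cos d t : 0 < d ->
  \int[mu]_x (abel d x * cos (t * x)) = poisson d t.
Proof.
move=> d0.
have D0 : d ^+ 2 + t ^+ 2 != 0 by rewrite gt_eqF// ltr_pwDl ?exprn_gt0 ?sqr_ge0.
have iac : mu.-integrable setT (EFin \o (fun x => abel d x * cos (t * x))).
  apply: le_integrable (integrable_abel d0) => //.
    apply/measurable_EFinP/measurable_funM; first exact: measurable_abel.
    apply: measurableT_comp; last exact: measurable_funM.
    by apply: continuous_measurable_fun; exact: continuous_cos.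
  move=> x _; rewrite /= lee_fin normrM ler_piMr// ler_norml.
  by rewrite cos_geN1 cos_le1.
rewrite Rintegral_even//; last by move=> x; rewrite abelN mulrN cosN.
have -> : poisson d t = 2 * (d / (d ^+ 2 + t ^+ 2)) by rewrite /poisson mulrA.
congr (_ * _).
pose f x := expR (- (d * x)) * (1 + cos (t * x)).
pose F x := expR (- (d * x)) * ((t * sin (t * x) - d * cos (t * x)) /
  (d ^+ 2 + t ^+ 2) - d^-1).
have dF x : is_derive x 1 F (f x).
  apply: is_derive_eq; rewrite /f /GRing.scale/=.
  by field; rewrite D0 gt_eqF.
have cf : continuous f.
  apply: (@is_derive_continuous _ _ (fun x => - d * expR (- (d * x)) * (1 + cos (t * x)) - expR (- (d * x)) * (t * sin (t * x)))).
  by move=> x; apply: is_derive_eq; rewrite /GRing.scale/=; ring.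
have f0 x : 0 <= f x.
  by rewrite mulr_ge0 ?expR_ge0//; have := cos_geN1 (t * x); lra.
have Fl : F x @[x --> +oo] --> (0 : R).
  pose C := (`|t| + d) / (d ^+ 2 + t ^+ 2) + d^-1.
  have Dp : 0 < d ^+ 2 + t ^+ 2 by rewrite ltr_pwDl ?exprn_gt0 ?sqr_ge0.
  have FC x : `|F x| <= expR (- (d * x)) * C.
    rewrite /F normrM ger0_norm ?expR_ge0// ler_wpM2l ?expR_ge0//.
    apply: le_trans (ler_normB _ _) _; apply: lerD.
      rewrite normrM [X in _ * X]ger0_norm ?invr_ge0 ?(ltW Dp)//.
      rewrite ler_wpM2r ?invr_ge0 ?(ltW Dp)//.
      apply: le_trans (ler_normB _ _) _; apply: lerD.
        by rewrite normrM ler_piMr// ler_norml sin_geN1 sin_le1.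
      rewrite normrM ger0_norm ?(ltW d0)// ler_piMr ?(ltW d0)//.
      by rewrite ler_norml cos_geN1 cos_le1.
    by rewrite ger0_norm// invr_ge0 ltW.
  have h0 : expR (- (d * x)) * C @[x --> +oo] --> 0.
    rewrite -[X in _ --> X](mul0r C); apply: cvgM; last exact: cvg_cst.
    exact: cvgy_expRN.
  apply: (@squeeze_cvgr _ _ _ _ (fun x => - (expR (- (d * x)) * C))
    (fun x => expR (- (d * x)) * C)) => //.
    by apply: nearW => x; rewrite -ler_norml.
  by rewrite -[X in _ --> X]oppr0; apply: cvgN.
have I1 := ftc_ray 0 f0 dF cf Fl.
have ia : mu.-integrable `[0, +oo[ (EFin \o (fun x => expR (- (d * x)))).
  apply/integrableP; split.
    apply/measurable_EFinP/measurable_funTS/measurableT_comp => //.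
    exact: measurable_funN.
  under eq_integral do rewrite /= ger0_norm ?expR_ge0//.
  by rewrite integral_expRN// ltry.
have i1 : mu.-integrable `[0, +oo[ (EFin \o f).
  apply/integrableP; split.
    apply/measurable_EFinP; apply: measurable_funTS.
    exact: continuous_measurable_fun.
  under eq_integral do rewrite /= ger0_norm ?f0//.
  by rewrite I1 ltry.
transitivity (\int[mu]_(x in `[0, +oo[) (f x - expR (- (d * x)))).
  apply: eq_Rintegral => x; rewrite inE/= in_itv/= andbT => x0.
  by rewrite /abel /f ger0_norm//; ring.
rewrite RintegralB// /Rintegral I1 integral_expRN//= /F.
rewrite !(mulr0, oppr0, expR0, sin0, cos0).
by field; rewrite D0 gt_eqF.
Qed.

(** The sine part of the Fourier integral of an even function vanishes. *)
Lemma Cintegral_even_cis (m : R -> R) t :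
  mu.-integrable setT (EFin \o m) -> (forall x, m (- x) = m x) ->
  Cintegral setT (fun x => (m x)%:C * cis (t * x)) =
  (\int[mu]_x (m x * cos (t * x)))%:C.
Proof.
move=> im mN.
have mm : measurable_fun setT m by apply/measurable_EFinP; exact: measurable_int im.
have ci : Cint (fun x => (m x)%:C * cis (t * x)).
  apply: (@Cint_dom _ _ (fun x => `|m x|)).
  - by apply: CmeasM; [exact: Cmeas_real|apply: Cmeas_cis; exact: measurable_funM].
  - exact: integrable_norm.
  - by move=> x; rewrite normcM normc_cis mulr1 normc_real.
apply: complexP => /=.
  by apply: eq_Rintegral => x _; rewrite mul0r subr0.
have := Cint_Im ci; set u := (X in EFin \o X) => iu.
rewrite -[LHS]/(\int[mu]_x u x) Rintegral_odd// => x.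
by rewrite /u !ImM /= mN mulrN sinN; ring.
Qed.

Lemma poisson_ge0 d t : 0 < d -> 0 <= poisson d t.
Proof. by move=> d0; rewrite /poisson divr_ge0 ?mulr_ge0 ?addr_ge0 ?sqr_ge0 ?ltW. Qed.

Lemma poisson_le d t : 0 < d -> poisson d t <= 2 / d.
Proof.
move=> d0; have D0 : 0 < d ^+ 2 + t ^+ 2 by rewrite ltr_pwDl ?exprn_gt0 ?sqr_ge0.
rewrite /poisson ler_pdivrMr//.
rewrite (_ : 2 / d * _ = 2 * d + 2 / d * t ^+ 2); last by field; rewrite gt_eqF.
by rewrite lerDl mulr_ge0 ?sqr_ge0// divr_ge0 ?ltW.
Qed.

Lemma poissonN d t : poisson d (- t) = poisson d t.
Proof. by rewrite /poisson sqrrN. Qed.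

Lemma continuous_poisson d y : 0 < d -> continuous (fun x => poisson d (x - y)).
Proof.
move=> d0 x; have D0 : d ^+ 2 + (x - y) ^+ 2 != 0.
  by rewrite gt_eqF// ltr_pwDl ?exprn_gt0 ?sqr_ge0.
apply: cvgM; first exact: cvg_cst.
apply: cvgV => //; apply: cvgD; first exact: cvg_cst.
by rewrite expr2; under eq_fun do rewrite expr2;
  apply: cvgM; apply: cvgB => //; exact: cvg_cst.
Qed.

Lemma measurable_poisson d : 0 < d -> measurable_fun setT (poisson d).
Proof.
move=> d0; have := continuous_poisson (y := 0) d0.
by under eq_fun do rewrite subr0; exact: continuous_measurable_fun.
Qed.

Lemma integral_poisson d a b y : 0 < d -> a < b ->
  (\int[mu]_(x in `[a, b]) (poisson d (x - y))%:E =
   (2 * (atan ((b - y) / d) - atan ((a - y) / d)))%:E)%E.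
Proof.
move=> d0 ab; pose F x := 2 * atan ((x - y) / d).
have dF (x : R) : is_derive x 1 F (poisson d (x - y)).
  apply: is_derive_eq; rewrite /GRing.scale/= /poisson.
  have D0 : d ^+ 2 + (x - y) ^+ 2 != 0.
    by rewrite gt_eqF// ltr_pwDl ?exprn_gt0 ?sqr_ge0.
  have D1 : 1 + ((x - y) / d) ^+ 2 != 0.
    by rewrite gt_eqF// ltr_pwDl ?sqr_ge0.
  have dn0 : d != 0 by rewrite gt_eqF.
  rewrite (_ : 1 + ((x - y) / d) ^+ 2 = (d ^+ 2 + (x - y) ^+ 2) / d ^+ 2); last first.
    by field.
  by field; rewrite D0 dn0.
rewrite (ftc_itv ab dF) /F; last exact: continuous_poisson.
by congr EFin; ring.
Qed.

(** The primitive 2 * atan (x / d) takes its values between - pi and pi. *)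
Lemma integral_poisson_le d y : 0 < d ->
  (\int[mu]_x (poisson d (x - y))%:E <= (2 * pi)%:E)%E.
Proof.
move=> d0; pose A (n : nat) : set R := `[- n.+1%:R, n.+1%:R]%classic.
have mp : measurable_fun setT (fun x => (poisson d (x - y))%:E).
  apply/measurable_EFinP; apply: continuous_measurable_fun.
  exact: continuous_poisson.
have UA : \bigcup_n A n = setT.
  apply/seteqP; split => // x _; exists (Num.truncn `|x|) => //=.
  by rewrite /A/= in_itv/= -ler_norml ltW// truncnS_gt.
have nA : nondecreasing_seq A.
  move=> m n mn; apply/subsetPset => x; rewrite /A/= !in_itv/= -!ler_norml.
  by move=> xm; apply: le_trans xm _; rewrite ler_nat ltnS.
have H : (\int[mu]_(x in A n) (poisson d (x - y))%:E)%E @[n --> \oo] -->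
    (\int[mu]_x (poisson d (x - y))%:E)%E.
  rewrite -UA; apply: ge0_nondecreasing_set_cvg_integral => //.
  - by move=> n; exact: measurable_itv.
  - by move=> n; exact: measurable_funTS.
  - by move=> n x _; rewrite lee_fin poisson_ge0.
have /cvg_lim <- // := H.
apply: lime_le; first by apply/cvg_ex; eexists; exact: H.
apply: nearW => n; rewrite integral_poisson//; last first.
  by rewrite -subr_gt0 opprK addr_gt0.
rewrite lee_fin ler_wpM2l//.
have := atan_ltpi2 ((n.+1%:R - y) / d); have := atan_gtNpi2 ((- n.+1%:R - y) / d).
lra.
Qed.

End poisson.

(** * Limits in quadratic mean and vanishing almost everywhere *)

Section convergence_tools.
Context {R : realType}.
Local Notation mu := (@lebesgue_measure R).

Lemma cvge0_le (u : nat -> \bar R) : u @ \oo --> 0%E ->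
  forall e : R, 0 < e -> exists N, forall n, (N <= n)%N -> (u n <= e%:E)%E.
Proof.
move=> /fine_cvgP[[M _ uM]] /cvgrPdist_le u0 e e0.
have [N _ HN] := u0 e e0.
exists (maxn M N) => n; rewrite geq_max => /andP[Mn Nn].
rewrite -(fineK (uM n Mn)) lee_fin.
by have := HN n Nn; rewrite /= sub0r normrN; apply: le_trans (ler_norm _).
Qed.

Lemma nrm2_dominated (f_ : nat -> R -> R[i]) (g : R -> R[i]) :
  (forall n, Cmeas (f_ n)) -> Cmeas g -> (nrm2 g < +oo)%E ->
  (forall n x, normc (f_ n x) <= normc (g x)) ->
  (forall x, Ccvg (f_ ^~ x) 0) ->
  forall e : R, 0 < e -> exists N, forall n, (N <= n)%N ->
    (nrm2 (f_ n) <= e%:E)%E.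
Proof.
move=> mf mg go fg f0; apply: cvge0_le.
rewrite -[X in _ --> X](integral0 mu setT).
apply: (@dominated_cvg _ _ _ mu _ _ _ _ (fun x => (normc (g x) ^+ 2)%:E)) => //.
- by move=> n; exact: measurable_nrm2.
- move=> x _; apply: cvg_EFin; first exact: nearW.
  have := Ccvg_normc_sq (f0 x); rewrite normc0 expr0n; exact.
- apply/integrableP; split; first exact: measurable_nrm2.
  by under eq_integral do rewrite gee0_abs ?lee_fin ?sqr_ge0//.
- move=> n x _; rewrite gee0_abs ?lee_fin ?sqr_ge0//.
  by rewrite ler_pXn2r ?nnegrE ?normc_ge0.
Qed.

(** At a Lebesgue point x the means of |h - h x| over small intervals around x
    tend to 0, and each of them is at least |h x| since h has mean 0 there. *)
Lemma ae_eq0_itv (h : R -> R) : measurable_fun setT h ->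
  (forall a b, a < b -> mu.-integrable `[a, b] (EFin \o h)) ->
  (forall a b, a < b -> \int[mu]_(x in `[a, b]) h x = 0) ->
  {ae mu, forall x, h x = 0}.
Proof.
move=> mh ih h0; have aef := ae_filter_ringOfSetsType mu.
have lh : locally_integrable setT h.
  split => //; first exact: openT.
  move=> K _ cK.
  have [M [_ HM]] := compact_bounded cK.
  pose B := `|M| + 1.
  have KB : K `<=` `[- B, B].
    move=> x Kx; rewrite /= in_itv/= -ler_norml.
    by apply: HM Kx; rewrite /B (le_lt_trans (ler_norm M))// ltrDl.
  have B0 : - B < B by rewrite /B; have := normr_ge0 M; lra.
  have /integrableP[_] := ih _ _ B0.
  apply: le_lt_trans; apply: ge0_subset_integral => //.
  - exact: compact_measurable.
  - apply: measurable_funTS; apply/measurable_EFinP.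
    exact: measurableT_comp.
apply: filterS (lebesgue_differentiation lh) => x.
rewrite /lebesgue_pt => dx.
apply/eqP; rewrite -normr_le0 -lee_fin.
have H : \forall r \near 0^'+, (`|h x|%:E <= davg h x r)%E.
  near=> r.
  have r0 : 0 < r by near: r; exact: nbhs_right_gt.
  have xr : x - r < x + r by lra.
  have bE : ball x r = `]x - r, x + r[%classic by rewrite ball_itv.
  have ih' : mu.-integrable `]x - r, x + r[ (EFin \o h).
    by apply: integrableS (ih _ _ xr) => //; exact: subset_itv_oo_cc.
  have ic : mu.-integrable `]x - r, x + r[ (EFin \o (fun=> h x)).
    apply: (@integrableS _ _ _ mu `[x - r, x + r]) => //.
      exact: subset_itv_oo_cc.
    apply: continuous_compact_integrable; first exact: segment_compact.
    by apply: continuous_subspaceT => ?; exact: cvg_cst.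
  have ihc : mu.-integrable `]x - r, x + r[ (EFin \o (fun y => h y - h x)).
    exact: (integrableB _ ih' ic).
  rewrite /davg /iavg bE lebesgue_measure_itv/= lte_fin xr -EFinB.
  rewrite (_ : x + r - (x - r) = 2 * r); last by ring.
  rewrite inver gt_eqF ?mulr_gt0// muleC lee_pdivlMr ?mulr_gt0//.
  rewrite (_ : (`|h x|%:E * _)%E =
      `|\int[mu]_(y in `]x - r, (x + r)[) (h y - h x)|%:E).
    rewrite EFin_normr_Rintegral//; apply: le_abse_integral => //.
    exact: measurable_int ihc.
  rewrite RintegralB// Rintegral_cst//= lebesgue_measure_itv/= lte_fin xr/=.
  have i1 : mu.-integrable `[x - r, x + r[ (EFin \o h).
    by apply: integrableS (ih _ _ xr) => //; exact: subset_itv_co_cc.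
  rewrite Rintegral_itv_obnd_cbnd// Rintegral_itv_bndo_bndc// h0// sub0r normrN.
  rewrite normrM -EFinM; congr (_ * _)%:E.
  by rewrite ger0_norm//; lra.
exact: (cvge_ge H dx).
Unshelve. all: by end_near. Qed.

End convergence_tools.

(** * Poisson kernels as an approximate identity *)

Section approximate_identity.
Context {R : realType}.
Local Notation mu := (@lebesgue_measure R).

Lemma cvg_atan_scaled (c : R) : c != 0 ->
  atan (c * n.+1%:R) @[n --> \oo] --> Num.sg c * (pi / 2).
Proof.
have nS : n.+1%:R @[n --> \oo] --> (+oo : set_system R).
  apply/cvgryPge => M; near=> n; apply: (@le_trans _ _ n%:R).
    by near: n; exact: nbhs_infty_ger.
  by rewrite ler_nat.
have pos (b : R) : 0 < b -> atan (b * n.+1%:R) @[n --> \oo] --> pi / 2.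
  move=> b0; apply: (@cvg_comp _ _ _ (fun n => b * n.+1%:R) (@atan R) _
    (pinfty_nbhs R)); last exact: cvgy_atan.
  apply/cvgryPge => M; move/cvgryPge: nS => nS.
  by apply: filterS (nS (M / b)) => n; rewrite ler_pdivrMr// mulrC.
rewrite neq_lt => /orP[c0|c0].
  rewrite ltr0_sg// mulN1r (_ : (fun n => _) =
    (fun n : nat => - atan (- c * n.+1%:R))); last first.
    by apply/funext => n; rewrite mulNr atanN opprK.
  by apply: cvgN; apply: pos; rewrite oppr_gt0.
by rewrite gtr0_sg// mul1r; exact: pos.
Unshelve. all: by end_near. Qed.

(** The factor of u y is the integral over [a, b] of the Poisson kernel of
    height 1 / (n + 1) centred at y: it is bounded by 2 pi and tends to 2 pi for
    y inside [a, b] and to 0 for y outside. *)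
Lemma approximate_identity (u : R -> R) a b : a < b ->
  mu.-integrable setT (EFin \o u) ->
  \int[mu]_y (u y * (2 * (atan ((b - y) * n.+1%:R) - atan ((a - y) * n.+1%:R))))
    @[n --> \oo] --> 2 * pi * \int[mu]_(y in `[a, b]) u y.
Proof.
move=> ab iu.
have mu_ : measurable_fun setT u by apply/measurable_EFinP; exact: measurable_int iu.
pose k n y := 2 * (atan ((b - y) * n.+1%:R) - atan ((a - y) * n.+1%:R)) : R.
have mk n : measurable_fun setT (k n).
  apply: measurable_funM => //; apply: measurable_funB.
    apply: measurableT_comp; last by apply: measurable_funM => //; exact: measurable_funB.
    by apply: continuous_measurable_fun; exact: continuous_atan.
  apply: measurableT_comp; last by apply: measurable_funM => //; exact: measurable_funB.
  by apply: continuous_measurable_fun; exact: continuous_atan.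
have kb n y : `|k n y| <= 2 * pi.
  have := atan_ltpi2 ((b - y) * n.+1%:R); have := atan_gtNpi2 ((b - y) * n.+1%:R).
  have := atan_ltpi2 ((a - y) * n.+1%:R); have := atan_gtNpi2 ((a - y) * n.+1%:R).
  by rewrite ler_norml /k; move=> *; apply/andP; split; lra.
pose l y := 2 * pi * (u \_ `[a, b]) y.
have ml : measurable_fun setT l.
  apply: measurable_funM => //.
  apply/(measurable_restrictT u (measurable_itv `[a, b])).
  exact: measurable_funTS.
have aef := ae_filter_ringOfSetsType mu.
have [] := @dominated_convergence _ _ _ mu setT measurableT
  (fun n y => (u y * k n y)%:E) (EFin \o l) (fun y => (2 * pi)%:E * `|u y|%:E)%E.
- by move=> n; apply/measurable_EFinP; exact: (measurable_funM mu_ (mk n)).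
- exact/measurable_EFinP.
- have ae1 (c : R) : {ae mu, forall y, y != c}.
    exists [set c]; split => //; first exact: lebesgue_measure_set1.
    by move=> y /= /negP; rewrite negbK => /eqP.
  apply: filterS2 (ae1 a) (ae1 b) => y ya yb _.
  apply: cvg_EFin; first exact: nearW.
  have -> : l y = u y * (2 * (Num.sg (b - y) * (pi / 2) - Num.sg (a - y) * (pi / 2))).
    rewrite /l /patch mem_setE in_itv/= -[point]/(0 : R).
    have [yla|ayl|e] := ltgtP y a; last by rewrite e eqxx in ya.
      rewrite (gtr0_sg (x := b - y)); last by lra.
      by rewrite (gtr0_sg (x := a - y)); [rewrite /=; ring|lra].
    have [ylb|byl|e] := ltgtP y b; last by rewrite e eqxx in yb.
      rewrite (gtr0_sg (x := b - y)); last by lra.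
      by rewrite (ltr0_sg (x := a - y)); [rewrite /=; field|lra].
    rewrite (ltr0_sg (x := b - y)); last by lra.
    by rewrite (ltr0_sg (x := a - y)); [rewrite /=; ring|lra].
  apply: cvgM; first exact: cvg_cst.
  apply: cvgM; first exact: cvg_cst.
  by apply: cvgB; apply: cvg_atan_scaled; rewrite subr_eq0 eq_sym.
- exact: integrableZl (integrable_norm iu).
- apply: aeW => y n _; rewrite /= -EFinM lee_fin normrM mulrC.
  by rewrite ler_wpM2r.
move=> il _ cvl; rewrite [X in _ --> X](_ : _ = \int[mu]_y l y); last first.
  rewrite /l RintegralZl//; last first.
    have := (integrable_mkcond (mu := mu) (D := `[a, b]) (EFin \o u) (measurable_itv _)).1.
    by rewrite restrict_EFin; apply; exact: integrableS iu.
  by rewrite -Rintegral_mkcond.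
apply: fine_cvg; rewrite /Rintegral fineK; last exact: integrable_fin_num.
exact: cvl.
Qed.

End approximate_identity.

(** * The Fourier transform of integrable functions *)

Section fourier_L1.
Context {R : realType}.
Local Notation mu := (@lebesgue_measure R).
Implicit Types (f g h : R -> R[i]) (d x : R).

Definition ft_const : R := (Num.sqrt (2 * pi))^-1.
Definition ftint f (xi : R) : R[i] :=
  Cintegral setT (fun x => f x * cis (- (x * xi))).
Definition ft f (xi : R) : R[i] := ft_const%:C * ftint f xi.

Lemma pi2_gt0 : 0 < 2 * pi :> R. Proof. by rewrite mulr_gt0 ?pi_gt0. Qed.

Lemma ft_const_sq : ft_const ^+ 2 = (2 * pi)^-1.
Proof. by rewrite /ft_const exprVn sqr_sqrtr// ltW// pi2_gt0. Qed.

Lemma Cint_cis f (u : R -> R) : Cint f -> measurable_fun setT u ->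
  Cint (fun x => f x * cis (u x)).
Proof.
move=> fi mu_; apply: (CintM_bounded (c := 1)) => // [|x].
  exact: Cmeas_cis.
by rewrite normc_cis.
Qed.

Lemma Cint_ftint f xi : Cint f -> Cint (fun x => f x * cis (- (x * xi))).
Proof.
by move=> fi; apply: Cint_cis => //; apply: measurable_funN; exact: measurable_funM.
Qed.

Lemma ftB f g : Cint f -> Cint g ->
  ft (fun x => f x - g x) = fun xi => ft f xi - ft g xi.
Proof.
move=> fi gi; apply/funext => xi; rewrite /ft /ftint -mulrBr; congr (_ * _).
rewrite -CintegralB; [|exact: Cint_ftint|exact: Cint_ftint].
by congr (Cintegral setT _); apply/funext => x; rewrite mulrBl.
Qed.

Lemma Cmeas_fst f : Cmeas f -> Cmeas (fun z : R * R => f z.1).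
Proof. by move=> mf; exact: (Cmeas_comp measurable_fst mf). Qed.

Lemma Cmeas_snd f : Cmeas f -> Cmeas (fun z : R * R => f z.2).
Proof. by move=> mf; exact: (Cmeas_comp measurable_snd mf). Qed.

Lemma Cmeas_cis2 : Cmeas (fun z : R * R => cis (- (z.2 * z.1))).
Proof.
by apply: Cmeas_cis; apply: measurable_funN; exact: measurable_funM.
Qed.

(** Fubini wants a kernel dominated by an integrable product.  The Abel weight
    provides one, and is divided out afterwards. *)
Lemma Cmeas_ftint f : Cint f -> Cmeas (ftint f).
Proof.
move=> [mf fi].
have H : Cmeas (fun xi => (abel 1 xi)%:C * ftint f xi).
  rewrite (_ : (fun xi => _) = fun xi => Cintegral setT (fun x =>
    (abel 1 xi)%:C * (f x * cis (- (x * xi))))); last first.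
    by apply/funext => xi; rewrite CintegralZ//; exact: Cint_ftint.
  apply: (@Cmeas_fubini_F _ (fun z => (abel 1 z.1)%:C * (f z.2 * cis (- (z.2 * z.1))))
    (abel 1) (fun x => normc (f x))).
  - apply: CmeasM; first apply: (Cmeas_fst (f := fun x => (abel 1 x)%:C)).
      by apply: Cmeas_real; exact: measurable_abel.
    by apply: CmeasM; [exact: Cmeas_snd|exact: Cmeas_cis2].
  - exact: integrable_abel.
  - exact: fi.
  - move=> x y; rewrite !normcM normc_cis mulr1 normc_real ger0_norm//.
    exact: abel_ge0.
rewrite (_ : ftint f = fun xi => (expR `|xi|)%:C * ((abel 1 xi)%:C * ftint f xi)).
  apply: CmeasM => //; apply: Cmeas_real; apply: measurableT_comp => //.
apply/funext => xi; rewrite mulrA -rmorphM/= /abel mul1r -expRD subrr expR0.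
by rewrite mul1r.
Qed.

Lemma Cmeas_ft f : Cint f -> Cmeas (ft f).
Proof. by move=> fi; apply: CmeasM => //; exact: Cmeas_ftint. Qed.

Lemma normc_ftint f xi : Cint f ->
  normc (ftint f xi) <= 2 * \int[mu]_x normc (f x).
Proof.
move=> fi; apply: le_trans (normc_Cintegral (Cint_ftint xi fi)) _.
rewrite (_ : (fun x => normc (f x * _)) = fun x => normc (f x))//.
by apply/funext => x; rewrite normcM normc_cis mulr1.
Qed.

(** Fubini: multiplying the transform of f by an integrable weight and
    transforming back convolves f with the transform of the weight. *)
Lemma weighted_inversion f (m : R -> R) x : Cint f ->
  mu.-integrable setT (EFin \o m) ->
  Cintegral setT (fun xi => (m xi)%:C * cis (x * xi) * ftint f xi) =
  Cintegral setT (fun y => f y *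
    Cintegral setT (fun xi => (m xi)%:C * cis ((x - y) * xi))).
Proof.
move=> fi im; have [mf fi'] := fi.
have mm : measurable_fun setT m by apply/measurable_EFinP; exact: measurable_int im.
have -> : (fun xi => (m xi)%:C * cis (x * xi) * ftint f xi) = fun xi =>
    Cintegral setT (fun y => (m xi)%:C * cis (x * xi) * (f y * cis (- (y * xi)))).
  by apply/funext => xi; rewrite CintegralZ//; exact: Cint_ftint.
rewrite (@Cfubini _ (fun z => (m z.1)%:C * cis (x * z.1) *
  (f z.2 * cis (- (z.2 * z.1)))) (fun xi => `|m xi|) (fun y => normc (f y))).
- congr (Cintegral setT _); apply/funext => y /=; rewrite -CintegralZ.
    congr (Cintegral setT _); apply/funext => xi.
    by rewrite mulrBl cisD; ring.
  apply: (@Cint_dom _ _ (fun xi => `|m xi|)).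
  + apply: CmeasM; first exact: Cmeas_real.
    by apply: Cmeas_cis; exact: measurable_funM.
  + exact: integrable_norm.
  + by move=> xi; rewrite normcM normc_cis mulr1 normc_real.
- apply: CmeasM.
    apply: (Cmeas_fst (f := fun xi => (m xi)%:C * cis (x * xi))).
    apply: CmeasM; first exact: Cmeas_real.
    by apply: Cmeas_cis; exact: measurable_funM.
  by apply: CmeasM; [exact: Cmeas_snd|exact: Cmeas_cis2].
- exact: integrable_norm.
- exact: fi'.
- by move=> xi y; rewrite !normcM !normc_cis !mulr1 normc_real.
Qed.

(** The Schur test: a x * a y is at most a x ^+ 2 + a y ^+ 2, and the kernel has
    mass at most 2 pi in the variable that is missing from each square. *)
Lemma poisson_schur (a : R -> R) d : 0 < d -> measurable_fun setT a ->
  (forall x, 0 <= a x) ->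
  (\int[mu]_x \int[mu]_y (a x * a y * poisson d (x - y))%:E <=
   (4 * pi)%:E * \int[mu]_x (a x ^+ 2)%:E)%E.
Proof.
move=> d0 ma a0.
have aP x y : 0 <= a x * a y * poisson d (x - y).
  by apply: mulr_ge0; [exact: mulr_ge0|exact: poisson_ge0].
pose G (z : R * R) := (a z.1 ^+ 2 * poisson d (z.1 - z.2))%:E.
pose H (z : R * R) := (a z.2 ^+ 2 * poisson d (z.1 - z.2))%:E.
have mp : measurable_fun setT (fun z : R * R => poisson d (z.1 - z.2)).
  apply: (measurableT_comp (measurable_poisson d0)).
  exact: measurable_funB.
have ma1 : measurable_fun setT (fun z : R * R => a z.1).
  exact: (measurableT_comp ma).
have ma2 : measurable_fun setT (fun z : R * R => a z.2).
  exact: (measurableT_comp ma).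
have mG : measurable_fun setT G.
  by apply/measurable_EFinP; apply: measurable_funM => //; exact: measurable_funX.
have mH : measurable_fun setT H.
  by apply/measurable_EFinP; apply: measurable_funM => //; exact: measurable_funX.
have G0 z : (0 <= G z)%E by rewrite lee_fin mulr_ge0 ?sqr_ge0 ?poisson_ge0.
have H0 z : (0 <= H z)%E by rewrite lee_fin mulr_ge0 ?sqr_ge0 ?poisson_ge0.
have mpx y : measurable_fun setT (fun x => (poisson d (x - y))%:E).
  apply/measurable_EFinP; apply: continuous_measurable_fun.
  exact: continuous_poisson.
have mpy x : measurable_fun setT (fun y : R => (poisson d (x - y))%:E).
  rewrite (_ : (fun y : R => _) = fun y : R => (poisson d (y - x))%:E)//.
  by apply/funext => y; rewrite -poissonN opprB.
have pxy x : (\int[mu]_y (poisson d (x - y))%:E <= (2 * pi)%:E)%E.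
  rewrite (_ : integral _ _ _ = (\int[mu]_y (poisson d (y - x))%:E)%E).
    exact: integral_poisson_le.
  by apply: eq_integral => y _; rewrite -poissonN opprB.
have GE : (\int[mu]_x \int[mu]_y G (x, y) <=
    (2 * pi)%:E * \int[mu]_x (a x ^+ 2)%:E)%E.
  rewrite -ge0_integralZl//; last 3 first.
  - by apply/measurable_EFinP; exact: measurable_funX.
  - by move=> x _; rewrite lee_fin sqr_ge0.
  - by rewrite lee_fin ltW// pi2_gt0.
  apply: ge0_le_integral => //.
  - by move=> x _; exact: integral_ge0.
  - exact: (measurable_fun_fubini_tonelli_F (m2 := mu) G mG).
  - by apply: measurable_funeM; apply/measurable_EFinP; exact: measurable_funX.
  - move=> x _; rewrite /G/=; under eq_integral do rewrite EFinM.
    rewrite ge0_integralZl//.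
    + by rewrite muleC lee_wpmul2r ?lee_fin ?sqr_ge0.
    + exact: mpy.
    + by move=> y _; rewrite lee_fin poisson_ge0.
    + by rewrite lee_fin sqr_ge0.
have HE : (\int[mu]_x \int[mu]_y H (x, y) <=
    (2 * pi)%:E * \int[mu]_x (a x ^+ 2)%:E)%E.
  have := fubini_tonelli (m1 := mu) (m2 := mu) H mH H0.
  rewrite -ge0_integralZl//; last 3 first.
  - by apply/measurable_EFinP; exact: measurable_funX.
  - by move=> x _; rewrite lee_fin sqr_ge0.
  - by rewrite lee_fin ltW// pi2_gt0.
  move=> ->; apply: ge0_le_integral => //.
  - by move=> x _; exact: integral_ge0.
  - exact: (measurable_fun_fubini_tonelli_G (m1 := mu) H mH).
  - by apply: measurable_funeM; apply/measurable_EFinP; exact: measurable_funX.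
  - move=> y _; rewrite /H/=; under eq_integral do rewrite EFinM.
    rewrite ge0_integralZl//.
    + by rewrite muleC lee_wpmul2r ?lee_fin ?sqr_ge0// integral_poisson_le.
    + exact: mpx.
    + by move=> x _; rewrite lee_fin poisson_ge0.
    + by rewrite lee_fin sqr_ge0.
rewrite (_ : 4 * pi = 2 * pi + 2 * pi); last by ring.
rewrite EFinD ge0_muleDl ?lee_fin ?(ltW pi2_gt0)//.
apply: le_trans (leeD GE HE); rewrite -ge0_integralD//; last 4 first.
- by move=> x _; exact: integral_ge0.
- exact: (measurable_fun_fubini_tonelli_F (m2 := mu) G mG).
- by move=> x _; exact: integral_ge0.
- exact: (measurable_fun_fubini_tonelli_F (m2 := mu) H mH).
have mI : measurable_fun setT (fun z : R * R => (a z.1 * a z.2 * poisson d (z.1 - z.2))%:E).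
  by apply/measurable_EFinP; apply: measurable_funM => //; exact: measurable_funM.
have mIx := measurable_fun_fubini_tonelli_F (m2 := mu) _ mI.
apply: ge0_le_integral => //.
- move=> x _; apply: integral_ge0 => y _.
  by rewrite lee_fin; exact: aP.
- by apply: mIx => z; rewrite lee_fin; exact: aP.
- apply: emeasurable_funD.
    exact: (measurable_fun_fubini_tonelli_F (m2 := mu) G mG).
  exact: (measurable_fun_fubini_tonelli_F (m2 := mu) H mH).
- move=> x _; rewrite -ge0_integralD//; last 2 first.
  + exact: (measurableT_comp mG (pair1_measurable x)).
  + exact: (measurableT_comp mH (pair1_measurable x)).
  apply: ge0_le_integral => //.
  + by move=> y _; rewrite lee_fin; exact: aP.
  + exact: (measurableT_comp mI (pair1_measurable x)).
  + apply: emeasurable_funD.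
      exact: (measurableT_comp mG (pair1_measurable x)).
    exact: (measurableT_comp mH (pair1_measurable x)).
  + move=> y _; rewrite /G /H/= -EFinD lee_fin -mulrDl ler_wpM2r ?poisson_ge0//.
    have := a0 x; have := a0 y; have := sqr_ge0 (a x - a y); nra.
Qed.

Lemma conjc_cis t : conjc (cis t) = cis (- t) :> R[i].
Proof. by rewrite /cis cosN sinN. Qed.

Lemma mulr_conjc (z : R[i]) : z * conjc z = (normc z ^+ 2)%:C.
Proof. by rewrite normc_sqE; case: z => u v; apply: complexP => /=; ring. Qed.

Lemma conjcM (z w : R[i]) : conjc (z * w) = conjc z * conjc w.
Proof. by case: z w => [a b] [c e]; apply: complexP => /=; ring. Qed.

Lemma normc_conjc (z : R[i]) : normc (conjc z) = normc z.
Proof. by case: z => u v /=; rewrite sqrrN. Qed.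

Lemma Cmeas_conjc f : Cmeas f -> Cmeas (fun x => conjc (f x)).
Proof.
move=> [f1 f2]; split.
  by rewrite (_ : (fun x => _) = fun x => Re (f x))//; apply/funext => x; case: (f x).
rewrite (_ : (fun x => _) = fun x => - Im (f x)); first exact: measurable_funN.
by apply/funext => x; case: (f x).
Qed.

Lemma Cintegral_conjc f : Cint f ->
  Cintegral setT (fun x => conjc (f x)) = conjc (Cintegral setT f).
Proof.
move=> fi; apply: complexP => /=.
  by apply: eq_Rintegral => x _; case: (f x).
rewrite -mulN1r -RintegralZl//; last exact: Cint_Im.
by apply: eq_Rintegral => x _; rewrite mulN1r; case: (f x).
Qed.

Lemma abel_sq d x : abel d x ^+ 2 = abel (2 * d) x.
Proof. by rewrite /abel expr2 -expRD; congr expR; ring. Qed.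

Lemma ftint_poisson f d x : 0 < d -> Cint f ->
  Cintegral setT (fun xi => (abel d xi)%:C * cis (x * xi) * ftint f xi) =
  Cintegral setT (fun y => f y * (poisson d (x - y))%:C).
Proof.
move=> d0 fi; rewrite weighted_inversion//; last exact: integrable_abel.
congr (Cintegral setT _); apply/funext => y; congr (_ * _).
rewrite Cintegral_even_cis ?integral_abel_cos//; first exact: integrable_abel.
by move=> xi; rewrite abelN.
Qed.

Lemma Cint_poisson f d x : 0 < d -> Cint f ->
  Cint (fun y => f y * (poisson d (x - y))%:C).
Proof.
move=> d0 fi; apply: (CintM_bounded (c := 2 / d)) => // [|y].
  apply: Cmeas_real; apply: (measurableT_comp (measurable_poisson d0)).
  exact: measurable_funB.
by rewrite normc_real ger0_norm ?poisson_ge0// poisson_le.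
Qed.

(** Expanding one of the two factors ft f in the squared norm and exchanging the
    integrals gives the quadratic form of a Poisson kernel evaluated at f, which
    the Schur test bounds. *)
Lemma nrm2_abel_ft f d : Cint f -> (nrm2 f < +oo)%E -> 0 < d ->
  (nrm2 (fun xi => (abel d xi)%:C * ft f xi)%R <= 8%:E * nrm2 f)%E.
Proof.
move=> fi f2 d0; have [mf fi'] := fi.
pose H := ftint f; have mH : Cmeas H by exact: Cmeas_ftint.
pose M := 2 * \int[mu]_x normc (f x).
have HM xi : normc (H xi) <= M by exact: normc_ftint.
have M0 : 0 <= M by exact: le_trans (normc_ge0 _) (HM 0).
have d20 : 0 < 2 * d by rewrite mulr_gt0.
pose F (z : R * R) := (abel (2 * d) z.1)%:C * H z.1 *
  (conjc (f z.2) * cis (z.2 * z.1)).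
have FE xi x : F (xi, x) = (abel (2 * d) xi)%:C * H xi *
    (conjc (f x) * cis (x * xi)) by [].
have mF : Cmeas F.
  apply: CmeasM.
    apply: (Cmeas_fst (f := fun xi => (abel (2 * d) xi)%:C * H xi)).
    by apply: CmeasM => //; apply: Cmeas_real; exact: measurable_abel.
  apply: CmeasM; first by apply: (Cmeas_snd (f := fun x => conjc (f x)));
    exact: Cmeas_conjc.
  by apply: Cmeas_cis; exact: measurable_funM.
have ia : mu.-integrable setT (EFin \o (fun xi => abel (2 * d) xi * M)).
  exact: (integrableZr measurableT M (integrable_abel d20)).
have Fab xi x : normc (F (xi, x)) <= abel (2 * d) xi * M * normc (f x).
  rewrite /F !normcM normc_cis mulr1 normc_conjc ler_wpM2r ?normc_ge0//.
  rewrite normc_real ger0_norm ?abel_ge0//.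
  by apply: ler_wpM2l; [exact: abel_ge0|exact: HM].
pose Q x := Cintegral setT (fun xi => F (xi, x)).
have iQ : Cint Q := Cint_fubini_G mF ia fi' Fab.
pose w xi := abel (2 * d) xi * normc (H xi) ^+ 2.
have w0 xi : 0 <= w xi by rewrite mulr_ge0 ?abel_ge0 ?sqr_ge0.
have QE : (\int[mu]_xi w xi)%:C = Cintegral setT Q.
  rewrite -Cintegral_real -(Cfubini mF ia fi' Fab); congr (Cintegral setT _).
  apply/funext => xi; rewrite /F/=.
  have icf : Cint (fun x => conjc (f x * cis (- (x * xi)))).
    have [m i] := Cint_ftint xi fi.
    split; first exact: Cmeas_conjc.
    by under [X in EFin \o X]eq_fun do rewrite normc_conjc.
  rewrite (_ : (fun x => _ * _ * _) = fun x => (abel (2 * d) xi)%:C * H xi *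
      conjc (f x * cis (- (x * xi)))); last first.
    by apply/funext => x; rewrite conjcM conjc_cis opprK.
  rewrite CintegralZ// Cintegral_conjc; last exact: Cint_ftint.
  by rewrite -mulrA mulr_conjc -rmorphM.
have wQ : \int[mu]_xi w xi <= 2 * \int[mu]_x normc (Q x).
  apply: le_trans (normc_Cintegral iQ); rewrite -QE normc_real.
  exact: ler_norm.
have Qx x : normc (Q x) <=
    2 * \int[mu]_y (normc (f x) * normc (f y) * poisson (2 * d) (x - y)).
  have -> : Q x = conjc (f x) * Cintegral setT (fun y => f y *
      (poisson (2 * d) (x - y))%:C).
    rewrite -ftint_poisson// -CintegralZ.
      by congr (Cintegral setT _); apply/funext => xi; rewrite FE /H; ring.
    apply: (Cint_dom (b := fun xi => abel (2 * d) xi * M)) => // [|xi].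
      apply: CmeasM => //; apply: CmeasM.
        by apply: Cmeas_real; exact: measurable_abel.
      by apply: Cmeas_cis; exact: measurable_funM.
    rewrite !normcM normc_cis mulr1 normc_real ger0_norm ?abel_ge0//.
    by rewrite ler_wpM2l ?abel_ge0.
  have ip := Cint_poisson x d20 fi.
  rewrite normcM normc_conjc.
  apply: le_trans (ler_wpM2l (normc_ge0 _) (normc_Cintegral ip)) _.
  rewrite mulrCA ler_pM2l// -RintegralZl//; last by case: ip.
  rewrite (_ : (fun y => normc (f x) * _) = fun y =>
    normc (f x) * normc (f y) * poisson (2 * d) (x - y))//.
  apply/funext => y; rewrite normcM normc_real ger0_norm ?poisson_ge0//.
  by rewrite mulrA.
have mn : measurable_fun setT (fun x => normc (f x)) by exact: Cmeas_normc.
have schur := poisson_schur d20 mn (fun x => normc_ge0 (f x)).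
have QS : ((\int[mu]_x normc (Q x))%:E <= 2%:E * ((4 * pi)%:E * nrm2 f))%E.
  pose J (z : R * R) := normc (f z.1) * normc (f z.2) *
    poisson (2 * d) (z.1 - z.2).
  have J0 z : (0 <= (J z)%:E)%E.
    rewrite lee_fin; apply: mulr_ge0; last exact: poisson_ge0.
    by apply: mulr_ge0; exact: normc_ge0.
  have mJ : measurable_fun setT (EFin \o J).
    apply/measurable_EFinP; apply: measurable_funM.
      apply: measurable_funM.
        exact: (measurableT_comp mn measurable_fst).
      exact: (measurableT_comp mn measurable_snd).
    apply: (measurableT_comp (measurable_poisson d20)).
    exact: measurable_funB.
  have mJx : measurable_fun setT (fun x => \int[mu]_y (J (x, y))%:E)%E.
    exact: (measurable_fun_fubini_tonelli_F (m2 := mu) (EFin \o J) mJ J0).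
  rewrite /Rintegral fineK; last by apply: integrable_fin_num => //; case: iQ.
  apply: (@le_trans _ _ (\int[mu]_x (2%:E * \int[mu]_y (J (x, y))%:E))%E).
    apply: ge0_le_integral => //.
    - by move=> x _; rewrite lee_fin normc_ge0.
    - by apply/measurable_EFinP; apply: Cmeas_normc; case: iQ.
    - exact: measurable_funeM.
    - move=> x _; have ip := Cint_poisson x d20 fi.
      have iJ : mu.-integrable setT (fun y => (J (x, y))%:E).
        have := integrableZl measurableT (normc (f x)) ip.2.
        apply: eq_integrable => // y _; rewrite /= -EFinM; congr EFin.
        rewrite /J/= normcM normc_real ger0_norm ?poisson_ge0//.
        by rewrite mulrA.
      rewrite -[integral _ _ _]fineK; last exact: integrable_fin_num.
      by rewrite -EFinM lee_fin; exact: Qx.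
  rewrite ge0_integralZl//; last by move=> x _; exact: integral_ge0.
  by apply: lee_wpmul2l; [rewrite lee_fin|exact: schur].
have wE xi : (normc ((abel d xi)%:C * ft f xi) ^+ 2)%:E =
    ((2 * pi)^-1%:E * (w xi)%:E)%E.
  rewrite -EFinM; congr EFin; rewrite !normcM !normc_real !exprMn.
  rewrite ger0_norm ?abel_ge0// abel_sq ger0_norm; last by rewrite invr_ge0 sqrtr_ge0.
  by rewrite ft_const_sq /w mulrCA.
have mw : measurable_fun setT w.
  apply: measurable_funM; first exact: measurable_abel.
  by apply: measurable_funX; exact: Cmeas_normc.
have iw : mu.-integrable setT (EFin \o w).
  apply: (le_integrable measurableT _ _
    (integrableZr measurableT (M ^+ 2) (integrable_abel d20))).
    exact/measurable_EFinP.
  move=> xi _; rewrite /= lee_fin ger0_norm// /w normrM.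
  rewrite [X in _ <= X * _]ger0_norm ?abel_ge0// ler_wpM2l ?abel_ge0//.
  by rewrite ger0_norm ?sqr_ge0// ler_pXn2r// nnegrE normc_ge0.
rewrite /nrm2; under eq_integral do rewrite wE.
rewrite ge0_integralZl//; last 3 first.
- exact/measurable_EFinP.
- by move=> x _; rewrite lee_fin w0.
- by rewrite lee_fin invr_ge0 ltW// pi2_gt0.
rewrite [X in (_ * X)%E](_ : _ = (\int[mu]_xi w xi)%:E); last first.
  by rewrite /Rintegral fineK//; exact: integrable_fin_num.
have wQS : ((\int[mu]_xi w xi)%:E <= 2%:E * (2%:E * ((4 * pi)%:E * nrm2 f)))%E.
  apply: (@le_trans _ _ (2 * \int[mu]_x normc (Q x))%:E); first by rewrite lee_fin.
  by rewrite EFinM; apply: lee_wpmul2l; [rewrite lee_fin|exact: QS].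
apply: le_trans (lee_wpmul2l _ wQS) _.
  by rewrite lee_fin invr_ge0 ltW// pi2_gt0.
rewrite -/(nrm2 f) (nrm2_fin f2) -!EFinM lee_fin le_eqVlt; apply/orP; left; apply/eqP.
have := pi_gt0 R; move: (fine _) (pi : R) => r p p0.
by rewrite -[2 * p]/(2 * p : R) invfM; field; rewrite gt_eqF.
Qed.

End fourier_L1.

(** * The Fourier-Plancherel transform *)

Section plancherel.
Context {R : realType}.
Local Notation mu := (@lebesgue_measure R).
Implicit Types (f g h k : R -> R[i]) (d x : R).

Definition L2f f := Cmeas f /\ (nrm2 f < +oo)%E.

Definition trunc (n : nat) f := patch (fun=> 0) `]- n%:R, n%:R[%classic f.

Definition inv_succ (n : nat) : R := n.+1%:R^-1.

Lemma inv_succ_gt0 n : 0 < inv_succ n. Proof. by rewrite invr_gt0. Qed.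

Lemma cvg_inv_succ : inv_succ n @[n --> \oo] --> (0 : R).
Proof. exact: cvg_harmonic. Qed.

Lemma cvg_abel x : abel (inv_succ n) x @[n --> \oo] --> (1 : R).
Proof.
rewrite -expR0; apply: continuous_cvg; first exact: continuous_expR.
rewrite -oppr0; apply: cvgN; rewrite -(mul0r `|x|).
by apply: cvgM; [exact: cvg_inv_succ|exact: cvg_cst].
Qed.

Lemma Ccvg_abel (z : R[i]) x :
  Ccvg (fun n => (abel (inv_succ n) x)%:C * z) z.
Proof.
split.
  under eq_fun do rewrite ReM /= mul0r subr0.
  have := @cvgM _ _ _ _ _ _ _ _ (cvg_abel x) (cvg_cst (Re z)).
  by rewrite mul1r; exact.
under eq_fun do rewrite ImM /= mul0r addr0.
have := @cvgM _ _ _ _ _ _ _ _ (cvg_abel x) (cvg_cst (Im z)).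
by rewrite mul1r; exact.
Qed.

(** The Abel weights tend to 1; Fatou's lemma removes them. *)
Lemma nrm2_ft f : Cint f -> (nrm2 f < +oo)%E ->
  (nrm2 (ft f) <= 8%:E * nrm2 f)%E.
Proof.
move=> fi f2; have mft := Cmeas_ft fi.
apply: (nrm2_fatou (f_ := fun n xi => (abel (inv_succ n) xi)%:C * ft f xi)).
- move=> n; apply: CmeasM => //; apply: Cmeas_real; exact: measurable_abel.
- by [].
- by apply: aeW => x; exact: Ccvg_abel.
- by exists 0%N => n _; apply: nrm2_abel_ft => //; exact: inv_succ_gt0.
Qed.

Lemma L2f_ft f : Cint f -> L2f f -> L2f (ft f).
Proof.
move=> fi [mf f2]; split; first exact: Cmeas_ft.
by apply: le_lt_trans (nrm2_ft fi f2) _; rewrite (nrm2_fin f2) -EFinM ltry.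
Qed.

Lemma L2fB f g : L2f f -> L2f g -> L2f (fun x => f x - g x).
Proof. by move=> [mf f2] [mg g2]; split; [exact: CmeasB|exact: nrm2B_lty]. Qed.

Lemma normc_patch_le (A : set R) f x :
  normc (patch (fun=> 0) A f x) <= normc (f x).
Proof. by rewrite /patch; case: ifP => // _; rewrite normc0 normc_ge0. Qed.

Lemma L2f_patch (A : set R) f : measurable A -> L2f f ->
  L2f (patch (fun=> 0) A f).
Proof.
move=> mA [mf f2]; have mp := Cmeas_patch mA mf; split => //.
apply: le_lt_trans f2; apply: nrm2_le => // x; exact: normc_patch_le.
Qed.

Lemma L2f_trunc n f : L2f f -> L2f (trunc n f).
Proof. by apply: L2f_patch; exact: measurable_itv. Qed.

(** Because |f| <= 1 + |f|^2 and bounded intervals have finite measure. *)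
Lemma Cint_itv (a b : R) (b0 b1 : bool) f : L2f f ->
  Cint (patch (fun=> 0) [set` Interval (BSide b0 a) (BSide b1 b)] f).
Proof.
move=> lf; set A := [set` _].
have [mp p2] := L2f_patch (measurable_itv _ : measurable A) lf.
apply: (@Cint_dom _ _ (fun x => \1_A x + normc (patch (fun=> 0) A f x) ^+ 2)) => //.
  have i1 := @integrable_indic_itv R a b b0 b1.
  have i2 : mu.-integrable setT
      (EFin \o (fun x => normc (patch (fun=> 0) A f x) ^+ 2)).
    apply/integrableP; split; first exact: measurable_nrm2.
    by under eq_integral do rewrite gee0_abs ?lee_fin ?sqr_ge0//.
  exact: (integrableD measurableT i1 i2).
move=> x; rewrite indicE; have [xab|xab] := boolP (x \in A).
  have := sqr_ge0 (normc (patch (fun=> 0) A f x) - 1).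
  by have := normc_ge0 (patch (fun=> 0) A f x); rewrite /=; nra.
by rewrite patch_out ?normc0 ?expr0n ?addr0//; move: xab; rewrite notin_setE.
Qed.

Lemma Cint_trunc n f : L2f f -> Cint (trunc n f).
Proof. exact: Cint_itv. Qed.

Lemma trunc_cvg f : L2f f -> forall e : R, 0 < e -> exists N, forall n,
  (N <= n)%N -> (nrm2 (fun x => trunc n f x - f x)%R <= e%:E)%E.
Proof.
move=> lf; have [mf f2] := lf.
apply: (nrm2_dominated (g := f)) => //.
- by move=> n; apply: CmeasB => //; case: (L2f_trunc n lf).
- move=> n x; rewrite /trunc /patch; case: ifP => _.
    by rewrite subrr normc0 normc_ge0.
  by rewrite sub0r normcN'.
move=> x.
have H : \forall n \near \oo, trunc n f x - f x = 0.
  near=> n; rewrite /trunc patch_in ?subrr//= in_itv/= -ltr_norml.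
  by near: n; exact: nbhs_infty_gtr.
split; apply: cvg_near_cst; apply: filterS H => n -> //.
Unshelve. all: by end_near. Qed.

(** h is the Fourier-Plancherel transform of f: the limit in quadratic mean
    of the Fourier integrals over growing bounded intervals. *)
Definition isF f h := Cmeas h /\ forall e : R, 0 < e -> exists N, forall n,
  (N <= n)%N -> (nrm2 (fun x => ft (trunc n f) x - h x)%R <= e%:E)%E.

Lemma truncB n f g :
  trunc n (fun x => f x - g x) = fun x => trunc n f x - trunc n g x.
Proof.
by apply/funext => x; rewrite /trunc /patch; case: ifP => // _; rewrite subrr.
Qed.

Lemma isF_Cint f : Cint f -> L2f f -> isF f (ft f).
Proof.
move=> fi lf; split; first exact: Cmeas_ft.
move=> e e0; have e8 : 0 < e / 8 by rewrite divr_gt0.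
have [N HN] := trunc_cvg lf e8; exists N => n Nn.
have ti := Cint_trunc n lf; have tl := L2f_trunc n lf.
rewrite -ftB//; apply: le_trans (nrm2_ft _ _) _.
- split; first by case: (L2fB tl lf).
  have [_ iD] := CintD ti (CintM (-1) fi); apply: eq_integrable iD => // x _.
  by rewrite /= mulN1r.
- by case: (L2fB tl lf).
apply: le_trans (lee_wpmul2l _ (HN n Nn)) _; first by rewrite lee_fin.
by rewrite -EFinM lee_fin mulrC divfK.
Qed.

Lemma isF_exists f : L2f f -> exists h, isF f h.
Proof.
move=> lf.
have mh n : Cmeas (ft (trunc n f)) by apply: Cmeas_ft; exact: Cint_trunc.
have [|h mh' Hh] := riesz_fischer mh; last by exists h; split.
move=> e e0; have e32 : 0 < e / 32 by rewrite divr_gt0.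
have [N HN] := trunc_cvg lf e32; exists N => n m Nn Nm.
have [tn tm] := (Cint_trunc n lf, Cint_trunc m lf).
have [ln lm] := (L2f_trunc n lf, L2f_trunc m lf).
rewrite -ftB//; apply: le_trans (nrm2_ft _ _) _.
- have [_ iD] := CintD tn (CintM (-1) tm); split; first by case: (L2fB ln lm).
  by apply: eq_integrable iD => // x _; rewrite /= mulN1r.
- by case: (L2fB ln lm).
have H : (nrm2 (fun x => trunc n f x - trunc m f x)%R <= (e / 8)%:E)%E.
  apply: le_trans (nrm2_dist (g := f) _ _ _) _; [by case: ln|by case: lf|by case: lm|].
  rewrite [X in (_ * (_ + X))%E]nrm2_distC.
  apply: le_trans (lee_wpmul2l _ (leeD (HN n Nn) (HN m Nm))) _; first by rewrite lee_fin.
  by rewrite -EFinD -EFinM lee_fin; lra.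
apply: le_trans (lee_wpmul2l _ H) _; first by rewrite lee_fin.
by rewrite -EFinM lee_fin; lra.
Qed.

Lemma isF_nrm2 f h : L2f f -> isF f h -> (nrm2 h <= 32%:E * nrm2 f)%E.
Proof.
move=> lf [mh fh]; have [mf f2] := lf.
apply/lee_addgt0Pr => e e0; have e2 : 0 < e / 2 by rewrite divr_gt0.
have [N /(_ _ (leqnn _)) HN] := fh _ e2.
have ti := Cint_trunc N lf; have [tm t2] := L2f_trunc N lf.
have mt := Cmeas_ft ti.
have n1 : (nrm2 (ft (trunc N f)) <= 8%:E * nrm2 f)%E.
  apply: le_trans (nrm2_ft ti t2) _; apply: lee_wpmul2l; first by rewrite lee_fin.
  by apply: nrm2_le => // x; exact: normc_patch_le.
rewrite (_ : h = fun x => (h x - ft (trunc N f) x) + ft (trunc N f) x); last first.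
  by apply/funext => x; rewrite subrK.
apply: le_trans (nrm2D _ mt) _; first exact: CmeasB.
rewrite nrm2_distC.
apply: le_trans (lee_wpmul2l _ (leeD HN n1)) _; first by rewrite lee_fin.
rewrite (nrm2_fin f2) -!EFinM -!EFinD lee_fin.
have : 0 <= fine (nrm2 f) by rewrite fine_ge0// nrm2_ge0.
lra.
Qed.

Lemma L2f_isF f h : L2f f -> isF f h -> L2f h.
Proof.
move=> lf fh; split; first by case: fh.
apply: le_lt_trans (isF_nrm2 lf fh) _; case: lf => _ f2.
by rewrite (nrm2_fin f2) -EFinM ltry.
Qed.

Lemma isFB f g h k : L2f f -> L2f g -> isF f h -> isF g k ->
  isF (fun x => f x - g x) (fun x => h x - k x).
Proof.
move=> lf lg [mh fh] [mk gk]; split; first exact: CmeasB.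
move=> e e0; have e4 : 0 < e / 4 by rewrite divr_gt0.
have [N HN] := fh _ e4; have [M HM] := gk _ e4.
exists (maxn N M) => n; rewrite geq_max => /andP[Nn Mn].
have [tf tg] := (Cint_trunc n lf, Cint_trunc n lg).
have [mtf mtg] := (Cmeas_ft tf, Cmeas_ft tg).
rewrite truncB ftB//.
rewrite (_ : (fun x => _) = fun x => (ft (trunc n f) x - h x) -
  (ft (trunc n g) x - k x)); last by apply/funext => x; ring.
apply: le_trans (nrm2B _ _) _; [exact: CmeasB|exact: CmeasB|].
apply: le_trans (lee_wpmul2l _ (leeD (HN n Nn) (HM n Mn))) _; first by rewrite lee_fin.
by rewrite -EFinD -EFinM lee_fin; lra.
Qed.

(** Boundedness of the transform, stated for differences so that it passes to
    limits. *)
Lemma isF_dist f g h k : L2f f -> L2f g -> isF f h -> isF g k ->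
  (nrm2 (fun x => h x - k x)%R <= 32%:E * nrm2 (fun x => f x - g x)%R)%E.
Proof. by move=> lf lg fh gk; apply: isF_nrm2; [exact: L2fB|exact: isFB]. Qed.

Lemma isF_ae f g h k : L2f f -> L2f g -> isF f h -> isF g k ->
  {ae mu, forall x, f x = g x} -> {ae mu, forall x, h x = k x}.
Proof.
move=> lf lg fh gk fg; have aef := ae_filter_ringOfSetsType mu.
have [[mf _] [mg _] [mh _] [mk _]] := And4 lf lg fh gk.
have H : nrm2 (fun x => f x - g x) = 0%E.
  rewrite -[RHS](@nrm20 R); apply: nrm2_ae => //; first exact: CmeasB.
  by apply: filterS fg => x ->; rewrite subrr.
have := isF_dist lf lg fh gk; rewrite H mule0 => hk.
have : nrm2 (fun x => h x - k x) = 0%E.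
  by apply/eqP; rewrite eq_le hk nrm2_ge0.
move=> /nrm2_eq0 => /(_ (CmeasB mh mk)); apply: filterS => x /eqP.
by rewrite subr_eq0 => /eqP.
Qed.

Lemma isF_ae_l f g h : Cmeas f -> Cmeas g -> isF f h ->
  {ae mu, forall x, f x = g x} -> isF g h.
Proof.
move=> mf mg [mh fh] fg; split; first exact: mh.
move=> e e0; have [N HN] := fh _ e0.
have aef := ae_filter_ringOfSetsType mu.
exists N => n Nn; move: (HN n Nn); suff -> : ft (trunc n f) = ft (trunc n g) by [].
apply/funext => xi; congr (_ * _).
have mt u : Cmeas u -> Cmeas (fun x => trunc n u x * cis (- (x * xi))).
  move=> mu_; apply: CmeasM.
    by apply: Cmeas_patch => //; exact: measurable_itv.
  by apply: Cmeas_cis; apply: measurable_funN; exact: measurable_funM.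
apply: Cintegral_ae; [exact: mt|exact: mt|].
by apply: filterS fg => x fgx; rewrite /trunc /patch fgx.
Qed.

Lemma isF_reflect f h : L2f f -> isF f h ->
  isF (fun x => f (- x)) (fun x => h (- x)).
Proof.
move=> lf [mh fh]; split; first exact: CmeasN_comp.
move=> e e0; have [N HN] := fh _ e0; exists N => n Nn.
have tN : trunc n (fun x => f (- x)) = fun x => trunc n f (- x).
  apply/funext => x; rewrite /trunc /patch !mem_setE !in_itv/=.
  by rewrite [in RHS]ltrN2 [in RHS]andbC [in RHS]ltrNl.
have ft_refl : ft (trunc n (fun x => f (- x))) = fun x => ft (trunc n f) (- x).
  apply/funext => xi; rewrite /ft; congr (_ * _); rewrite tN /ftint.
  rewrite -(CintegralN (Cint_ftint (- xi) (Cint_trunc n lf))).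
  by congr (Cintegral setT _); apply/funext => x; rewrite mulrNN.
rewrite ft_refl; have := HN n Nn.
rewrite -(nrm2N_comp (f := fun x => ft (trunc n f) x - h x))//.
by apply: CmeasB => //; apply: Cmeas_ft; exact: Cint_trunc.
Qed.

End plancherel.

(** * Fourier inversion *)

Section inversion.
Context {R : realType}.
Local Notation mu := (@lebesgue_measure R).
Implicit Types (f g h k : R -> R[i]) (d x : R).

Lemma le_add_sqr_div (z eta : R) : 0 <= z -> 0 < eta -> z <= eta + z ^+ 2 / eta.
Proof.
move=> z0 e0; rewrite -subr_ge0.
rewrite (_ : _ - z = ((z / eta - 1) ^+ 2 + z / eta) * eta); last first.
  by field; rewrite gt_eqF.
apply: mulr_ge0; last exact: ltW.
by apply: addr_ge0; [exact: sqr_ge0|apply: divr_ge0 => //; exact: ltW].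
Qed.

(** Convergence in quadratic mean gives convergence in mean on bounded
    intervals: eta is chosen first, then the squared norm small against it. *)
Lemma integral_itv_le (a b : R) f eta : a < b -> 0 < eta -> L2f f ->
  \int[mu]_(x in `[a, b]) normc (f x) <=
  eta * (b - a) + fine (nrm2 f) / eta.
Proof.
move=> ab e0 [mf f2]; rewrite -lee_fin.
have mn : measurable_fun setT (fun x => normc (f x)) by exact: Cmeas_normc.
have m2 : measurable_fun setT (fun x => normc (f x) ^+ 2) by exact: measurable_funX.
have [_ i1] := Cint_itv a b true false (conj mf f2).
have i1' : mu.-integrable `[a, b] (EFin \o (fun x => normc (f x))).
  apply: (integrable_mkcond (mu := mu) (EFin \o (fun x => normc (f x)))
    (measurable_itv `[a, b])).2.
  apply: eq_integrable i1 => // x _; rewrite /= /patch.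
  by case: ifP => // _; rewrite normc0.
rewrite /Rintegral fineK; last exact: integrable_fin_num.
apply: (@le_trans _ _ (\int[mu]_(x in `[a, b]) (eta%:E + eta^-1%:E * (normc (f x) ^+ 2)%:E))%E).
  apply: ge0_le_integral => //.
  - by move=> x _; rewrite lee_fin normc_ge0.
  - by apply/measurable_EFinP; exact: measurable_funTS.
  - apply: emeasurable_funD => //; apply: measurable_funeM.
    by apply/measurable_EFinP; exact: measurable_funTS.
  - move=> x _; rewrite -EFinM -EFinD lee_fin mulrC.
    exact: le_add_sqr_div (normc_ge0 _) e0.
rewrite ge0_integralD//; last 3 first.
- by move=> x _; rewrite lee_fin ltW.
- move=> x _; rewrite -EFinM lee_fin mulr_ge0 ?sqr_ge0// invr_ge0 ltW//.
- by apply: measurable_funeM; apply/measurable_EFinP; exact: measurable_funTS.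
rewrite EFinD; apply: leeD.
  have muab : mu `[a, b] = (b - a)%:E.
    by rewrite lebesgue_measure_itv/= lte_fin ab.
  by rewrite integral_cst//= EFinM muab.
rewrite ge0_integralZl//; last 3 first.
- by apply/measurable_EFinP; exact: measurable_funTS.
- by move=> x _; rewrite lee_fin sqr_ge0.
- by rewrite lee_fin invr_ge0 ltW.
rewrite mulrC EFinM; apply: lee_wpmul2l; first by rewrite lee_fin invr_ge0 ltW.
rewrite -nrm2_fin//; apply: ge0_subset_integral => //.
  exact/measurable_EFinP.
by move=> x _; rewrite lee_fin sqr_ge0.
Qed.

Lemma Ccvg_cst (z : R[i]) : Ccvg (fun=> z) z.
Proof. by split; exact: cvg_cst. Qed.

Lemma CcvgB (u v : nat -> R[i]) l m : Ccvg u l -> Ccvg v m ->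
  Ccvg (fun n => u n - v n) (l - m).
Proof.
move=> [u1 u2] [v1 v2]; split.
  by under eq_fun do rewrite ReD ReN; rewrite ReD ReN; exact: cvgB.
by under eq_fun do rewrite ImD ImN; rewrite ImD ImN; exact: cvgB.
Qed.

Lemma Ccvg_normc (u : nat -> R[i]) l :
  (forall e : R, 0 < e -> exists N, forall n, (N <= n)%N -> normc (u n - l) <= e) ->
  Ccvg u l.
Proof.
move=> H; split; apply/cvgrPdist_le => e e0; have [N HN] := H e e0.
  exists N => // n Nn /=; rewrite distrC -ReN -ReD.
  exact: le_trans (Re_le_normc _) (HN n Nn).
exists N => // n Nn /=; rewrite distrC -ImN -ImD.
exact: le_trans (Im_le_normc _) (HN n Nn).
Qed.

Lemma integrable_itv (a b : R) (b0 b1 : bool) (u : R -> R) :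
  mu.-integrable setT
    (EFin \o patch (fun=> 0) [set` Interval (BSide b0 a) (BSide b1 b)] u) ->
  mu.-integrable [set` Interval (BSide b0 a) (BSide b1 b)] (EFin \o u).
Proof.
move=> iu; apply: (integrable_mkcond (mu := mu) (EFin \o u) (measurable_itv _)).2.
by rewrite restrict_EFin.
Qed.

Lemma L2f_integrable_itv (a b : R) f : L2f f ->
  [/\ mu.-integrable `[a, b] (EFin \o (fun x => Re (f x))),
      mu.-integrable `[a, b] (EFin \o (fun x => Im (f x))) &
      mu.-integrable `[a, b] (EFin \o (fun x => normc (f x)))].
Proof.
move=> lf; have ip := Cint_itv a b true false lf.
split; apply: integrable_itv.
- have := Cint_Re ip; apply: eq_integrable => // x _.
  by rewrite /= /patch; case: ifP.
- have := Cint_Im ip; apply: eq_integrable => // x _.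
  by rewrite /= /patch; case: ifP.
- have := ip.2; apply: eq_integrable => // x _.
  by rewrite /= /patch; case: ifP => // _; rewrite normc0.
Qed.

Lemma Ccvg_itv (a b : R) (q_ : nat -> R -> R[i]) q : a < b ->
  (forall n, L2f (q_ n)) -> L2f q ->
  (forall e : R, 0 < e -> exists N, forall n, (N <= n)%N ->
    (nrm2 (fun x => q_ n x - q x)%R <= e%:E)%E) ->
  Ccvg (fun n => Cintegral `[a, b] (q_ n)) (Cintegral `[a, b] q).
Proof.
move=> ab lq_ lq H; apply: Ccvg_normc => e e0.
pose eta := e / (4 * (b - a)).
have ba0 : 0 < b - a by rewrite subr_gt0.
have eta0 : 0 < eta by rewrite divr_gt0// mulr_gt0.
have ee : 0 < e * eta / 4 by rewrite divr_gt0// mulr_gt0.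
have [N HN] := H _ ee; exists N => n Nn.
have ld := L2fB (lq_ n) lq.
rewrite !(Cintegral_mkcond `[a, b]) -CintegralB; [|exact: Cint_itv|exact: Cint_itv].
have -> : (fun x => patch (fun=> 0) `[a, b] (q_ n) x - patch (fun=> 0) `[a, b] q x) =
    patch (fun=> 0) `[a, b] (fun x => q_ n x - q x).
  by apply/funext => x; rewrite /patch; case: ifP; rewrite ?subrr.
apply: le_trans (normc_Cintegral (Cint_itv a b true false ld)) _.
rewrite (_ : (fun x => normc _) =
    (fun x => normc (q_ n x - q x)) \_ `[a, b]); last first.
  by apply/funext => x; rewrite /patch; case: ifP => // _; rewrite normc0.
rewrite -Rintegral_mkcond.
apply: (@le_trans _ _ (2 * (eta * (b - a) + e * eta / 4 / eta))).
  rewrite ler_pM2l//; apply: le_trans (integral_itv_le ab eta0 ld) _.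
  rewrite lerD2l ler_pM2r ?invr_gt0//.
  by rewrite -lee_fin -nrm2_fin; [exact: HN|case: ld].
rewrite le_eqVlt; apply/orP; left; apply/eqP; rewrite /eta; field.
by rewrite !gt_eqF.
Qed.

Lemma Cint_abel_ftint f d x : 0 < d -> Cint f ->
  Cint (fun xi => (abel d xi)%:C * cis (x * xi) * ftint f xi).
Proof.
move=> d0 fi; pose M := 2 * \int[mu]_x normc (f x).
apply: (@Cint_dom _ _ (fun xi => abel d xi * M)) => [| |xi].
- apply: CmeasM; last exact: Cmeas_ftint.
  apply: CmeasM; first by apply: Cmeas_real; exact: measurable_abel.
  by apply: Cmeas_cis; exact: measurable_funM.
- exact: (integrableZr measurableT M (integrable_abel d0)).
- rewrite !normcM normc_cis mulr1 normc_real ger0_norm ?abel_ge0//.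
  by rewrite ler_wpM2l ?abel_ge0// normc_ftint.
Qed.

(** The square of the transform is the reflection.  Tested against the
    indicator of [a, b], the regularised inversion formula is a Poisson mean of
    f, and the Poisson kernel is an approximate identity. *)
Lemma isF_invol_Cint f k : Cint f -> L2f f -> isF (ft f) k ->
  {ae mu, forall x, k (- x) = f x}.
Proof.
move=> fi lf hk; have [mf f2] := lf.
have aef := ae_filter_ringOfSetsType mu.
have lh := L2f_ft fi lf; have [mh h2] := lh.
have lk := L2f_isF lh hk; have [mk k2] := lk.
pose w n xi := (abel (inv_succ n) xi)%:C * ft f xi.
have mw n : Cmeas (w n).
  by apply: CmeasM => //; apply: Cmeas_real; exact: measurable_abel.
have wle n xi : normc (w n xi) <= normc (ft f xi).
  rewrite normcM normc_real ger0_norm ?abel_ge0// ler_piMl ?normc_ge0//.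
  by apply: abel_le1; rewrite ltW// inv_succ_gt0.
have lw n : L2f (w n).
  by split => //; apply: le_lt_trans h2; exact: nrm2_le.
have iw n : Cint (w n).
  pose M := `|ft_const| * (2 * \int[mu]_x normc (f x)).
  apply: (@Cint_dom _ _ (fun xi => abel (inv_succ n) xi * M)) => // [|xi].
    exact: (integrableZr measurableT M (integrable_abel (inv_succ_gt0 n))).
  rewrite /w normcM normc_real ger0_norm ?abel_ge0// ler_wpM2l ?abel_ge0//.
  by rewrite /ft normcM normc_real ler_wpM2l// normc_ftint.
pose g n x := ft (w n) (- x).
have mg n : Cmeas (g n) by apply: CmeasN_comp; exact: Cmeas_ft.
have gk e : 0 < e -> exists N, forall n, (N <= n)%N ->
    (nrm2 (fun x => g n x - k (- x))%R <= e%:E)%E.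
  move=> e0; have e32 : 0 < e / 32 by rewrite divr_gt0.
  have [|||||N HN] := @nrm2_dominated _ (fun n x => w n x - ft f x) (ft f)
    _ _ _ _ _ _ e32 => //.
  - by move=> n; exact: CmeasB.
  - move=> n x; rewrite /w -{2}[ft f x]mul1r -mulrBl normcM ler_piMl ?normc_ge0//.
    rewrite (_ : _ - 1 = (abel (inv_succ n) x - 1)%:C); last first.
      by apply: complexP => //=; rewrite subr0.
    rewrite normc_real distrC ger0_norm ?subr_ge0.
      by rewrite lerBlDr lerDl abel_ge0.
    by apply: abel_le1; rewrite ltW// inv_succ_gt0.
  - move=> x; have := CcvgB (Ccvg_abel (ft f x) x) (Ccvg_cst (ft f x)).
    by rewrite subrr.
  exists N => n Nn.
  rewrite (nrm2N_comp (f := fun x => ft (w n) x - k x)); last first.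
    by apply: CmeasB => //; exact: Cmeas_ft.
  apply: le_trans (isF_dist (lw n) lh (isF_Cint (iw n) (lw n)) hk) _.
  apply: le_trans (lee_wpmul2l _ (HN n Nn)) _; first by rewrite lee_fin.
  by rewrite -EFinM lee_fin mulrC divfK.
have lg n : L2f (g n).
  split; first exact: mg.
  rewrite /g (nrm2N_comp (f := ft (w n))); last exact: Cmeas_ft.
  by have [] := L2f_ft (iw n) (lw n).
have gE n x : g n x = ((2 * pi)^-1)%:C *
    Cintegral setT (fun y => f y * (poisson (inv_succ n) (x - y))%:C).
  rewrite -ftint_poisson ?inv_succ_gt0// -ft_const_sq expr2 rmorphM /g /ft -mulrA.
  congr (_ * _); rewrite [LHS]/ftint -CintegralZ.
    by congr (Cintegral setT _); apply/funext => xi; rewrite /w /ft mulrN opprK [xi * x]mulrC; ring.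
  by apply: Cint_abel_ftint => //; exact: inv_succ_gt0.
pose A a b n y : R := 2 * (atan ((b - y) * n.+1%:R) - atan ((a - y) * n.+1%:R)).
have gint a b n : a < b -> Cintegral `[a, b] (g n) =
    ((2 * pi)^-1)%:C * Cintegral setT (fun y => f y * (A a b n y)%:C).
  move=> ab; pose I := \1_(`[a, b]%classic) : R -> R.
  pose F (z : R * R) := (I z.1)%:C * (f z.2 * (poisson (inv_succ n) (z.1 - z.2))%:C).
  have FE x y : F (x, y) = (I x)%:C * (f y * (poisson (inv_succ n) (x - y))%:C) by [].
  have I0 x : 0 <= I x by rewrite /I indicE.
  have mI : measurable_fun setT I by exact: measurable_indic.
  have mF : Cmeas F.
    apply: CmeasM; first by apply: (Cmeas_fst (f := fun x => (I x)%:C)); exact: Cmeas_real.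
    apply: CmeasM; first exact: Cmeas_snd.
    apply: Cmeas_real; apply: (measurableT_comp (measurable_poisson (inv_succ_gt0 n))).
    exact: measurable_funB.
  have iI : mu.-integrable setT (EFin \o (fun x => I x * (2 / inv_succ n))).
    have i1 : mu.-integrable setT (EFin \o I).
      exact: (@integrable_indic_itv R a b true false).
    exact: (integrableZr measurableT (2 / inv_succ n) i1).
  have Fab x y : normc (F (x, y)) <= I x * (2 / inv_succ n) * normc (f y).
    rewrite FE !normcM !normc_real [leRHS]mulrAC -[leRHS]mulrA.
    rewrite ger0_norm// ler_wpM2l// ler_wpM2l ?normc_ge0//.
    by rewrite ger0_norm ?poisson_le// ?poisson_ge0// inv_succ_gt0.
  rewrite Cintegral_mkcond.
  transitivity (((2 * pi)^-1)%:C *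
      Cintegral setT (fun x => Cintegral setT (fun y => F (x, y)))).
    rewrite -CintegralZ; last exact: Cint_fubini_F mF iI fi.2 Fab.
    congr (Cintegral setT _); apply/funext => x.
    rewrite -[fun y : R => F (x, y)]/(fun y : R => (I x)%:C *
      (f y * (poisson (inv_succ n) (x - y))%:C)).
    rewrite CintegralZ; last by apply: Cint_poisson => //; exact: inv_succ_gt0.
    rewrite /patch /I indicE; case: ifP => _.
      by rewrite gE mul1r.
    by rewrite mul0r mulr0.
  rewrite (Cfubini mF iI fi.2 Fab); congr (_ * Cintegral setT _).
  apply/funext => y.
  rewrite (_ : (fun x => F (x, y)) = fun x => f y * (I x * poisson (inv_succ n) (x - y))%:C); last first.
    by apply/funext => x; rewrite FE mulrCA -rmorphM.
  rewrite CintegralZ; last first.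
    apply: (Cint_dom _ iI) => [|x].
      apply: Cmeas_real; apply: measurable_funM => //.
      apply: (measurableT_comp (measurable_poisson (inv_succ_gt0 n))).
      exact: measurable_funB.
    have p0 := poisson_ge0 (x - y) (inv_succ_gt0 n).
    rewrite normc_real ger0_norm; last exact: mulr_ge0.
    by rewrite ler_wpM2l// poisson_le// inv_succ_gt0.
  rewrite Cintegral_real; congr (_ * _%:C).
  transitivity (\int[mu]_(x in `[a, b]) poisson (inv_succ n) (x - y)).
    rewrite [RHS]Rintegral_mkcond; apply: eq_Rintegral => x _.
    by rewrite /patch /I indicE; case: ifP => _; rewrite ?mul1r ?mul0r.
  rewrite /Rintegral integral_poisson//= ?inv_succ_gt0//.
  by rewrite /A /inv_succ invrK.
have lkN : L2f (fun x => k (- x)).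
  split; first exact: CmeasN_comp.
  by rewrite (nrm2N_comp (f := k)).
have cvg_g a b : a < b ->
    Ccvg (fun n => Cintegral `[a, b] (g n)) (Cintegral `[a, b] (fun x => k (- x))).
  by move=> ab; exact: Ccvg_itv.
have cvg_f a b : a < b ->
    Ccvg (fun n => Cintegral `[a, b] (g n)) (Cintegral `[a, b] f).
  move=> ab; have pi0 : 2 * pi != 0 :> R by rewrite gt_eqF// pi2_gt0.
  have E (u : R -> R) : \int[mu]_(x in `[a, b]) u x =
      (2 * pi)^-1 * (2 * pi * \int[mu]_(x in `[a, b]) u x) by rewrite mulKf.
  split.
    rewrite (_ : (fun n => _) =
        fun n => (2 * pi)^-1 * \int[mu]_y (Re (f y) * A a b n y)); last first.
      apply/funext => n; rewrite gint// ReM /= mul0r subr0; congr (_ * _).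
      by apply: eq_Rintegral => y _; rewrite ReM /= mulr0 subr0.
    rewrite [Re _]/= E; apply: cvgM; first exact: cvg_cst.
    by apply: approximate_identity => //; exact: Cint_Re.
  rewrite (_ : (fun n => _) =
      fun n => (2 * pi)^-1 * \int[mu]_y (Im (f y) * A a b n y)); last first.
    apply/funext => n; rewrite gint// ImM /= mul0r addr0; congr (_ * _).
    by apply: eq_Rintegral => y _; rewrite ImM /= mulr0 add0r.
  rewrite [Im _]/= E; apply: cvgM; first exact: cvg_cst.
  by apply: approximate_identity => //; exact: Cint_Im.
have eqI a b : a < b -> Cintegral `[a, b] (fun x => k (- x)) = Cintegral `[a, b] f.
  move=> ab; have [c1 c2] := cvg_g _ _ ab; have [c3 c4] := cvg_f _ _ ab.
  apply: complexP.
    by rewrite -(cvg_lim (@Rhausdorff R) c1); exact: cvg_lim c3.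
  by rewrite -(cvg_lim (@Rhausdorff R) c2); exact: cvg_lim c4.
have ae0 (u : R -> R) : measurable_fun setT u ->
    (forall a b, mu.-integrable `[a, b] (EFin \o u)) ->
    (forall a b, a < b -> \int[mu]_(x in `[a, b]) u x = 0) ->
    {ae mu, forall x, u x = 0}.
  by move=> mu_ iu u0; apply: ae_eq0_itv.
have [[f1 f2'] [k1 k2']] : Cmeas f /\ Cmeas (fun x : R => k (- x)) by case: lkN.
have H1 : {ae mu, forall x, Re (k (- x)) - Re (f x) = 0}.
  apply: ae0 => [|a b|a b ab].
  - exact: measurable_funB.
  - have [i1 _ _] := L2f_integrable_itv a b lkN.
    have [i2 _ _] := L2f_integrable_itv a b lf.
    exact: (integrableB _ i1 i2).
  - have [i1 _ _] := L2f_integrable_itv a b lkN.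
    have [i2 _ _] := L2f_integrable_itv a b lf.
    by rewrite RintegralB//; have [-> _] := eqI a b ab; rewrite subrr.
have H2 : {ae mu, forall x, Im (k (- x)) - Im (f x) = 0}.
  apply: ae0 => [|a b|a b ab].
  - exact: measurable_funB.
  - have [_ i1 _] := L2f_integrable_itv a b lkN.
    have [_ i2 _] := L2f_integrable_itv a b lf.
    exact: (integrableB _ i1 i2).
  - have [_ i1 _] := L2f_integrable_itv a b lkN.
    have [_ i2 _] := L2f_integrable_itv a b lf.
    by rewrite RintegralB//; have [_ ->] := eqI a b ab; rewrite subrr.
apply: filterS2 H1 H2 => x /eqP; rewrite subr_eq0 => /eqP e1 /eqP.
by rewrite subr_eq0 => /eqP e2; exact: complexP.
Qed.

End inversion.

(** * The transform on classes of functions *)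

Section plancherel_quotient.
Context {R : realType}.
Local Notation mu := (@lebesgue_measure R).
Implicit Types (f g h k : R -> R[i]).

Lemma ae_eq_nrm2 f g : Cmeas f -> Cmeas g ->
  (forall e : R, 0 < e -> (nrm2 (fun x => f x - g x)%R <= e%:E)%E) ->
  {ae mu, forall x, f x = g x}.
Proof.
move=> mf mg H; have aef := ae_filter_ringOfSetsType mu.
have H0 : nrm2 (fun x => f x - g x) = 0%E.
  apply/eqP; rewrite eq_le nrm2_ge0 andbT; apply/lee_addgt0Pr => e e0.
  by rewrite add0e; exact: H.
apply: filterS (nrm2_eq0 (CmeasB mf mg) H0) => x /eqP.
by rewrite subr_eq0 => /eqP.
Qed.

(** By density of the functions with bounded support, the square of the
    transform is the reflection on all square integrable functions. *)
Lemma isF_invol f h k : L2f f -> isF f h -> isF h k ->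
  {ae mu, forall x, k (- x) = f x}.
Proof.
move=> lf fh hk; have lh := L2f_isF lf fh; have lk := L2f_isF lh hk.
have [[mf _] [mh _] [mk _]] := And3 lf lh lk.
apply: ae_eq_nrm2 => //; first exact: CmeasN_comp.
move=> e e0.
have e1 : 0 < e / 4 / 32 / 32 by rewrite !divr_gt0.
have [N /(_ _ (leqnn _)) HN] := trunc_cvg lf e1.
pose fN := trunc N f.
have [lfN ifN] : L2f fN /\ Cint fN by split; [exact: L2f_trunc|exact: Cint_trunc].
have [kN hkN] := isF_exists (L2f_ft ifN lfN).
have lkN := L2f_isF (L2f_ft ifN lfN) hkN.
have [[mfN _] [mkN _]] := (lfN, lkN).
have kfN := isF_invol_Cint ifN lfN hkN.
have dh := isF_dist lfN lf (isF_Cint ifN lfN) fh.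
have dk := isF_dist (L2f_ft ifN lfN) lh hkN hk.
have mkN' : Cmeas (fun x : R => kN (- x)) by exact: CmeasN_comp.
have mk' : Cmeas (fun x : R => k (- x)) by exact: CmeasN_comp.
apply: le_trans (nrm2_dist mk' mkN' mf) _.
have -> : nrm2 (fun x => kN (- x) - f x) = nrm2 (fun x => fN x - f x).
  have aef := ae_filter_ringOfSetsType mu.
  by apply: nrm2_ae; [exact: CmeasB|exact: CmeasB|apply: filterS kfN => x ->].
have H1 : (nrm2 (fun x => k (- x) - kN (- x))%R <= (e / 4)%:E)%E.
  rewrite (nrm2N_comp (f := fun x => k x - kN x)); last exact: CmeasB.
  rewrite nrm2_distC; apply: le_trans dk _.
  have H2 : (nrm2 (fun x => ft fN x - h x)%R <= (e / 4 / 32)%:E)%E.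
    apply: le_trans dh _; apply: le_trans (lee_wpmul2l _ HN) _.
      by rewrite lee_fin.
    by rewrite -EFinM lee_fin; lra.
  apply: le_trans (lee_wpmul2l _ H2) _; first by rewrite lee_fin.
  by rewrite -EFinM lee_fin; lra.
apply: le_trans (lee_wpmul2l _ (leeD H1 HN)) _; first by rewrite lee_fin.
by rewrite -EFinD -EFinM lee_fin; lra.
Qed.

Lemma L2on_setT f : L2on setT f <-> L2f f.
Proof.
split=> [[? ? _]|[mf f2]]; first by split.
by split; [exact: mf|exact: f2|move=> x nx; exfalso; apply: nx].
Qed.

Lemma L2f_repr A (u : L2 R A) : L2f (repr u : R -> R[i]).
Proof. by have [] := L2on_repr u. Qed.

Lemma fourier_truncE N f : fourier_trunc N f = ft (trunc N f).
Proof.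
apply/funext => t; rewrite /fourier_trunc /ft; congr (_ * _).
rewrite Cintegral_mkcond; congr (Cintegral setT _); apply/funext => x.
rewrite /trunc /patch; case: ifP => _; last by rewrite mul0r.
by rewrite /cexp /= expR0 /cis mul1r.
Qed.

Lemma fourierE (u : L2 R setT) h : isF (repr u) h ->
  fourier u = L2class setT h.
Proof.
move=> uh; have lu := L2f_repr u; have lh := L2f_isF lu uh.
rewrite /fourier; apply: cvg_lim; first exact: norm_hausdorff.
apply: L2class_cvg.
- exact/L2on_setT.
- apply: nearW => n; rewrite fourier_truncE; apply/L2on_setT.
  by apply: L2f_ft; [exact: Cint_trunc|exact: L2f_trunc].
- move=> e e0; have [_ /(_ e e0)[N HN]] := uh.
  exists N; first exact: Logic.I.
  by move=> n Nn /=; rewrite fourier_truncE; exact: HN.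
Qed.

Lemma isF_fourier (u : L2 R setT) : isF (repr u) (repr (fourier u)).
Proof.
have lu := L2f_repr u; have [h uh] := isF_exists lu.
have lh := L2f_isF lu uh; have [mh _] := lh.
rewrite (fourierE uh).
have he : {ae mu, forall x, (repr (L2class setT h) : R -> R[i]) x = h x}.
  by apply: L2class_ae; exact/L2on_setT.
have [mr _] := L2f_repr (L2class setT h).
split=> // e e0; have [N HN] := uh.2 e e0; exists N => n Nn.
have aef := ae_filter_ringOfSetsType mu.
have mt : Cmeas (ft (trunc n (repr u))) by apply: Cmeas_ft; exact: Cint_trunc.
rewrite (@nrm2_ae _ _ (fun x => ft (trunc n (repr u)) x - h x)); [exact: HN|..].
- exact: CmeasB.
- exact: CmeasB.
- by apply: filterS he => x ->.
Qed.

Lemma L2_repr_eq A (u v : L2 R A) :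
  {ae mu, forall x, (repr u : R -> R[i]) x = repr v x} -> u = v.
Proof.
by move=> uv; rewrite -(L2class_repr u) -(L2class_repr v);
  apply/L2class_eqP => //; exact: L2on_repr.
Qed.

Lemma fourier_inj : injective (@fourier R).
Proof.
move=> u v uv; apply: L2_repr_eq.
have [lu lv] := (L2f_repr u, L2f_repr v).
have Fu := isF_fourier u; have := isF_fourier v; rewrite -uv => Fv.
have [k Fk] := isF_exists (L2f_repr (fourier u)).
have ku := isF_invol lu Fu Fk; have kv := isF_invol lv Fv Fk.
have aef := ae_filter_ringOfSetsType mu.
by apply: filterS2 ku kv => x <-.
Qed.

(** The transform commutes with the reflection and its square is the reflection,
    so it maps the reflected transform of w to w. *)
Lemma fourier_invE (w : L2 R setT) k : isF (repr w) k ->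
  fourier_inv w = L2class setT (fun x => k (- x)).
Proof.
move=> wk; have aef := ae_filter_ringOfSetsType mu.
have lw := L2f_repr w; have lk := L2f_isF lw wk; have [mk k2] := lk.
have lkN : L2f (fun x => k (- x)).
  by split; [exact: CmeasN_comp|rewrite (nrm2N_comp mk)].
set v := L2class setT _.
have vk : {ae mu, forall x, (repr v : R -> R[i]) x = k (- x)}.
  by apply: L2class_ae; exact/L2on_setT.
have lv := L2f_repr v.
suff <- : fourier v = w.
  apply: pinvKV; last by rewrite inE.
  by move=> x y _ _; exact: fourier_inj.
have [m km] := isF_exists lk.
have mw := isF_invol lw wk km.
have kNm := isF_reflect lk km.
have Fv := isF_fourier v.
have H := isF_ae lv lkN Fv kNm vk.
apply: L2_repr_eq; apply: filterS2 H mw => x -> ->//.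
Qed.

End plancherel_quotient.

(** * Variation of damped cosines *)

Section damped_cosine.
Context {R : realType}.
Implicit Types (a b s t : R).

Lemma cos_lipschitz a b : `|cos a - cos b| <= `|a - b| :> R.
Proof.
wlog ab : a b / a <= b.
  move=> H; have [|/ltW] := leP a b; first exact: H.
  by move=> ba; rewrite distrC [leRHS]distrC; exact: H.
have [||c _ E] := @MVT_segment R (fun x => - cos x) sin a b ab.
- by move=> x _; apply: is_derive_eq; rewrite opprK.
- by apply: continuous_subspaceT => x; apply: cvgN; exact: continuous_cos.
rewrite (_ : cos a - cos b = sin c * (b - a)); last by rewrite -E; ring.
rewrite normrM [leRHS]distrC ler_piMl// ler_norml.
by rewrite sin_geN1 sin_le1.
Qed.

Lemma expRN_lipschitz a b : 0 <= a -> 0 <= b ->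
  `|expR (- a) - expR (- b)| <= `|a - b|.
Proof.
wlog ab : a b / a <= b.
  move=> H a0 b0; have [ab|/ltW ba] := leP a b; first exact: H.
  by rewrite distrC [leRHS]distrC; exact: H.
move=> a0 b0; rewrite ger0_norm ?subr_ge0 ?ler_expR ?lerN2//.
rewrite distrC ger0_norm ?subr_ge0//.
rewrite (_ : expR (- b) = expR (- a) * expR (a - b)); last first.
  by rewrite -expRD; congr expR; ring.
rewrite -{1}[expR (- a)]mulr1 -mulrBr.
have h1 : 1 - expR (a - b) <= b - a by have := expR_ge1Dx (a - b); lra.
have h2 : 0 <= 1 - expR (a - b).
  by rewrite subr_ge0 -expR0 ler_expR subr_le0.
have h3 : expR (- a) <= 1 by rewrite -expR0 ler_expR oppr_le0.
have := expR_ge0 (- a); nra.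
Qed.

Lemma damped_cos_lipschitz a b s t : 0 <= a -> 0 <= b ->
  `|expR (- a) * cos s - expR (- b) * cos t| <= `|a - b| + `|s - t|.
Proof.
move=> a0 b0.
rewrite (_ : _ - _ = (expR (- a) - expR (- b)) * cos s +
  expR (- b) * (cos s - cos t)); last by ring.
apply: le_trans (ler_normD _ _) _; apply: lerD.
  rewrite normrM; apply: le_trans (expRN_lipschitz a0 b0).
  by rewrite ler_piMr// ler_norml cos_geN1 cos_le1.
rewrite normrM; apply: le_trans (cos_lipschitz s t).
rewrite ler_piMl// ger0_norm ?expR_ge0//.
by rewrite -expR0 ler_expR oppr_le0.
Qed.

End damped_cosine.

(** * Terms of the zeta series compared with integrals *)

Section zeta_terms.
Context {R : realType}.
Local Notation mu := (@lebesgue_measure R).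
Implicit Types (d e s t x : R) (n : nat) (K : set nat).

Definition Ln n : R := ln n%:R.
Definition cell n : set R := `[Ln n, Ln n.+1[%classic.

Lemma expR_Ln n : (0 < n)%N -> expR (Ln n) = n%:R.
Proof. by move=> n0; rewrite lnK// posrE ltr0n. Qed.

Lemma Ln_ge0 n : 0 <= Ln n.
Proof.
case: n => [|n]; first by rewrite /Ln ln0.
by rewrite ln_ge0// ler1n.
Qed.

Lemma Ln_lt n : (0 < n)%N -> Ln n < Ln n.+1.
Proof. by move=> n0; rewrite ltr_ln ?posrE ?ltr0n// ltr_nat. Qed.

Lemma Ln_step n : (0 < n)%N -> Ln n.+1 - Ln n <= n%:R^-1.
Proof.
move=> n0; have np : 0 < n%:R :> R by rewrite ltr0n.
rewrite -ln_div ?posrE ?ltr0n//.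
rewrite -natr1 mulrDl divff ?gt_eqF// mul1r; apply: le_ln1Dx.
by rewrite (lt_le_trans (ltrN10 _))// invr_ge0 ltW.
Qed.

Lemma cell_bounds n x : cell n x -> Ln n <= x /\ x <= Ln n.+1.
Proof. by rewrite /cell/= in_itv/= => /andP[? /ltW]. Qed.

Lemma integrable_cell (u : R -> R) n : continuous u ->
  mu.-integrable (cell n) (EFin \o u).
Proof.
move=> cu; apply: (@integrableS _ _ _ mu `[Ln n, Ln n.+1]) => //.
- exact: measurable_itv.
- by apply: subset_itv_co_cc.
- apply: continuous_compact_integrable; first exact: segment_compact.
  exact: continuous_subspaceT.
Qed.

Lemma Rintegral_expR_cell n : (0 < n)%N -> \int[mu]_(x in cell n) expR x = 1.
Proof.
move=> n0; rewrite /cell Rintegral_itv_bndo_bndc; last first.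
  by apply: integrable_cell; exact: continuous_expR.
rewrite /Rintegral (ftc_itv (Ln_lt n0) (F := expR) (f := expR)).
- by rewrite /= !expR_Ln// -natr1; ring.
- exact: continuous_expR.
Qed.

Lemma fine_cell n : (0 < n)%N -> fine (mu (cell n)) = Ln n.+1 - Ln n.
Proof.
by move=> n0; rewrite /cell lebesgue_measure_itv/= lte_fin Ln_lt.
Qed.

(** With s = 1 + d + i t, zterm d t n is the real part of n^(-s), and main_int d t n
    is the real part of the integral of x^(-s) over [n, n + 1], in the variable
    log x. *)
Definition main_int d t n : R :=
  \int[mu]_(x in cell n) (expR (- (d * x)) * cos (t * x)).

Definition zterm d t n : R := expR (- ((1 + d) * Ln n)) * cos (t * Ln n).

Definition dterm K d t n : R :=
  if n \in K then zterm d t n - main_int d t n else 0.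

Lemma continuous_damped d t : continuous (fun x => expR (- (d * x)) * cos (t * x)).
Proof.
apply: (@is_derive_continuous _ _ (fun x => - d * expR (- (d * x)) * cos (t * x) -
  expR (- (d * x)) * (t * sin (t * x)))) => x.
by apply: is_derive_eq; rewrite /GRing.scale/=; ring.
Qed.

(** Both terms are integrals over the cell of e^x, which has mass 1, against
    values of e^(-(1+d)x) cos (t x) taken in the cell.  The latter are of size
    1 / n and vary by a factor of order 1 / n, as the cell has length about 1 / n. *)
Lemma dterm_bound K d t n : 0 <= d -> (0 < n)%N ->
  `|dterm K d t n| <= (1 + d + `|t|) / n%:R ^+ 2.
Proof.
move=> d0 n0; have np : 0 < n%:R :> R by rewrite ltr0n.
rewrite /dterm; case: ifP => _; last first.
  by rewrite normr0 divr_ge0 ?exprn_ge0 ?addr_ge0.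
pose phi x := expR (- ((1 + d) * x)) * cos (t * x).
have cphi : continuous phi by exact: continuous_damped.
have E1 : zterm d t n = \int[mu]_(x in cell n) (phi (Ln n) * expR x).
  rewrite RintegralZl ?Rintegral_expR_cell ?mulr1//.
    exact: measurable_itv.
  by apply: integrable_cell; exact: continuous_expR.
have E2 : main_int d t n = \int[mu]_(x in cell n) (phi x * expR x).
  apply: eq_Rintegral => x _; rewrite /phi mulrAC -expRD; congr (expR _ * _).
  by ring.
have c1 : continuous (fun x => phi (Ln n) * expR x).
  by move=> x; apply: cvgM; [exact: cvg_cst|exact: continuous_expR].
have c2 : continuous (fun x => phi x * expR x).
  by move=> x; apply: cvgM; [exact: cphi|exact: continuous_expR].
have mc : measurable (cell n) by exact: measurable_itv.
rewrite E1 E2 -RintegralB//; [|exact: integrable_cell|exact: integrable_cell].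
have c3 : continuous (fun x => phi (Ln n) * expR x - phi x * expR x).
  by move=> x; apply: cvgB; [exact: c1|exact: c2].
apply: le_trans (le_normr_Rintegral (mu := mu) mc (integrable_cell n c3)) _.
pose C := (1 + d + `|t|) / n%:R ^+ 2.
apply: (@le_trans _ _ (\int[mu]_(x in cell n) (C * expR x))).
  apply: le_Rintegral => //.
  - by apply: integrable_norm; exact: integrable_cell.
  - apply: integrable_cell => x.
    by apply: cvgM; [exact: cvg_cst|exact: continuous_expR].
  - move=> x /cell_bounds[x1 x2].
    rewrite -mulrBl normrM [X in _ * X]ger0_norm ?expR_ge0//.
    rewrite ler_wpM2r ?expR_ge0// /phi.
    have x0 : 0 <= x - Ln n by rewrite subr_ge0.
    have d1 : 0 <= 1 + d by rewrite addr_ge0.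
    rewrite (_ : expR (- ((1 + d) * Ln n)) * _ - _ = expR (- ((1 + d) * Ln n)) *
      (expR (- 0) * cos (t * Ln n) - expR (- ((1 + d) * (x - Ln n))) * cos (t * x))); last first.
      rewrite oppr0 expR0 mulrBr !mulrA -expRD mulr1; congr (_ - expR _ * _).
      by ring.
    rewrite normrM ger0_norm ?expR_ge0// /C -[_ / _ ^+ 2]mulrC expr2 invfM -mulrA.
    apply: ler_pM; rewrite ?expR_ge0//.
      apply: (@le_trans _ _ (expR (- Ln n))); last by rewrite expRN expR_Ln.
      by rewrite ler_expR lerN2 ler_peMl ?Ln_ge0// lerDl.
    apply: le_trans (damped_cos_lipschitz _ _ _ _) _ => //; first exact: mulr_ge0.
    rewrite sub0r normrN -mulrBr !normrM [`|Ln n - x|]distrC.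
    rewrite [`|x - Ln n|]ger0_norm// [`|1 + d|]ger0_norm// -mulrDl.
    rewrite mulrC; apply: ler_pM => //; first exact: addr_ge0.
    by apply: le_trans (Ln_step n0); rewrite lerD2r.
by rewrite RintegralZl ?Rintegral_expR_cell ?mulr1//;
  apply: integrable_cell; exact: continuous_expR.
Qed.

Lemma dterm_lipschitz K d e s t n : 0 <= d -> 0 <= e -> (0 < n)%N ->
  `|dterm K d t n - dterm K e s n| <= 2 * Ln n.+1 * (`|d - e| + `|t - s|).
Proof.
move=> d0 e0 n0; rewrite /dterm.
have L0 := Ln_ge0 n.+1; have Ll := ltW (Ln_lt n0).
have de0 : 0 <= `|d - e| + `|t - s| by rewrite addr_ge0.
case: ifP => _; last by rewrite subr0 normr0 !mulr_ge0.
rewrite (_ : _ - _ - _ = (zterm d t n - zterm e s n) +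
  (main_int e s n - main_int d t n)); last by ring.
apply: le_trans (ler_normD _ _) _.
rewrite -mulrA mulr_natl mulr2n; apply: lerD.
  apply: le_trans (damped_cos_lipschitz _ _ _ _) _.
  - by rewrite mulr_ge0 ?addr_ge0// Ln_ge0.
  - by rewrite mulr_ge0 ?addr_ge0// Ln_ge0.
  rewrite -!mulrBl (_ : 1 + d - (1 + e) = d - e); last by ring.
  rewrite !normrM -mulrDl mulrC; apply: ler_wpM2r => //.
  by rewrite ger0_norm ?Ln_ge0.
have mc : measurable (cell n) by exact: measurable_itv.
have i1 := integrable_cell n (@continuous_damped e s).
have i2 := integrable_cell n (@continuous_damped d t).
rewrite /main_int -RintegralB//.
apply: le_trans (le_normr_Rintegral (mu := mu) mc (integrableB (mu := mu) mc i1 i2)) _.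
apply: (@le_trans _ _ (\int[mu]_(x in cell n) (Ln n.+1 * (`|d - e| + `|t - s|)))).
  apply: le_Rintegral => //.
  - exact: (integrable_norm (integrableB (mu := mu) mc i1 i2)).
  - by apply: integrable_cell => x; exact: cvg_cst.
  - move=> x /cell_bounds[x1 x2].
    have x0 : 0 <= x by exact: le_trans (Ln_ge0 n) x1.
    apply: le_trans (damped_cos_lipschitz _ _ _ _) _; [exact: mulr_ge0|exact: mulr_ge0|].
    rewrite -!mulrBl !normrM -mulrDl mulrC [`|e - d|]distrC [`|s - t|]distrC.
    by apply: ler_wpM2r => //; rewrite ger0_norm.
rewrite Rintegral_cst// fine_cell// ler_piMr ?mulr_ge0//.
apply: le_trans (Ln_step n0) _.
by rewrite invf_le1 ?ltr0n// ler1n.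
Qed.

End zeta_terms.

(** * Series dominated by inverse squares *)

Section quadratic_tails.
Context {R : realType}.

(** 1 / n^2 <= 2 / (n (n + 1)), which telescopes. *)
Lemma inv_sq_telescope (n : nat) : (0 < n)%N ->
  (n%:R ^+ 2)^-1 <= 2 * (n%:R^-1 - n.+1%:R^-1) :> R.
Proof.
move=> n0; have np : 1 <= n%:R :> R by rewrite ler1n.
rewrite -(natr1 n); move: (n%:R : R) np => x x1.
have x0 : 0 < x by lra.
have x10 : 0 < x + 1 by lra.
rewrite (_ : 2 * _ = 2 / (x * (x + 1))); last by field; rewrite !gt_eqF.
rewrite ler_pdivlMr ?mulr_gt0// ler_pdivrMl ?exprn_gt0//; nra.
Qed.

Variables (u : nat -> R) (C : R).
Hypotheses (C0 : 0 <= C) (uC : forall n, (0 < n)%N -> `|u n| <= C / n%:R ^+ 2).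

Lemma series_tail_le N M : (0 < N)%N -> (N <= M)%N ->
  \sum_(N <= n < M) `|u n| <= 2 * C / N%:R.
Proof.
move=> N0 NM.
apply: (@le_trans _ _ (2 * C * (N%:R^-1 - M%:R^-1))); last first.
  by rewrite ler_wpM2l ?mulr_ge0// lerBlDr lerDl invr_ge0.
rewrite -(subnKC NM); elim: (M - N)%N => [|k ih].
  by rewrite addn0 big_geq// subrr mulr0.
rewrite addnS big_nat_recr/= ?leq_addr//.
have Nk : (0 < N + k)%N by rewrite addn_gt0 N0.
apply: le_trans (lerD ih (uC Nk)) _.
have := ler_wpM2l C0 (inv_sq_telescope Nk).
move: ((N + k)%:R^-1) ((N + k).+1%:R^-1) (((N + k)%:R ^+ 2)^-1) => x y z.
by lra.
Qed.

Lemma series_quadratic_cvg : cvgn (series u).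
Proof.
suff H : cvgn (series (fun n => `|u n|)) by exact: normed_cvg H.
apply: nondecreasing_is_cvgn.
  by apply/nondecreasing_seqP => n; rewrite !seriesEnat/= big_nat_recr//= lerDl.
exists (`|u 0%N| + 2 * C) => _ [n _ <-]; rewrite seriesEnat/=.
case: n => [|n]; first by rewrite big_geq// addr_ge0// mulr_ge0.
rewrite big_nat_recl//= lerD2l -[leRHS]divr1.
by have := @series_tail_le 1 n.+1 isT isT; rewrite big_add1/=.
Qed.

Lemma series_quadratic_tail N : (0 < N)%N ->
  `|limn (series u) - series u N| <= 2 * C / N%:R.
Proof.
move=> N0; have cu := series_quadratic_cvg.
apply/ler_addgt0Pr => e e0.
have /cvgrPdist_le /(_ e e0)[M _ HM] := cu.
have /HM /= H : (M <= maxn M N)%N by rewrite leq_maxl.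
rewrite (_ : limn (series u) - series u N =
  (series u (maxn M N) - series u N) + (limn (series u) - series u (maxn M N))); last by ring.
apply: le_trans (ler_normD _ _) _; apply: lerD => //.
rewrite sub_series leq_maxr.
apply: le_trans (ler_norm_sum _ _ _) _.
exact: series_tail_le (leq_maxr M N).
Qed.

End quadratic_tails.

(** * The zeta function up to the line of abscissa 1 *)

Section zeta_kernel.
Context {R : realType}.
Local Notation mu := (@lebesgue_measure R).
Variable K : set nat.
Hypothesis K_pos : K `<=` [set n | (0 < n)%N].
Implicit Types (d e s t x M : R).

Let notin0 : (0%N \in K) = false.
Proof. by apply/negbTE; rewrite notin_setE => /K_pos. Qed.

Let dterm0 d t : dterm K d t 0 = 0.
Proof. by rewrite /dterm notin0. Qed.

Definition Dser d t : R := limn (series (dterm K d t)).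

Let dterm_C d t M n : 0 <= d <= 1 -> `|t| <= M -> (0 < n)%N ->
  `|dterm K d t n| <= (2 + M) / n%:R ^+ 2.
Proof.
move=> /andP[d0 d1] tM n0; apply: le_trans (dterm_bound K t d0 n0) _.
rewrite ler_wpM2r// ?invr_ge0 ?exprn_ge0//; lra.
Qed.

Lemma Dser_cvg d t : 0 <= d <= 1 -> series (dterm K d t) n @[n --> \oo] --> Dser d t.
Proof.
move=> d01; apply: (series_quadratic_cvg (C := 2 + `|t|)).
  by rewrite addr_ge0.
by move=> n n0; apply: dterm_C.
Qed.

Lemma Dser_bound d t M : 0 <= d <= 1 -> `|t| <= M -> `|Dser d t| <= 2 * (2 + M).
Proof.
move=> d01 tM; have M0 : 0 <= M by exact: le_trans tM.
have := @series_quadratic_tail R (dterm K d t) (2 + M) _ _ 1 isT.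
rewrite seriesEnat/= big_nat1 dterm0 subr0 divr1; apply.
  by rewrite addr_ge0.
by move=> n n0; exact: dterm_C.
Qed.

(** Finitely many terms are Lipschitz, and the tails are uniformly small.  That
    d = 0 is included is what makes the correction survive in the limit. *)
Lemma Dser_unif_continuous M e : 0 <= M -> 0 < e ->
  exists2 eta, 0 < eta & forall d d' t s, 0 <= d <= 1 -> 0 <= d' <= 1 ->
    `|t| <= M -> `|s| <= M -> `|d - d'| <= eta -> `|t - s| <= eta ->
    `|Dser d t - Dser d' s| <= e.
Proof.
move=> M0 e0; pose C := 2 + M; have C0 : 0 <= C by rewrite addr_ge0.
pose N := (Num.truncn (8 * C / e)).+1.
have NC : 4 * C / N%:R <= e / 2.
  rewrite ler_pdivrMr ?ltr0n//.
  have := truncnS_gt (8 * C / e); rewrite -/N ltr_pdivrMr// => /ltW H.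
  by lra.
pose W : R := 1 + \sum_(0 <= n < N) 4 * Ln n.+1.
have S0 : 0 <= \sum_(0 <= n < N) 4 * Ln n.+1 :> R.
  by apply: sumr_ge0 => n _; rewrite mulr_ge0// Ln_ge0.
have W0 : 0 < W by rewrite ltr_pwDl.
exists (e / 2 / W); first by rewrite !divr_gt0.
move=> d d' t s d01 d'01 tM sM dd ts.
have t1 : `|Dser d t - series (dterm K d t) N| <= 2 * C / N%:R.
  by apply: series_quadratic_tail => // n n0; exact: dterm_C.
have t2 : `|Dser d' s - series (dterm K d' s) N| <= 2 * C / N%:R.
  by apply: series_quadratic_tail => // n n0; exact: dterm_C.
have t3 : `|series (dterm K d t) N - series (dterm K d' s) N| <= e / 2.
  rewrite !seriesEnat/= -sumrB; apply: le_trans (ler_norm_sum _ _ _) _.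
  apply: (@le_trans _ _ (\sum_(0 <= n < N) 4 * Ln n.+1 * (e / 2 / W))).
    apply: ler_sum => n _; case: n => [|n].
      by rewrite !dterm0 subr0 normr0 !mulr_ge0 ?Ln_ge0 ?invr_ge0// ltW.
    have [/andP[d0 _] /andP[d'0 _]] := (d01, d'01).
    apply: le_trans (dterm_lipschitz K s t d0 d'0 _) _ => //.
    rewrite (_ : 4 * Ln n.+2 * _ = 2 * Ln n.+2 * (e / 2 / W + e / 2 / W)); last by ring.
    by rewrite ler_wpM2l ?mulr_ge0 ?Ln_ge0// lerD.
  rewrite -mulr_suml mulrC mulrAC ler_pdivrMr// ler_wpM2l ?divr_ge0 ?ltW//.
  by rewrite /W; lra.
rewrite (_ : _ - _ = (Dser d t - series (dterm K d t) N) -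
  (Dser d' s - series (dterm K d' s) N) +
  (series (dterm K d t) N - series (dterm K d' s) N)); last by ring.
apply: le_trans (ler_normD _ _) _.
apply: (@le_trans _ _ (4 * C / N%:R + e / 2)); last by lra.
apply: lerD => //; apply: le_trans (ler_normB _ _) _.
by rewrite (_ : 4 * C / N%:R = 2 * C / N%:R + 2 * C / N%:R); [exact: lerD|ring].
Qed.

(** The n such that |x| lies in cell n: a closed formula, which turns membership
    in Lset into a condition on one integer. *)
Definition cell_index x : nat := Num.truncn (expR `|x|).

Lemma cell_indexN x : cell_index (- x) = cell_index x.
Proof. by rewrite /cell_index normrN. Qed.

Lemma cell_indexP n x : (0 < n)%N -> 0 <= x -> (cell_index x == n) = (x \in cell n).
Proof.
move=> n0 x0; rewrite /cell_index truncn_eq ?expR_ge0// ger0_norm//.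
rewrite mem_setE in_itv/= -(@expR_Ln R n)// -(@expR_Ln R n.+1)//.
by rewrite ler_expR ltr_expR.
Qed.

Lemma cell_ge0 n x : cell n x -> 0 <= x.
Proof. by move=> /cell_bounds[+ _]; apply: le_trans; exact: Ln_ge0. Qed.

Lemma Lset_cell_index x : Lset K x <-> K (cell_index x).
Proof.
have cellK y n : K n -> cell n y -> cell_index y = n.
  move=> Kn yn; have n0 : (0 < n)%N by exact: K_pos Kn.
  by apply/eqP; rewrite cell_indexP ?(cell_ge0 yn)//; exact/mem_set.
split=> [[n Kn [xn|xn]]|Kx].
- have xn' : cell n (- x).
    by move: xn; rewrite /cell/= !in_itv/= => /andP[h1 h2]; rewrite lerNr ltrNl h1 h2.
  by rewrite -cell_indexN (cellK _ _ Kn xn').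
- by rewrite (cellK _ _ Kn xn).
- have n0 : (0 < cell_index x)%N by exact: K_pos Kx.
  exists (cell_index x) => //; have [x0|x0] := leP 0 x.
    by right; apply/set_mem; rewrite -cell_indexP.
  left; have : - x \in cell (cell_index x).
    by rewrite -cell_indexP// ?cell_indexN// oppr_ge0 ltW.
  by rewrite mem_setE in_itv/= => /andP[h1 h2]; rewrite /= in_itv/= ltrNl lerNr h1 h2.
Qed.

Lemma measurable_Lset : measurable (Lset K : set R).
Proof.
apply: bigcup_measurable => n _.
by apply: measurableU; exact: measurable_itv.
Qed.

(** The Fourier integral of the characteristic function of Lset K, which in
    general only converges thanks to the Abel weight. *)
Definition Lker d t : R := \int[mu]_x (abel d x * \1_(Lset K) x * cos (t * x)).

Lemma measurable_cell_index : measurable_fun setT (cell_index : R -> nat).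
Proof.
move=> _ B _; rewrite setTI.
have -> : cell_index @^-1` B = \bigcup_(n in B) (cell_index @^-1` [set n]).
  by apply/seteqP; split=> [x Bx|x [n Bn /= ->]//]; exists (cell_index x).
apply: bigcup_measurable => n _.
have [->|n0] := posnP n.
  rewrite (_ : _ @^-1` _ = set0)//; apply/seteqP; split => x //= x0.
  have : (0 < cell_index x)%N by rewrite truncn_gt0 -expR0 ler_expR.
  by rewrite x0.
rewrite (_ : _ @^-1` _ = cell n `|` -%R @^-1` (cell n)).
  apply: measurableU; first exact: measurable_itv.
  by rewrite -[X in measurable X]setTI; apply: oppr_measurable => //; exact: measurable_itv.
apply/seteqP; split=> x /=.
  move=> /eqP; have [x0|x0] := leP 0 x.
    by rewrite cell_indexP// => /set_mem; left.
  by rewrite -cell_indexN cell_indexP// ?oppr_ge0 ?ltW// => /set_mem; right.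
by move=> [xn|xn]; apply/eqP; [|rewrite -cell_indexN];
  rewrite cell_indexP ?(cell_ge0 xn)//; exact/mem_set.
Qed.

Let natb_itv (b : bool) : -1 <= (b%:R : R) <= 1.
Proof. by case: b => /=; apply/andP; split; lra. Qed.

Lemma integrable_cell_weight (P : pred nat) d t : 0 < d ->
  mu.-integrable setT (EFin \o (fun x => abel d x * (P (cell_index x))%:R * cos (t * x))).
Proof.
move=> d0; apply: le_integrable (integrable_abel d0) => //.
  apply/measurable_EFinP; apply: measurable_funM; last first.
    apply: measurableT_comp; last exact: measurable_funM.
    by apply: continuous_measurable_fun; exact: continuous_cos.
  apply: measurable_funM; first exact: measurable_abel.
  have mP : measurable_fun setT (fun n : nat => (P n)%:R : R) by [].
  exact: (measurableT_comp mP measurable_cell_index).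
move=> x _; rewrite /= lee_fin -mulrA normrM ler_piMr// normrM.
rewrite mulr_ile1// ?ler_norml ?cos_geN1 ?cos_le1//.
Qed.

Lemma main_intE d t n : 0 < d -> (0 < n)%N ->
  \int[mu]_x (abel d x * (cell_index x == n)%:R * cos (t * x)) = 2 * main_int d t n.
Proof.
move=> d0 n0; rewrite Rintegral_even; last 2 first.
- exact: (integrable_cell_weight (pred1 n) t d0).
- by move=> x; rewrite abelN cell_indexN mulrN cosN.
congr (_ * _); rewrite Rintegral_mkcond [RHS]Rintegral_mkcond.
apply: eq_Rintegral => x _; rewrite /patch mem_setE in_itv/= andbT.
have [x0|x0] := leP 0 x; last first.
  by rewrite ifF//; apply/negbTE; rewrite notin_setE => /cell_ge0; rewrite leNgt x0.
rewrite cell_indexP//; case: ifP => _; last by rewrite mulr0 mul0r.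
by rewrite mulr1 /abel ger0_norm.
Qed.

Lemma main_int_sum d t N : 0 < d ->
  \int[mu]_x (abel d x * ((cell_index x < N)%N && (cell_index x \in K))%:R * cos (t * x))
  = 2 * \sum_(0 <= n < N | n \in K) main_int d t n.
Proof.
move=> d0; elim: N => [|N ih].
  rewrite big_geq// mulr0; apply: Rintegral_odd => [|x].
    exact: (integrable_cell_weight (fun n => (n < 0)%N && (n \in K)) t d0).
  by rewrite !ltn0 !mulr0 !mul0r oppr0.
rewrite big_mkcond big_nat_recr//= -big_mkcond mulrDr -ih.
have [NK|NK] := ifP; last first.
  rewrite mulr0 addr0; apply: eq_Rintegral => x _; congr (_ * _%:R * _).
  rewrite ltnS leq_eqVlt; case: eqP => //= ->; by rewrite NK andbF.
have N0 : (0 < N)%N by apply: K_pos; exact/set_mem.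
rewrite -main_intE// -RintegralD//; last 2 first.
- exact: (integrable_cell_weight (fun n => (n < N)%N && (n \in K)) t d0).
- exact: (integrable_cell_weight (pred1 N) t d0).
apply: eq_Rintegral => x _; rewrite ltnS leq_eqVlt.
case: eqP => /= [->|_]; first by rewrite NK ltnn /=; ring.
by rewrite mulr0 mul0r addr0.
Qed.

Lemma main_int_cvg d t : 0 < d ->
  \sum_(0 <= n < N | n \in K) main_int d t n @[N --> \oo] --> 2^-1 * Lker d t.
Proof.
move=> d0.
have H : \int[mu]_x (abel d x * ((cell_index x < N)%N && (cell_index x \in K))%:R * cos (t * x))
    @[N --> \oo] --> Lker d t.
  apply: fine_cvg; rewrite /Lker /Rintegral fineK; last first.
    apply: integrable_fin_num => //.
    apply: eq_integrable (integrable_cell_weight (fun n => n \in K) t d0) => // x _.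
    rewrite /= indicE; congr (_ * _%:R * _)%:E.
    by congr nat_of_bool; apply/idP/idP => /set_mem/Lset_cell_index/mem_set.
  apply: (@dominated_cvg _ _ _ mu _ _ _ _ (EFin \o abel d)) => //.
  - move=> N; exact: measurable_int
      (integrable_cell_weight (fun n => (n < N)%N && (n \in K)) t d0).
  - move=> x _; apply: cvg_EFin; first exact: nearW.
    apply: cvg_near_cst; exists (cell_index x).+1 => // N /= xN.
    rewrite xN/= indicE; congr (_ * _%:R * _).
    by congr nat_of_bool; apply/idP/idP => /set_mem/Lset_cell_index/mem_set.
  - exact: integrable_abel.
  - move=> N x _; rewrite /= lee_fin -mulrA normrM ger0_norm ?abel_ge0//.
    rewrite ler_piMr ?abel_ge0// normrM mulr_ile1// ?ler_norml ?cos_geN1 ?cos_le1//.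
rewrite (_ : (fun N => _) = fun N => 2^-1 * \int[mu]_x (abel d x *
    ((cell_index x < N)%N && (cell_index x \in K))%:R * cos (t * x))); last first.
  by apply/funext => N; rewrite main_int_sum// mulKf.
by apply: cvgM; [exact: cvg_cst|exact: H].
Qed.

Lemma zterm_cvg d t : 0 < d <= 1 ->
  \sum_(0 <= n < N | n \in K) zterm d t n @[N --> \oo] -->
  Dser d t + 2^-1 * Lker d t.
Proof.
move=> /andP[d0 d1].
rewrite (_ : (fun N => _) = fun N => series (dterm K d t) N +
    \sum_(0 <= n < N | n \in K) main_int d t n); last first.
  apply/funext => N; rewrite seriesEnat/= [in LHS]big_mkcond [X in _ + X]big_mkcond.
  rewrite -big_split/=; apply: eq_bigr => n _; rewrite /dterm.
  by case: ifP => _; rewrite ?subrK ?addr0.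
by apply: cvgD; [apply: Dser_cvg; rewrite ltW|exact: main_int_cvg].
Qed.

Lemma Ccvg_cvg (u : nat -> R[i]) (l : R[i]) : Ccvg u l ->
  (u n : R[i]^o) @[n --> \oo] --> (l : R[i]^o).
Proof.
move=> [ur ui]; apply/cvgrPdist_le => eps; rewrite ltcE/= => /andP[/eqP ei e0].
have -> : eps = (Re eps)%:C by apply: complexP.
have e2 : 0 < Re eps / 2 by rewrite divr_gt0.
have /cvgrPdist_le /(_ _ e2) Hr := ur.
have /cvgrPdist_le /(_ _ e2) Hi := ui.
near=> n.
rewrite (_ : `|l - u n| = (normc (l - u n))%:C); last by case: (l - u n).
rewrite lecR; apply: le_trans (normc_le _) _.
rewrite ReD ReN ImD ImN [leRHS](splitr (Re eps)); apply: lerD.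
  by near: n; exact: Hr.
by near: n; exact: Hi.
Unshelve. all: by end_near. Qed.

(** Replacing each n^(-s) by the integral of x^(-s) over [n, n + 1] splits the
    zeta function of K into a Fourier integral over Lset K, which may be singular
    as d tends to 0, and a correction that is regular up to d = 0. *)
Lemma Re_zeta d t : 0 < d <= 1 ->
  Re (zeta K ((1 + d) +i* t)) = Dser d t + 2^-1 * Lker d t.
Proof.
move=> d01; have /andP[d0 d1] := d01.
pose z n := cexp (- (((1 + d) +i* t) * (ln n%:R)%:C)) : R[i].
have zRe n : Re (z n) = zterm d t n.
  rewrite /z /cexp ReM /= !(mulr0, mul0r, subr0, addr0, sub0r, add0r).
  by rewrite cosN.
(* zeta is a complex limit, so the imaginary parts have to converge too: they
   are dominated by the terms at t = 0 *)
have zIm n : `|Im (z n)| <= zterm d 0 n.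
  apply: le_trans (Im_le_normc _) _; rewrite /z /cexp normcM normc_real.
  rewrite [X in _ * X](normc_cis _) mulr1 ger0_norm ?expR_ge0//.
  rewrite /zterm mul0r cos0 mulr1 ler_expR ReN ReM /= mulr0 subr0.
  by [].
have ImZ : cvgn (series (fun n => if n \in K then Im (z n) else 0)).
  suff H : cvgn (series (fun n => `|if n \in K then Im (z n) else 0|)).
    exact: normed_cvg H.
  apply: (@series_le_cvg _ _ (fun n => if n \in K then zterm d 0 n else 0)) => //.
  - move=> n; case: ifP => // _; rewrite /zterm mul0r cos0 mulr1.
    exact: expR_ge0.
  - by move=> n; case: ifP => // _; rewrite normr0.
  apply/cvg_ex; exists (Dser d 0 + 2^-1 * Lker d 0).
  have := @zterm_cvg d 0 d01; rewrite (_ : (fun N => _) =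
    series (fun n => if n \in K then zterm d 0 n else 0))//.
  by apply/funext => N; rewrite seriesEnat/= big_mkcond.
have zl : Ccvg (fun N => \sum_(0 <= n < N | n \in K) z n)
    ((Dser d t + 2^-1 * Lker d t) +i*
     limn (series (fun n => if n \in K then Im (z n) else 0))).
  split=> /=.
    rewrite (_ : (fun N => _) = fun N => \sum_(0 <= n < N | n \in K) zterm d t n).
      exact: zterm_cvg.
    apply/funext => N; rewrite (big_morph _ (@ReD R) (erefl : Re 0 = 0)).
    by apply: eq_bigr => n _; exact: zRe.
  rewrite (_ : (fun N => _) = series (fun n => if n \in K then Im (z n) else 0)) //.
  apply/funext => N; rewrite seriesEnat/= (big_morph _ (@ImD R) (erefl : Im 0 = 0)).
  exact: big_mkcond.
by rewrite /zeta (cvg_lim _ (Ccvg_cvg zl)).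
Qed.

End zeta_kernel.

(** * Compactness of equicontinuous classes *)

Section equicontinuous_compact.
Context {R : realType}.
Local Notation mu := (@lebesgue_measure R).
Variables (T : R).
Hypothesis T_gt0 : 0 < T.
Let I : set R := `]- T, T[%classic.
Let J : set R := `[- T, T]%classic.
Implicit Types (h : R -> R[i]).

Definition cutI h : R -> R[i] := patch (fun=> 0) I h.

Let IJ : I `<=` J.
Proof. exact: subset_itv_oo_cc. Qed.

Let measI : measurable I.
Proof. exact: measurable_itv. Qed.

Let muI : (mu I = (2 * T)%:E)%E.
Proof.
rewrite /I lebesgue_measure_itv/= lte_fin.
have -> : - T < T by rewrite (lt_trans _ T_gt0)// oppr_lt0.
by rewrite -EFinB; congr EFin; ring.
Qed.

Lemma nrm2_cutI_bound h c : Cmeas (cutI h) -> 0 <= c ->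
  (forall x, I x -> normc (h x) <= c) -> (nrm2 (cutI h) <= (c ^+ 2 * (2 * T))%:E)%E.
Proof.
move=> mh c0 hc.
apply: (@le_trans _ _ (\int[mu]_(x in I) (c ^+ 2)%:E)%E); last first.
  by rewrite integral_cst//= muI -EFinM.
rewrite /nrm2 [leRHS]integral_mkcond; apply: ge0_le_integral => //.
- by move=> x _; rewrite lee_fin sqr_ge0.
- exact: measurable_nrm2.
- apply/(measurable_restrictT _ measI).
  exact: measurable_cst.
- move=> x _; rewrite /cutI /patch; case: ifPn => [/set_mem xI|_].
    by rewrite lee_fin ler_pXn2r ?nnegrE ?normc_ge0// hc.
  by rewrite normc0 expr0n.
Qed.

Definition modulus (eta : R -> R) h := forall e, 0 < e ->
  forall x y, J x -> J y -> `|x - y| <= eta e -> normc (h x - h y) <= e.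

Lemma modulus_Cmeas eta h : (forall e, 0 < e -> 0 < eta e) -> modulus eta h ->
  Cmeas (cutI h).
Proof.
move=> eta0 mh.
have near_h x : I x -> forall e, 0 < e -> \forall y \near x, normc (h x - h y) <= e.
  move=> Ix e e0.
  have nI : \forall y \near x, I y.
    by apply: open_nbhs_nbhs; split => //; exact: itv_open.
  near=> y; apply: mh => //; [exact: IJ|apply: IJ; near: y; exact: nI|].
  by near: y; apply: cvgr_dist_le; [exact: cvg_id|exact: eta0].
have mr : measurable_fun I (fun x => Re (h x)).
  apply: open_continuous_measurable_fun; first exact: itv_open.
  move=> x /set_mem Ix; apply/cvgrPdist_le => e e0.
  apply: filterS (near_h x Ix e e0) => y; apply: le_trans.
  by rewrite -ReN -ReD; exact: Re_le_normc.
have mi : measurable_fun I (fun x => Im (h x)).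
  apply: open_continuous_measurable_fun; first exact: itv_open.
  move=> x /set_mem Ix; apply/cvgrPdist_le => e e0.
  apply: filterS (near_h x Ix e e0) => y; apply: le_trans.
  by rewrite -ImN -ImD; exact: Im_le_normc.
split.
  rewrite (_ : (fun x => _) = (fun x => Re (h x)) \_ I).
    by apply/(measurable_restrictT _ measI).
  by apply/funext => x; rewrite /cutI /patch; case: ifP.
rewrite (_ : (fun x => _) = (fun x => Im (h x)) \_ I).
  by apply/(measurable_restrictT _ measI).
by apply/funext => x; rewrite /cutI /patch; case: ifP.
Unshelve. all: by end_near. Qed.

Variables (eta : R -> R) (M : R).
Hypotheses (eta0 : forall e, 0 < e -> 0 < eta e) (M0 : 0 <= M).

Definition equi_class : set (L2 R I) := [set u | exists h,
  [/\ modulus eta h, (forall x, J x -> normc (h x) <= M) & u = L2class I (cutI h)]].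

Lemma equi_L2on h : modulus eta h -> (forall x, J x -> normc (h x) <= M) ->
  L2on I (cutI h).
Proof.
move=> mh hM; have mc := modulus_Cmeas eta0 mh; split => //.
  apply: le_lt_trans (ltry (M ^+ 2 * (2 * T))).
  by apply: nrm2_cutI_bound => // x /IJ; exact: hM.
by move=> x Ix; rewrite /cutI patch_out.
Qed.

(** Compactness of [-M, M]. *)
Let ultra_cvg_real (U : Type) (F : set_system U) (f : U -> R) : UltraFilter F ->
  (\forall u \near F, `|f u| <= M) ->
  exists l : R, forall e, 0 < e -> \forall u \near F, `|f u - l| <= e.
Proof.
move=> FU fM.
have := @segment_compact R (- M) M; rewrite compact_ultra => /(_ (f @ F)).
have FF : UltraFilter (f @ F).
  split; first exact: fmap_proper_filter.
  move=> G GP FG; apply/seteqP; split=> [A GA|A /FG//].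
  have [//|FA] := in_ultra_setVsetC (f @^-1` A) FU.
  have /FG GA' : (f @ F) (~` A) by [].
  by have /filter_ex[? []] : G (A `&` ~` A) by exact: filterI.
move=> /(_ FF); case.
  by apply: filterS fM => u; rewrite /= in_itv/= -ler_norml.
move=> l [_ /= fl]; exists l => e e0.
have /cvgrPdist_le /(_ e e0) : f @ F --> l := fl.
by apply: filterS => u; rewrite distrC.
Qed.

(** Arzela-Ascoli: along an ultrafilter the functions converge pointwise since
    they are bounded, and uniformly since they share a modulus of continuity;
    on a bounded interval this is convergence in quadratic mean. *)
Lemma equi_class_compact : compact equi_class.
Proof.
rewrite compact_ultra => F FU FC.
(* an equicontinuous representative of each class *)
pose sel (u : L2 R I) : R -> R[i] := if pselect (equi_class u) is left p
  then projT1 (cid p) else fun=> 0.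
have selP u : equi_class u -> [/\ modulus eta (sel u),
    (forall x, J x -> normc (sel u x) <= M) & u = L2class I (cutI (sel u))].
  by move=> Cu; rewrite /sel; case: pselect => // p; case: cid.
have lim_ex x : exists l : R[i], J x -> forall e, 0 < e ->
    \forall u \near F, normc (sel u x - l) <= e.
  have [Jx|nJx] := pselect (J x); last by exists 0.
  have sM : \forall u \near F, normc (sel u x) <= M.
    by apply: filterS FC => u /selP[_ uM _]; exact: uM.
  have [lr Hr] : exists l : R, forall e, 0 < e ->
      \forall u \near F, `|Re (sel u x) - l| <= e.
    apply: ultra_cvg_real; apply: filterS sM => u; apply: le_trans.
    exact: Re_le_normc.
  have [li Hi] : exists l : R, forall e, 0 < e ->
      \forall u \near F, `|Im (sel u x) - l| <= e.
    apply: ultra_cvg_real; apply: filterS sM => u; apply: le_trans.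
    exact: Im_le_normc.
  exists (lr +i* li) => _ e e0; have e2 : 0 < e / 2 by rewrite divr_gt0.
  apply: filterS2 (Hr _ e2) (Hi _ e2) => u ur ui.
  apply: le_trans (normc_le _) _; rewrite ReD ReN ImD ImN /=.
  by rewrite [leRHS](splitr e) lerD.
pose H x : R[i] := projT1 (cid (lim_ex x)).
have HP x : J x -> forall e, 0 < e -> \forall u \near F, normc (sel u x - H x) <= e.
  exact: projT2 (cid (lim_ex x)).
have Hmod : modulus eta H.
  move=> e e0 x y Jx Jy xy; apply/ler_addgt0Pr => r r0.
  have r2 : 0 < r / 2 by rewrite divr_gt0.
  have /filter_ex[u [[/selP[um _ _] ux] uy]] : F (equi_class `&`
      [set u | normc (sel u x - H x) <= r / 2] `&`
      [set u | normc (sel u y - H y) <= r / 2]).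
    by apply: filterI; [apply: filterI; [exact: FC|exact: HP]|exact: HP].
  have := um e e0 x y Jx Jy xy.
  rewrite (_ : H x - H y = (sel u x - sel u y) - (sel u x - H x) + (sel u y - H y)); last by ring.
  move=> h; apply: le_trans (normcD _ _) _.
  apply: le_trans (lerD (normcB _ _) (lexx _)) _.
  by move: ux uy h => /=; lra.
have HM x : J x -> normc (H x) <= M.
  move=> Jx; apply/ler_addgt0Pr => r r0.
  have /filter_ex[u [/selP[_ uM _] ux]] : F (equi_class `&`
      [set u | normc (sel u x - H x) <= r]).
    by apply: filterI; [exact: FC|exact: HP].
  rewrite (_ : H x = sel u x - (sel u x - H x)); last by ring.
  by apply: le_trans (normcB _ _) _; apply: lerD => //; exact: uM.
exists (L2class I (cutI H)); split; first by exists H.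
rewrite /= -[X in X --> _]/(id @ F).
have near_eq : {near F, (fun u => L2class I (cutI (sel u))) =1 id}.
  by apply: filterS FC => u /selP[_ _ <-].
apply: cvg_trans (near_eq_cvg near_eq) _.
apply: L2class_cvg.
- exact: equi_L2on.
- by apply: filterS FC => u /selP[um uM _]; exact: equi_L2on.
move=> e e0.
(* a tolerance r for the sup norm giving e for the squared norm *)
pose r := Num.sqrt (e / (2 * T)).
have T20 : 0 < 2 * T by rewrite mulr_gt0.
have r0 : 0 < r by rewrite sqrtr_gt0 divr_gt0.
have r3 : 0 < r / 3 by rewrite divr_gt0.
have er := eta0 r3.
(* the points p j form a net of mesh eta (r / 3), on which pointwise convergence
   is uniform; equicontinuity does the rest *)
pose N := (Num.truncn (2 * T / eta (r / 3))).+1.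
pose p (j : 'I_N) : R := - T + j%:R * eta (r / 3).
have near_p : \forall u \near F, forall j : 'I_N, J (p j) ->
    normc (sel u (p j) - H (p j)) <= r / 3.
  apply: filter_forall => j.
  have [Jp|nJp] := pselect (J (p j)); last by apply: nearW => u /nJp.
  by apply: filterS (HP _ Jp _ r3).
apply: filterS2 FC near_p => u /selP[um uM _] up.
rewrite (_ : (fun x => _) = cutI (fun x => sel u x - H x)); last first.
  by apply/funext => x; rewrite /cutI /patch; case: ifP => // _; rewrite subrr.
apply: (@le_trans _ _ (r ^+ 2 * (2 * T))%:E); last first.
  by rewrite lee_fin sqr_sqrtr ?divfK ?gt_eqF// divr_ge0// ltW.
have mH := modulus_Cmeas eta0 Hmod; have mu_ := modulus_Cmeas eta0 um.
apply: nrm2_cutI_bound; [|exact: ltW|].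
  rewrite (_ : cutI _ = fun x => cutI (sel u) x - cutI H x); first exact: CmeasB.
  by apply/funext => x; rewrite /cutI /patch; case: ifP => // _; rewrite subrr.
move=> x /IJ Jx.
have /andP[x1 x2] : - T <= x <= T by move: Jx; rewrite /J /= in_itv.
have xT0 : 0 <= (x + T) / eta (r / 3) by apply: divr_ge0; [lra|exact: ltW].
have jN : (Num.truncn ((x + T) / eta (r / 3)) < N)%N.
  rewrite ltnS truncn_ge_nat; last by rewrite divr_ge0// ltW.
  apply: (@le_trans _ _ ((x + T) / eta (r / 3))).
    by have /andP[] := truncn_itv xT0.
  by rewrite ler_pM2r ?invr_gt0//; lra.
pose j := Ordinal jN.
have /andP[j1 j2] := truncn_itv xT0.
have px : p j <= x.
  by rewrite /p /=; move: j1; rewrite ler_pdivlMr//; lra.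
have xp : x <= p j + eta (r / 3).
  rewrite /p /=; move: j2; rewrite ltr_pdivrMr// -natr1 mulrDl mul1r => /ltW.
  lra.
have Jp : J (p j).
  rewrite /J /= in_itv/=; apply/andP; split; last by lra.
  by rewrite /p lerDl mulr_ge0// ltW.
have xpj : `|x - p j| <= eta (r / 3).
  by rewrite ger0_norm ?subr_ge0//; lra.
have h1 := um _ r3 x (p j) Jx Jp xpj.
have h2 := Hmod _ r3 x (p j) Jx Jp xpj.
have h3 := up j Jp.
rewrite (_ : sel u x - H x = (sel u x - sel u (p j)) - (H x - H (p j)) +
  (sel u (p j) - H (p j))); last by ring.
apply: le_trans (normcD _ _) _.
apply: le_trans (lerD (normcB _ _) (lexx _)) _.
lra.
Qed.

End equicontinuous_compact.

(** * The correction operator *)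

Section correction_operator.
Context {R : realType}.
Local Notation mu := (@lebesgue_measure R).
Variables (K : set nat) (T : R).
Hypotheses (K_pos : K `<=` [set n | (0 < n)%N]) (T_gt0 : 0 < T).
Let I : set R := `]- T, T[%classic.
Let J : set R := `[- T, T]%classic.
Implicit Types (g : R -> R[i]) (d e s t x : R).

Let IJ : I `<=` J.
Proof. exact: subset_itv_oo_cc. Qed.

Lemma continuous_Dser d : 0 <= d <= 1 -> continuous (Dser K d).
Proof.
move=> d01 x; apply/cvgrPdist_le => e e0.
have M0 : 0 <= `|x| + 1 by rewrite addr_ge0.
have [eta eta0 H] := Dser_unif_continuous K_pos M0 e0.
near=> y; apply: H => //.
- by rewrite lerDl.
- have : `|x - y| <= 1 by near: y; apply: cvgr_dist_le; [exact: cvg_id|].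
  have := ler_normB x (x - y); rewrite opprB addrC subrK; lra.
- by rewrite subrr normr0 ltW.
Unshelve. all: by end_near. Qed.

Lemma L2on_L2f g : L2on I g -> L2f g.
Proof. by case. Qed.

Lemma L2on_Cint g : L2on I g -> Cint g.
Proof.
move=> lg; have := Cint_itv (- T) T false true (L2on_L2f lg).
rewrite (_ : patch _ _ _ = g)//; apply/funext => x; rewrite /patch.
case: ifPn => // /negP xI; case: lg => _ _ -> // xI'; apply: xI; exact/mem_set.
Qed.

Lemma L2on_norm1 g : L2on I g ->
  \int[mu]_x normc (g x) <= 2 * T + fine (nrm2 g).
Proof.
move=> lg; have TT : - T < T by rewrite (lt_trans _ T_gt0)// oppr_lt0.
have := integral_itv_le TT ltr01 (L2on_L2f lg).
rewrite divr1 mul1r (_ : T - - T = 2 * T); last by ring.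
rewrite Rintegral_mkcond (_ : _ \_ _ = fun x => normc (g x))//.
apply/funext => x; rewrite /patch; case: ifPn => // xJ.
case: lg => _ _ ->; first by rewrite normc0.
by move=> /IJ xJ'; move: xJ; rewrite notin_setE.
Qed.

Definition corr d g t : R[i] :=
  Cintegral setT (fun x => g x * (Dser K d (t - x))%:C).

Let dist_IJ t x : J t -> I x -> `|t - x| <= 2 * T.
Proof.
rewrite /J /I /= !in_itv/= => /andP[t1 t2] /andP[x1 x2].
by rewrite ler_norml; apply/andP; split; lra.
Qed.

Lemma Cint_corr d g t : 0 <= d <= 1 -> L2on I g -> J t ->
  Cint (fun x => g x * (Dser K d (t - x))%:C).
Proof.
move=> d01 lg Jt; have [mg ig] := L2on_Cint lg.
pose B := 2 * (2 + 2 * T).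
apply: (@Cint_dom _ _ (fun x => normc (g x) * B)) => [| |x].
- apply: CmeasM => //; apply: Cmeas_real.
  apply: measurableT_comp; last exact: measurable_funB.
  by apply: continuous_measurable_fun; exact: continuous_Dser.
- exact: (integrableZr measurableT B ig).
- rewrite normcM normc_real; have [Ix|nIx] := pselect (I x).
    by rewrite ler_wpM2l ?normc_ge0// Dser_bound// dist_IJ.
  by case: lg => _ _ ->//; rewrite normc0 !mul0r.
Qed.

Lemma corr_bound d g t : 0 <= d <= 1 -> L2on I g -> J t ->
  normc (corr d g t) <= 2 * (2 * (2 + 2 * T) * \int[mu]_x normc (g x)).
Proof.
move=> d01 lg Jt; have [mg ig] := L2on_Cint lg; have ic := Cint_corr d01 lg Jt.
apply: le_trans (normc_Cintegral ic) _; rewrite ler_pM2l//.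
rewrite mulrC -RintegralZr//; apply: le_Rintegral => //.
- by case: ic.
- exact: (integrableZr measurableT (2 * (2 + 2 * T)) ig).
move=> x _; rewrite normcM normc_real; have [Ix|nIx] := pselect (I x).
  by rewrite ler_wpM2l ?normc_ge0// Dser_bound// dist_IJ.
by case: lg => _ _ ->//; rewrite normc0 !mul0r.
Qed.

(** The same eta serves all g whose integral norm is bounded, which gives both
    the compactness at d = 0 and the limit as d tends to 0. *)
Lemma corr_unif_continuous e : 0 < e -> exists2 eta, 0 < eta &
  forall d d' t s g, 0 <= d <= 1 -> 0 <= d' <= 1 -> L2on I g -> J t -> J s ->
    `|d - d'| <= eta -> `|t - s| <= eta ->
    normc (corr d g t - corr d' g s) <= 2 * (e * \int[mu]_x normc (g x)).
Proof.
move=> e0; have T20 : 0 <= 2 * T by rewrite mulr_ge0// ltW.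
have [eta eta0 H] := Dser_unif_continuous K_pos T20 e0.
exists eta => // d d' t s g d01 d'01 lg Jt Js dd ts.
have [mg ig] := L2on_Cint lg.
have [ic1 ic2] := (Cint_corr d01 lg Jt, Cint_corr d'01 lg Js).
rewrite /corr -CintegralB//.
have ic : Cint (fun x => g x * (Dser K d (t - x))%:C - g x * (Dser K d' (s - x))%:C).
  have [m i] := CintD ic1 (CintM (-1) ic2).
  split; first by apply: CmeasB; [case: ic1|case: ic2].
  by apply: eq_integrable i => // x _; rewrite /= mulN1r.
apply: le_trans (normc_Cintegral ic) _; rewrite ler_pM2l// mulrC -RintegralZr//.
apply: le_Rintegral => //.
- by case: ic.
- exact: (integrableZr measurableT e ig).
move=> x _; rewrite -mulrBr normcM.
rewrite (_ : _ - _ = (Dser K d (t - x) - Dser K d' (s - x))%:C); last first.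
  by apply: complexP => //=; rewrite subrr.
rewrite normc_real; have [Ix|nIx] := pselect (I x).
  rewrite ler_wpM2l ?normc_ge0//; apply: H => //; try exact: dist_IJ.
  by rewrite (_ : t - x - (s - x) = t - s)//; ring.
by case: lg => _ _ ->//; rewrite normc0 !mul0r.
Qed.

Definition corr_fun d g : R -> R[i] := cutI T (fun t => (pi^-1)%:C * corr d g t).

Definition corr_sup A : R := pi^-1 * (2 * (2 * (2 + 2 * T) * A)).

Lemma corr_equicontinuous A : 0 <= A -> exists2 eta : R -> R,
  (forall e, 0 < e -> 0 < eta e) &
  forall d g, 0 <= d <= 1 -> L2on I g -> \int[mu]_x normc (g x) <= A ->
    modulus T eta (fun t => (pi^-1)%:C * corr d g t) /\
    (forall x, J x -> normc ((pi^-1)%:C * corr d g x) <= corr_sup A).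
Proof.
move=> A0; have pi0 : 0 <= pi^-1 :> R by rewrite invr_ge0 pi_ge0.
pose c e := e / (2 * (pi^-1 * A + 1)).
have pA : 0 <= pi^-1 * A by exact: mulr_ge0.
have c0 e : 0 < e -> 0 < c e.
  by move=> e0; rewrite divr_gt0// mulr_gt0// ltr_wpDl.
have /choice[eta H] : forall e, exists eta, 0 < e -> 0 < eta /\
    forall d d' t s g, 0 <= d <= 1 -> 0 <= d' <= 1 -> L2on I g -> J t -> J s ->
    `|d - d'| <= eta -> `|t - s| <= eta ->
    normc (corr d g t - corr d' g s) <= 2 * (c e * \int[mu]_x normc (g x)).
  move=> e; have [e0|ne0] := pselect (0 < e); last by exists 0 => /ne0.
  by have [eta eta0 H] := corr_unif_continuous (c0 e e0); exists eta.
exists eta => [e e0|d g d01 lg gA]; first by have [] := H e e0.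
split=> [e e0 x y Jx Jy xy|x Jx].
  have [eta0 He] := H e e0.
  rewrite -mulrBr normcM normc_real ger0_norm//.
  have := He d d x y g d01 d01 lg Jx Jy; rewrite subrr normr0 => /(_ (ltW eta0) xy) H1.
  apply: le_trans (ler_wpM2l pi0 H1) _.
  apply: (@le_trans _ _ (pi^-1 * (2 * (c e * A)))).
    by rewrite ler_wpM2l// ler_pM2l// ler_wpM2l// ltW// c0.
  rewrite (_ : pi^-1 * (2 * (c e * A)) = e * (pi^-1 * A) / (pi^-1 * A + 1)); last first.
    by rewrite /c; move: (pi^-1) pA => p pA'; field; rewrite gt_eqF// ltr_wpDl.
  rewrite ler_pdivrMr ?ltr_wpDl// ler_pM2l//; lra.
rewrite normcM normc_real ger0_norm// /corr_sup ler_wpM2l//.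
apply: le_trans (corr_bound d01 lg Jx) _; rewrite ler_pM2l// ler_wpM2l//.
by rewrite mulr_ge0// addr_ge0// mulr_ge0// ltW.
Qed.

Lemma corr_sup_ge0 A : 0 <= A -> 0 <= corr_sup A.
Proof.
move=> A0; rewrite /corr_sup; apply: mulr_ge0; first by rewrite invr_ge0 pi_ge0.
have := T_gt0; move=> T0; apply: mulr_ge0 => //; apply: mulr_ge0 => //.
by apply: mulr_ge0 => //; lra.
Qed.

Lemma norm1_ge0 g : 0 <= \int[mu]_x normc (g x).
Proof. by apply: Rintegral_ge0 => x _; exact: normc_ge0. Qed.

Lemma corr_L2on d g : 0 <= d <= 1 -> L2on I g -> L2on I (corr_fun d g).
Proof.
move=> d01 lg; have [eta eta0 H] := corr_equicontinuous (norm1_ge0 g).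
have [h1 h2] := H d g d01 lg (lexx _).
exact: (equi_L2on T_gt0 eta0 (corr_sup_ge0 (norm1_ge0 g)) h1 h2).
Qed.

Definition corr_op (u : L2 R I) : L2 R I := L2class I (corr_fun 0 (repr u)).

Let d00 : 0 <= (0 : R) <= 1.
Proof. by rewrite lexx ler01. Qed.

Lemma corr_fun_lin a f g : L2on I f -> L2on I g ->
  corr_fun 0 (fun x => a * f x + g x) = fun x => a * corr_fun 0 f x + corr_fun 0 g x.
Proof.
move=> lf lg; apply/funext => t; rewrite /corr_fun /cutI /patch.
case: ifPn => [/set_mem/IJ Jt|_]; last by rewrite mulr0 addr0.
rewrite mulrCA -mulrDr; congr (_ * _).
have [icf icg] := (Cint_corr d00 lf Jt, Cint_corr d00 lg Jt).
rewrite /corr -CintegralZ// -CintegralD//; last exact: CintM.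
by congr (Cintegral setT _); apply/funext => x; rewrite mulrDl mulrA.
Qed.

Lemma corr_fun_ae d f g : 0 <= d <= 1 -> L2on I f -> L2on I g ->
  {ae mu, forall x, f x = g x} -> corr_fun d f = corr_fun d g.
Proof.
move=> d01 lf lg fg; have aef := ae_filter_ringOfSetsType mu.
apply/funext => t; rewrite /corr_fun /cutI /patch.
case: ifPn => [/set_mem/IJ Jt|//]; congr (_ * _).
have [icf icg] := (Cint_corr d01 lf Jt, Cint_corr d01 lg Jt).
apply: Cintegral_ae; [by case: icf|by case: icg|].
by apply: filterS fg => x ->.
Qed.

Lemma repr_ae_eq A (w : L2 R A) f : w = L2class A f -> L2on A f ->
  {ae mu, forall x, (repr w : R -> R[i]) x = f x}.
Proof. by move=> ->; exact: L2class_ae. Qed.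

Lemma corr_op_linear : linear corr_op.
Proof.
move=> a u v; have [lu lv] := (L2on_repr u, L2on_repr v).
rewrite /corr_op -L2class_lin; [|exact: corr_L2on|exact: corr_L2on].
rewrite -corr_fun_lin//; congr (L2class I _).
apply: corr_fun_ae => //; first exact: L2on_repr.
  exact: L2on_lin.
apply: repr_ae_eq; last exact: L2on_lin.
by rewrite L2class_lin// !L2class_repr.
Qed.

HB.instance Definition _ := GRing.isLinear.Build R[i] (L2 R I) (L2 R I) _ corr_op
  corr_op_linear.

Definition corr_linear : {linear L2 R I -> L2 R I} := corr_op.

(** The functions of a bounded subset of L2 have bounded integral norms, so their
    images share a bound and a modulus of continuity. *)
Lemma corr_op_compact : compact_operator corr_linear.
Proof.
move=> B [M [Mreal HM]].
pose N := Re M + 1.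
have BN u : B u -> Num.sqrt (fine (nrm2 (repr u))) <= N.
  move=> Bu.
  have nu : `|u| = (Num.sqrt (fine (nrm2 (repr u))))%:C.
    by rewrite -{1}(L2class_repr u) L2class_norm//; exact: L2on_repr.
  suff : `|u| <= N%:C by rewrite nu lecR.
  apply: HM Bu.
  move: Mreal; rewrite realE !lecE /= => Mi.
  have Im0 : Im M = 0 by case/orP: Mi => /andP[/eqP-> _].
  by rewrite ltcE /= Im0 eqxx /= ltrDl.
pose A := 2 * T + N ^+ 2.
have A0 : 0 <= A by rewrite addr_ge0 ?sqr_ge0// mulr_ge0// ltW.
have [eta eta0 H] := corr_equicontinuous A0.
exists (equi_class eta (corr_sup A)).
  move=> _ [u Bu <-]; have lu := L2on_repr u.
  have uA : \int[mu]_x normc (repr u x) <= A.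
    apply: le_trans (L2on_norm1 lu) _; rewrite lerD2l.
    have n0 : 0 <= fine (nrm2 (repr u)) by rewrite fine_ge0// nrm2_ge0.
    rewrite -[leLHS]sqr_sqrtr// ler_pXn2r ?nnegrE ?sqrtr_ge0 ?BN//.
    exact: le_trans (sqrtr_ge0 _) (BN u Bu).
  by have [h1 h2] := H 0 _ d00 lu uA; exists (fun t => (pi^-1)%:C * corr 0 (repr u) t).
have cE := equi_class_compact T_gt0 eta0 (corr_sup_ge0 A0).
split => //; apply: compact_closed => //; exact: norm_hausdorff.
Qed.

End correction_operator.

(** * The decomposition *)

Section decomposition.
Context {R : realType}.
Local Notation mu := (@lebesgue_measure R).
Variables (K : set nat) (T : R).
Hypotheses (K_pos : K `<=` [set n | (0 < n)%N]) (T_gt0 : 0 < T).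
Let I : set R := `]- T, T[%classic.
Let J : set R := `[- T, T]%classic.
Let L : set R := Lset K.
Implicit Types (f g h k : R -> R[i]) (d e t x : R).

Let IJ : I `<=` J.
Proof. exact: subset_itv_oo_cc. Qed.

(** The spectral cutoff to Lset of a function, made integrable by the Abel
    weight so that its inverse transform is an honest integral. *)
Definition damped d g xi : R[i] := (abel d xi)%:C * patch (fun=> 0) L (ft g) xi.

Let mL : measurable L. Proof. exact: measurable_Lset. Qed.

(** By Fubini, the inverse transform of the damped cutoff is a convolution with
    Lker. *)
Lemma ft_damped d g x : 0 < d -> Cint g ->
  [/\ Cint (damped d g),
  Cint (fun y => g y * (Lker K d (x - y))%:C) &
  ft (damped d g) (- x) = ((2 * pi)^-1)%:C *
    Cintegral setT (fun y => g y * (Lker K d (x - y))%:C)].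
Proof.
move=> d0 gi; have [mg gi'] := gi; pose m xi := abel d xi * \1_L xi.
have mm : measurable_fun setT m.
  by apply: measurable_funM; [exact: measurable_abel|exact: measurable_indic].
have m_le xi : `|m xi| <= abel d xi.
  by rewrite normrM ger0_norm ?abel_ge0// ler_piMr ?abel_ge0// indicE; case: (_ \in _);
    rewrite ?normr1 ?normr0.
have im : mu.-integrable setT (EFin \o m).
  apply: le_integrable (integrable_abel d0) => //; first exact/measurable_EFinP.
  by move=> xi _; rewrite /= lee_fin [leRHS]ger0_norm ?abel_ge0.
have mN xi : m (- xi) = m xi.
  rewrite /m abelN; congr (_ * _); rewrite !indicE; congr (nat_of_bool _)%:R.
  by apply/idP/idP => /set_mem/(Lset_cell_index K_pos) H; apply/mem_set/(Lset_cell_index K_pos);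
    move: H; rewrite cell_indexN.
have dE xi : damped d g xi = (m xi)%:C * (ft_const%:C * ftint g xi).
  rewrite /damped /patch /m indicE /ft; case: ifP => _; first by rewrite mulr1.
  by rewrite !mulr0 mul0r.
pose M := 2 * \int[mu]_y normc (g y).
have iker z : Cint (fun xi => (m xi)%:C * cis (z * xi) * ftint g xi).
  apply: (@Cint_dom _ _ (fun xi => abel d xi * M)) => [| |xi].
  - apply: CmeasM; last exact: Cmeas_ftint.
    apply: CmeasM; first exact: Cmeas_real.
    by apply: Cmeas_cis; exact: measurable_funM.
  - exact: (integrableZr measurableT M (integrable_abel d0)).
  - rewrite !normcM normc_cis mulr1 normc_real.
    by apply: ler_pM; rewrite ?normc_ge0 ?normc_ftint.
have E1 z : (fun xi => damped d g xi * cis (z * xi)) =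
    fun xi => ft_const%:C * ((m xi)%:C * cis (z * xi) * ftint g xi).
  by apply/funext => xi; rewrite dE; ring.
split.
- have := CintM ft_const%:C (iker 0); rewrite -E1.
  rewrite (_ : (fun xi => _ * _) = damped d g)//.
  by apply/funext => xi; rewrite mul0r /cis cos0 sin0 mulr1.
- have mF : Cmeas (fun z : R * R => (m z.1)%:C * (g z.2 * cis ((x - z.2) * z.1))).
    apply: CmeasM; first by apply: (Cmeas_fst (f := fun xi => (m xi)%:C)); exact: Cmeas_real.
    apply: CmeasM; first exact: Cmeas_snd.
    by apply: Cmeas_cis; apply: measurable_funM => //; exact: measurable_funB.
  rewrite (_ : (fun y => _) = fun y =>
      Cintegral setT (fun xi => (m xi)%:C * (g y * cis ((x - y) * xi)))); last first.
    apply/funext => y.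
    rewrite (_ : (fun xi => _) = fun xi => g y * ((m xi)%:C * cis ((x - y) * xi))); last first.
      by apply/funext => xi; ring.
    rewrite CintegralZ ?Cintegral_even_cis//.
    apply: (@Cint_dom _ _ (fun xi => `|m xi|)).
    + apply: CmeasM; first exact: Cmeas_real.
      by apply: Cmeas_cis; exact: measurable_funM.
    + exact: integrable_norm.
    + by move=> xi; rewrite normcM normc_cis mulr1 normc_real.
  apply: (Cint_fubini_G mF (a := fun xi => `|m xi|) (b := fun y => normc (g y))) => //.
    exact: integrable_norm.
  by move=> xi y; rewrite !normcM normc_cis mulr1 normc_real.
rewrite /ft /ftint -ft_const_sq expr2 rmorphM -mulrA; congr (_ * _).
rewrite (_ : (fun xi => _ * cis _) = fun xi => damped d g xi * cis (x * xi)); last first.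
  by apply/funext => xi; rewrite mulrN opprK mulrC [x * xi]mulrC mulrC.
rewrite E1 CintegralZ//; congr (_ * _).
rewrite (weighted_inversion x gi im); congr (Cintegral setT _).
by apply/funext => y; rewrite Cintegral_even_cis.
Qed.

Let L2f_damped d g : 0 < d -> Cint g -> L2f g -> L2f (damped d g).
Proof.
move=> d0 gi lg; have [mh h2] := L2f_patch mL (L2f_ft gi lg).
have md : Cmeas (damped d g).
  by apply: CmeasM => //; apply: Cmeas_real; exact: measurable_abel.
split => //; apply: le_lt_trans h2; apply: nrm2_le => // xi.
rewrite normcM normc_real ger0_norm ?abel_ge0// ler_piMl ?normc_ge0//.
by rewrite abel_le1// ltW.
Qed.

(** Dominated convergence along the sequence 1 / (n + 1), then monotonicity of the
    Abel weight in d. *)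
Lemma damped_cvg g : Cint g -> L2f g -> forall e, 0 < e -> exists2 d0, 0 < d0 &
  forall d, 0 < d -> d <= d0 ->
    (nrm2 (fun xi => damped d g xi - patch (fun=> 0) L (ft g) xi)%R <= e%:E)%E.
Proof.
move=> gi lg e e0; set h := patch _ _ _.
have lh : L2f h := L2f_patch mL (L2f_ft gi lg); have [mh h2] := lh.
have dn n : Cmeas (damped (inv_succ n) g).
  by case: (L2f_damped (inv_succ_gt0 n) gi lg).
have dE d xi : damped d g xi - h xi = - ((1 - abel d xi)%:C * h xi).
  rewrite /damped -/h (_ : (1 - abel d xi)%:C = 1 - (abel d xi)%:C); first by ring.
  by apply: complexP => //=; rewrite subrr.
have nE d xi : 0 < d -> normc (damped d g xi - h xi) = (1 - abel d xi) * normc (h xi).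
  move=> d0; rewrite dE normcN' normcM normc_real ger0_norm// subr_ge0.
  by rewrite abel_le1// ltW.
have [|||||N HN] := @nrm2_dominated _ (fun n xi => damped (inv_succ n) g xi - h xi) h
    _ _ _ _ _ _ e0 => //.
- by move=> n; exact: CmeasB.
- move=> n xi; rewrite nE ?inv_succ_gt0// ler_piMl ?normc_ge0//.
  by rewrite lerBlDr lerDl abel_ge0.
- by move=> xi; have := CcvgB (Ccvg_abel (h xi) xi) (Ccvg_cst (h xi)); rewrite subrr.
exists (inv_succ N); first exact: inv_succ_gt0.
move=> d d0 dN; apply: le_trans (HN N (leqnn _)).
have [md _] := L2f_damped d0 gi lg.
apply: nrm2_le; [exact: CmeasB|exact: CmeasB|move=> xi].
rewrite !nE ?inv_succ_gt0// ler_wpM2r ?normc_ge0// lerD2l lerN2 ler_expR lerN2.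
by rewrite ler_wpM2r.
Qed.

(** The splitting of the zeta function by Re_zeta, read on the operator. *)
Lemma Zdelta_fun d (u : L2 R I) : 0 < d <= 1 ->
  Zdelta K d u = L2class I (fun t => corr_fun K T d (repr u) t +
    cutI T (fun t => ft (damped d (repr u)) (- t)) t).
Proof.
move=> d01; have /andP[d0 d1] := d01; have lu := L2on_repr u.
have ui := L2on_Cint lu.
congr (L2class I _); apply/funext => t; rewrite /corr_fun /cutI /patch.
case: ifPn => [/set_mem/IJ Jt|_]; last by rewrite addr0.
have [_ il ->] := ft_damped t d0 ui.
have ic : Cint (fun x => repr u x * (Dser K d (t - x))%:C).
  by apply: (Cint_corr K_pos _ lu Jt); rewrite (ltW d0).
rewrite Cintegral_mkcond.
transitivity ((pi^-1)%:C * Cintegral setT (fun x => repr u x * (Dser K d (t - x))%:C +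
    (2^-1 : R)%:C * (repr u x * (Lker K d (t - x))%:C))).
  congr (_ * Cintegral setT _); apply/funext => x; rewrite /patch.
  case: ifPn => [xI|xI].
    rewrite (Re_zeta K_pos)// (_ : (_ + _)%:C = (Dser K d (t - x))%:C +
      (2^-1 : R)%:C * (Lker K d (t - x))%:C); first by ring.
    by rewrite -rmorphM -rmorphD.
  case: lu => _ _ ->; first by rewrite !mul0r mulr0 addr0.
  by move=> xI'; move: xI; rewrite mem_set.
rewrite CintegralD//; last exact: CintM.
rewrite CintegralZ// mulrDr; congr (_ + _).
by rewrite mulrA -rmorphM/= [in RHS]invfM [in RHS](mulrC 2^-1).
Qed.

Lemma L2on_cutI h : L2f h -> L2on I (cutI T h).
Proof.
move=> lh; have [mc c2] := L2f_patch (measurable_itv `]- T, T[) lh.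
by split=> [||x xI]; [exact: mc|exact: c2|rewrite /cutI patch_out].
Qed.

Lemma chiE A B E (u : L2 R A) f : measurable E -> E `<=` B -> L2f f ->
  {ae mu, forall x, (repr u : R -> R[i]) x = f x} ->
  chi B E u = L2class B (patch (fun=> 0) E f).
Proof.
move=> mE EB lf uf; have aef := ae_filter_ringOfSetsType mu.
have lp h : L2f h -> L2on B (patch (fun=> 0) E h).
  move=> /(L2f_patch mE)[mh h2]; split => // x Bx.
  by rewrite patch_out// => /EB.
apply/L2class_eqP; [apply: lp; exact: L2f_repr|exact: lp|].
by apply: filterS uf => x ux; rewrite /patch ux.
Qed.

Lemma spectral_cutoffE (g : L2 R I) k :
  isF (patch (fun=> 0) L (ft (repr g))) k ->
  chi I I (fourier_inv (chi setT L (fourier (chi setT setT g)))) =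
  L2class I (cutI T (fun t => k (- t))).
Proof.
move=> Hk; have aef := ae_filter_ringOfSetsType mu.
have lg := L2on_repr g; have gi := L2on_Cint lg; have lg2 := L2on_L2f lg.
have [lf lH] := (L2f_ft gi lg2, L2f_patch mL (L2f_ft gi lg2)).
have setTon f : L2f f -> L2on setT f by move=> ?; apply/L2on_setT.
have aeL2 f : L2f f -> {ae mu, forall x, f x = (repr (L2class setT f) : R -> R[i]) x}.
  by move=> /setTon/L2class_ae; apply: filterS => x ->.
have aeL2' f : L2f f -> {ae mu, forall x, (repr (L2class setT f) : R -> R[i]) x = f x}.
  by move=> /setTon/L2class_ae.
have E0 : chi setT setT g = L2class setT (repr g).
  rewrite (chiE (f := repr g))//; last exact: aeW.
  by rewrite patch_setT.
have isFr f h : L2f f -> isF f h -> isF (repr (L2class setT f)) h.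
  move=> lf' fh; have [mf _] := lf'; have [mr _] := L2f_repr (L2class setT f).
  exact: (isF_ae_l mf mr fh (aeL2 _ lf')).
rewrite E0 (fourierE (isFr _ _ lg2 (isF_Cint gi lg2))).
rewrite (chiE (B := setT) (E := L) (f := ft (repr g)))//; last exact: aeL2'.
rewrite (fourier_invE (isFr _ _ lH Hk)).
have lk := L2f_isF lH Hk; have [mk k2] := lk.
have lkN : L2f (fun x => k (- x)).
  by split; [exact: CmeasN_comp|rewrite nrm2N_comp].
apply: chiE => //; [exact: measurable_itv|exact: aeL2'].
Qed.

Lemma corr_funB d d' g :
  (fun t => corr_fun K T d g t - corr_fun K T d' g t) =
  cutI T (fun t => (pi^-1)%:C * (corr K d g t - corr K d' g t)).
Proof.
apply/funext => t; rewrite /corr_fun /cutI /patch.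
case: (_ \in _); last exact: subrr.
exact: (esym (mulrBr _ (corr K d g t) (corr K d' g t))).
Qed.

(** The correction converges uniformly on I, because its kernel is uniformly
    continuous up to d = 0; the spectral part converges because the transform is
    bounded in L2. *)
Lemma Zdelta_cvg (g : L2 R I) k :
  isF (patch (fun=> 0) L (ft (repr g))) k ->
  Zdelta K d g @[d --> 0^'+] -->
    L2class I (fun t => corr_fun K T 0 (repr g) t + cutI T (fun t => k (- t)) t).
Proof.
move=> Hk; have d00 : 0 <= (0 : R) <= 1 by rewrite lexx ler01.
have lg := L2on_repr g; have gi := L2on_Cint lg; have lg2 := L2on_L2f lg.
have lH := L2f_patch mL (L2f_ft gi lg2).
have [mk k2] := L2f_isF lH Hk.
have lN h : L2f h -> L2f (fun x => h (- x)).
  by move=> [mh h2]; split; [exact: CmeasN_comp|rewrite nrm2N_comp].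
have lD f h : L2on I f -> L2on I h -> L2on I (fun x => f x + h x).
  move=> [mf f2 f0] [mh h2 h0]; split; [exact: CmeasD|exact: nrm2D_lty|].
  by move=> x xI; rewrite f0// h0// addr0.
have lft d : 0 < d -> L2f (ft (damped d (repr g))).
  move=> d0; have [di _ _] := ft_damped 0 d0 gi.
  exact: L2f_ft di (L2f_damped d0 gi lg2).
have near1 (e : R) : 0 < e -> \forall d \near 0^'+, 0 < d <= e.
  by move=> e0; near=> d; apply/andP; split; near: d; [exact: nbhs_right_gt|exact: nbhs_right_le].
pose Z d : R -> R[i] := fun t => corr_fun K T d (repr g) t +
    cutI T (fun t => ft (damped d (repr g)) (- t)) t.
have near_eq : \forall d \near 0^'+, L2class I (Z d) = Zdelta K d g.
  by apply: filterS (near1 1 ltr01) => d d01; rewrite (Zdelta_fun g d01).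
apply: cvg_trans (near_eq_cvg near_eq) _.
have lc d : 0 <= d <= 1 -> L2on I (corr_fun K T d (repr g)).
  by move=> d01; exact: corr_L2on.
have lck : L2on I (cutI T (fun t => k (- t))) by apply: L2on_cutI; exact: lN.
have lcd d : 0 < d -> L2on I (cutI T (fun t => ft (damped d (repr g)) (- t))).
  by move=> d0; apply: L2on_cutI; apply: lN; exact: lft.
apply: L2class_cvg.
- by apply: lD => //; exact: lc.
- apply: filterS (near1 1 ltr01) => d /andP[d0 d1]; apply: lD; last exact: lcd.
  by apply: lc; rewrite (ltW d0).
move=> e e0.
(* e / 4 for each of the two parts, in view of the factor 2 of nrm2D; c is the
   matching bound in the sup norm, and r the one on the kernel *)
pose A := \int[mu]_x normc (repr g x); have A0 : 0 <= A := norm1_ge0 _.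
have T0 := T_gt0; have pi0 : 0 < pi^-1 :> R by rewrite invr_gt0 pi_gt0.
pose c := Num.sqrt (e / 4 / (2 * T)).
have c0 : 0 < c by rewrite sqrtr_gt0 !divr_gt0// mulr_gt0.
have cE : c ^+ 2 * (2 * T) = e / 4.
  rewrite sqr_sqrtr; last by rewrite ltW// !divr_gt0// mulr_gt0.
  by rewrite divfK// gt_eqF// mulr_gt0.
pose r := c / (pi^-1 * 2 * (A + 1)).
have r0 : 0 < r by rewrite divr_gt0// !mulr_gt0// ltr_wpDl.
have rE : pi^-1 * (2 * (r * A)) <= c.
  rewrite (_ : pi^-1 * (2 * (r * A)) = c * A / (A + 1)); last first.
    rewrite /r; move: pi0; move: (pi^-1) => p p0; field.
    by rewrite !gt_eqF// ltr_wpDl.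
  rewrite ler_pdivrMr ?ltr_wpDl// ler_pM2l//; lra.
have [eta eta0 Heta] := corr_unif_continuous K_pos T_gt0 r0.
have e128 : 0 < e / 4 / 32 by rewrite !divr_gt0.
have [d0 d0_gt0 Hd0] := damped_cvg gi lg2 e128.
near=> d.
have /andP[dgt0 d1] : 0 < d <= 1 by near: d; exact: near1.
have d_eta : d <= eta by near: d; exact: nbhs_right_le.
have dd0 : d <= d0 by near: d; exact: nbhs_right_le.
have d01 : 0 <= d <= 1 by rewrite (ltW dgt0).
have [[mcd _ _] [mc0 _ _]] := (lc d d01, lc 0 d00).
have [[mhd _ _] [mhk _ _]] := (lcd d dgt0, lck).
rewrite (_ : (fun t => Z d t - _) = fun t =>
    (corr_fun K T d (repr g) t - corr_fun K T 0 (repr g) t) +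
    (cutI T (fun t => ft (damped d (repr g)) (- t)) t - cutI T (fun t => k (- t)) t));
  last by apply/funext => t; rewrite /Z opprD addrACA.
have H1 : (nrm2 (fun t => corr_fun K T d (repr g) t - corr_fun K T 0 (repr g) t)%R <=
    (e / 4)%:E)%E.
  have dE := corr_funB d 0 (repr g).
  rewrite dE -cE; apply: nrm2_cutI_bound => //; [|exact: ltW|].
    by rewrite -dE; exact: CmeasB.
  move=> x /IJ Jx; rewrite normcM normc_real gtr0_norm//.
  apply: le_trans rE; rewrite ler_pM2l//; apply: Heta => //.
    by rewrite subr0 gtr0_norm.
  by rewrite subrr normr0 ltW.
have H2 : (nrm2 (fun t => cutI T (fun t => ft (damped d (repr g)) (- t)) t -
    cutI T (fun t => k (- t)) t)%R <= (e / 4)%:E)%E.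
  have [di _ _] := ft_damped 0 dgt0 gi.
  have ld := L2f_damped dgt0 gi lg2; have [mf _] := lft d dgt0.
  have mB : Cmeas (fun t => ft (damped d (repr g)) t - k t) by exact: CmeasB.
  apply: (@le_trans _ _ (nrm2 (fun t => ft (damped d (repr g)) t - k t)%R)).
    rewrite -(nrm2N_comp mB); apply: nrm2_le; [exact: CmeasB|exact: (CmeasN_comp mB)|].
    move=> x; rewrite /cutI /patch; case: (_ \in _) => //.
    by rewrite subrr normc0 normc_ge0.
  apply: le_trans (isF_dist ld lH (isF_Cint di ld) Hk) _.
  apply: le_trans (lee_wpmul2l _ (Hd0 d dgt0 dd0)) _; first by rewrite lee_fin.
  by rewrite -EFinM lee_fin mulrC divfK.
apply: le_trans (nrm2D _ _) _; [exact: CmeasB|exact: CmeasB|].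
apply: le_trans (lee_wpmul2l _ (leeD H1 H2)) _; first by rewrite lee_fin.
by rewrite -EFinD -EFinM lee_fin; lra.
Unshelve. all: by end_near. Qed.

Lemma Zop_decomposition (g : L2 R I) :
  Zop K g = chi I I (fourier_inv (chi setT L (fourier (chi setT setT g)))) +
    corr_op K g.
Proof.
have lg := L2on_repr g; have gi := L2on_Cint lg; have lg2 := L2on_L2f lg.
have lH := L2f_patch mL (L2f_ft gi lg2).
have [k Hk] := isF_exists lH; have [mk k2] := L2f_isF lH Hk.
rewrite (spectral_cutoffE Hk) /Zop.
rewrite (cvg_lim (@norm_hausdorff _ _) (Zdelta_cvg Hk)) addrC.
rewrite -[corr_op K g]scale1r /corr_op -L2class_lin.
- by congr (L2class I _); apply/funext => t; rewrite mul1r.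
- by apply: corr_L2on => //; rewrite lexx ler01.
- by apply: L2on_cutI; split; [exact: CmeasN_comp|rewrite nrm2N_comp].
Qed.

End decomposition.

Local Close Scope complex_scope.

Theorem theorem1 (R : realType) (K : set nat) (T : R)
    (K_pos : K `<=` [set n | (0 < n)%N]) (T_gt0 : 0 < T) :
  let I : set R := `]- T, T[%classic in
  exists Phi : {linear L2 R I -> L2 R I},
    compact_operator Phi /\
    forall g : L2 R I,
      Zop K g =
        chi I I (fourier_inv (chi setT (Lset K) (fourier (chi setT setT g)))) +
        Phi g.
Proof.
move=> I; exists (corr_linear K_pos T_gt0); split; first exact: corr_op_compact.
by move=> g; exact: Zop_decomposition.
Qed.
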